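(* There are universal constants $c,C>0$ with the following property. Fix $n\in\mathbb N$ and $p\ge1$, and suppose that there exists $m\in\mathbb N$ such that $m$ divides $n$ and $\max\{p,2\}\le m\le e^p$. Then there exists a canonically positioned normed space $\mathbf Y=(\mathbb R^n,\|\cdot\|_{\mathbf Y})$ such that $$\forall x\in\mathbb R^n,\quad c\|x\|_{\ell_p^n}\le\|x\|_{\mathbf Y}\le C\|x\|_{\ell_p^n},\qquad\text{and}\qquad\mathrm{iq}(B_{\mathbf Y})\le C\sqrt n.$$
   Context: $B_{\mathbf Y}$ is the closed unit ball of $\mathbf Y$. The isoperimetric quotient of a convex body $K\subseteq\mathbb R^n$ is $\mathrm{iq}(K)=\mathrm{vol}_{n-1}(\partial K)/\mathrm{vol}_n(K)^{\frac{n-1}{n}}$. Canonically positioned: let $\mathsf{Isom}(\mathbf Y)$ be the group of linear isometric automorphisms of $\mathbf Y$. A finite dimensional normed space $\mathbf Y$ is canonically positioned if any two $\mathsf{Isom}(\mathbf Y)$-invariant scalar products on $\mathbf Y$ are proportional to each other. When $\mathbf Y=(\mathbb R^n,\|\cdot\|_{\mathbf Y})$ is said to be canonically positioned, it is always also assumed that the standard scalar product on $\mathbb R^n$ is $\mathsf{Isom}(\mathbf Y)$-invariant, i.e., that $\mathsf{Isom}(\mathbf Y)$ is a subgroup of the orthogonal group $\mathsf O_n$. *)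

(* Defs.v *)
From HB Require Import structures.
From mathcomp Require Import all_boot all_order all_algebra.
From mathcomp Require Import all_classical all_reals all_analysis.

Set Implicit Arguments.
Unset Strict Implicit.
Unset Printing Implicit Defensive.

Import Order.TTheory GRing.Theory Num.Theory.
Import numFieldNormedType.Exports.

Local Open Scope classical_set_scope.
Local Open Scope ring_scope.

(* R^n is 'rV[R]_n. The library topology on it comes from the sup norm, hence is
   the usual one; the Euclidean metric below is explicit (l2_norm). *)

Section Norms.
Context {R : realType} {n : nat}.
Implicit Types (x y : 'rV[R]_n) (N : 'rV[R]_n -> R).

Definition is_norm N : Prop :=
  [/\ forall x y, N (x + y) <= N x + N y,
      forall (a : R) x, N (a *: x) = `|a| * N x &
      forall x, N x = 0 -> x = 0].

Definition unit_ball N : set 'rV[R]_n := [set x | N x <= 1].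

Definition lp_norm (p : R) x : R := (\sum_(i < n) `|x 0 i| `^ p) `^ p^-1.

Definition std_dot x y : R := \sum_(i < n) x 0 i * y 0 i.

Definition l2_norm x : R := Num.sqrt (std_dot x x).

End Norms.

Section CanonicalPosition.
Context {R : realType} {n : nat}.
Implicit Types (N : 'rV[R]_n -> R).

Definition Isom N : set {linear 'rV[R]_n -> 'rV[R]_n} :=
  [set f | bijective f /\ forall x, N (f x) = N x].

Definition Isom_invariant N (B : 'rV[R]_n -> 'rV[R]_n -> R) : Prop :=
  forall f, Isom N f -> forall x y, B (f x) (f y) = B x y.

(* The first conjunct is the definition for an abstract finite dimensional
   space; the second one is the standing convention for norms on R^n. *)
Definition canonically_positioned N : Prop :=
  (forall B1 B2 : {dot 'rV[R]_n for idfun},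
      Isom_invariant N B1 -> Isom_invariant N B2 ->
      exists a : R, forall x y, B1 x y = a * B2 x y) /\
  Isom_invariant N std_dot.

End CanonicalPosition.

Section Volume.
Context {R : realType}.
Local Open Scope ereal_scope.

(* The n-fold product of the Lebesgue measure on R. *)
Fixpoint lebesgue_tuple (n : nat) : set (n.-tuple (measurableTypeR R)) -> \bar R :=
  match n with
  | 0%N => dirac [tuple]
  | n'.+1 => pushforward (@lebesgue_measure R \x @lebesgue_tuple n')
      (fun xt : measurableTypeR R * n'.-tuple (measurableTypeR R) =>
         [the n'.+1.-tuple (measurableTypeR R) of xt.1 :: xt.2])
  end.

Definition vol (n : nat) (A : set 'rV[R]_n) : \bar R :=
  lebesgue_tuple [set t : n.-tuple R | A (\row_(i < n) tnth t i)].

Definition diam (n : nat) (A : set 'rV[R]_n) : \bar R :=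
  ereal_sup [set (l2_norm (x - y))%:E | x in A & y in A].

(* diam set0 = -oo, and x ^+ 0 = 1: the case distinction makes the empty set
   free in every dimension, so that the case d = 0 is the counting measure. *)
Definition hausdorff_cost (d n : nat) (A : set 'rV[R]_n) : \bar R :=
  if pselect (A = set0) then 0 else diam A ^+ d.

Definition hausdorff_pre (d n : nat) (delta : R) (A : set 'rV[R]_n) : \bar R :=
  ereal_inf [set \sum_(0 <= k <oo) hausdorff_cost d (F k) |
             F in [set F : (set 'rV[R]_n)^nat |
                   A `<=` \bigcup_k F k /\ forall k, diam (F k) <= delta%:E]].

(* d-dimensional Hausdorff measure in R^n for the Euclidean distance. The factor
   vol(B_2^d) / 2^d is the usual normalization: on R^d one gets the Lebesgue
   measure, by the isodiametric inequality. *)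
Definition hausdorff (d n : nat) (A : set 'rV[R]_n) : \bar R :=
  vol (unit_ball (@l2_norm R d)) * ((2%:R ^- d)%R)%:E *
  ereal_sup [set hausdorff_pre d delta A | delta in [set delta : R | (0 < delta)%R]].

Definition boundary (n : nat) (A : set 'rV[R]_n) : set 'rV[R]_n :=
  closure A `\` interior A.

(* The value is in [0, +oo], so that an infinite surface area is not collapsed
   to a real number. *)
Definition iq (n : nat) (K : set 'rV[R]_n) : \bar R :=
  hausdorff n.-1 (boundary K) / (vol K `^ (n.-1%:R / n%:R)).

End Volume.

(* Main.v *)
Require Import Defs.
From HB Require Import structures.
From mathcomp Require Import all_boot all_order all_algebra.
From mathcomp Require Import all_classical all_reals all_analysis.
From mathcomp Require Import measurable_realfun lra.
Set Implicit Arguments.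
Unset Strict Implicit.
Unset Printing Implicit Defensive.
Import Order.TTheory GRing.Theory Num.Theory.
Import numFieldNormedType.Exports.
Local Open Scope classical_set_scope.
Local Open Scope ring_scope.

(** The unit ball of Y is, up to scaling, a sublevel set of a separable convex function
    Psi(x) = phi(x_1) + ... + phi(x_n), where phi is a smooth even substitute for the p-th
    power and the level is found by averaging.

    The potential. Let q be the integer part of p, let L(u) = u + u^2/2 + ... + u^q/q, the
    truncation of - log(1 - u), and let phi(t) = L(u(t)) - L(u(0)) with
    u(t) = (sqrt(1 + t^2) / 2)^(p/q). The last term of L makes phi(t) comparable to |t|^p,
    up to factors C^p, for large |t| (phi_power_lower, phi_power_upper). On the other hand
    L' <= exp L (geom_poly_le_expR), so that |phi'| <= |t| exp(L(u(t))): the derivative is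
    controlled by an exponential of phi with constants that do not depend on p, which fails
    for |t|^p itself. Moreover phi(t) >= (|t| - 1)/4, so all the one-dimensional integrals
    of exp(- k phi) and of phi'^2 exp(- 4 phi) are bounded above uniformly in p, and that of
    exp(- 4 phi) is bounded below.

    The norm. For a n <= s <= B n the body K = {Psi <= s} lies between two multiples of
    n^(1/p) times the unit ball of l_p^n (sublevel_of_lp_norm_le, lp_norm_le_of_sublevel), so
    the gauge of n^(-1/p) K is equivalent to the l_p norm. It is invariant under signed
    permutations of the coordinates. This forces invariant scalar products to be
    proportional, and an averaging of Hilbert-Schmidt norms over signed permutations shows
    that every linear isometry is orthogonal (canonically_positioned_of_symmetric).

    The surface area. For a convex function Phi whose gradient grows along rays and a level
    s >= Phi(0) + sigma, the area of {Phi = s} is at most 8 / (k sigma) times the integral of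
    |grad Phi| over the body {Phi <= s} dilated by 1 + 2k (hausdorff_level_le). Indeed, by
    Vitali's covering theorem it suffices to sum r^(n-1) over disjoint small balls B(x, r)
    centred on the level set. Over each of them one erects a cylinder on a disc of the
    tangent hyperplane at x, in the direction of x and of relative height k. Its height is
    k <grad Phi(x), x> / |grad Phi(x)| >= k sigma / |grad Phi(x)|, so that the integral of
    |grad Phi| over it is at least a constant times k sigma r^(n-1). The cylinders lie in
    cones over disjoint pieces of the level set, hence are disjoint.

    The choice of s. With sigma = a n and k = 1/n, it remains to find a level s with
    a n <= s <= B n such that the integral of |grad Psi(l x)| over {Psi <= s}, l = 1 + 2/n, is
    O(sqrt n) times the volume. By the inequality of arithmetic and geometric means one may
    bound the integral of |grad Psi(l x)|^2 by O(n) times the volume instead. Since p <= n,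
    l^p is bounded, and the product structure gives
      int |grad Psi(l x)|^2 exp(- 4 Psi) <= C n z^n,   z = int exp(- 4 phi).
    The left side dominates the sum over integers s of exp(- 4 s) times the integral of
    |grad Psi(l x)|^2 over {Psi <= s}. The sum over a n <= s <= B n of
    exp(- 4 s) vol {Psi <= s} is at least c z^n, because the regions Psi < a n and Psi > b n
    carry little of the mass of exp(- 4 Psi) (exp_Psi_split). Comparing the two sums gives s
    (exists_isoperimetric_level). Finally vol(K)^(1/n) <= C turns the area bound into
    iq <= C sqrt n (iq_le). *)

(** * Lebesgue measure on tuples *)

Section TupleMeasure.
Context {R : realType}.
Local Open Scope ereal_scope.
Notation T n := (n.-tuple (measurableTypeR R)).
Notation leb1 := (@lebesgue_measure R).

Definition consT n (xt : measurableTypeR R * T n) : T n.+1 := [tuple of xt.1 :: xt.2].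
Lemma measurable_consT n : measurable_fun setT (@consT n).
Proof. exact: (@measurable_cons _ _ _ _ _ n). Qed.

Lemma lebesgue_tupleS n : @lebesgue_tuple R n.+1 =
  pushforward (leb1 \x @lebesgue_tuple R n) (@consT n).
Proof. by []. Qed.

Definition cubeT n (a b : R) : set (T n) := [set t | forall i, `[a, b]%classic (tnth t i)].
Lemma measurable_cubeT n a b : measurable (@cubeT n a b).
Proof.
rewrite (_ : cubeT a b = \big[setI/setT]_(i < n) ((fun t => tnth t i) @^-1` `[a, b]%classic)).
  apply: bigsetI_measurable => i _; rewrite -[X in measurable X]setTI.
  by apply: measurable_tnth => //; exact: measurable_itv.
apply/seteqP; split => t; rewrite -bigcap_seq /=.
  by move=> H i _; exact: H.
by move=> H i; apply: H; rewrite /= mem_index_enum.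
Qed.
Lemma cubeT_cons n a b : @consT n @^-1` cubeT a b = `[a, b]%classic `*` cubeT a b.
Proof.
apply/seteqP; split => -[x t] /=.
  move=> H; split; first exact: (H ord0).
  by move=> i; have := H (lift ord0 i); rewrite /= /consT /= tnthS.
move=> [Hx Ht] i; have [->|i0] := eqVneq i ord0; first exact: Hx.
have [j ->] : exists j : 'I_n, i = lift ord0 j.
  by case: (unliftP ord0 i) i0 => [j ->|->]; [exists j|rewrite eqxx].
by rewrite /consT /= tnthS; exact: Ht.
Qed.

Section SigmaFinitePack.
Context d (X : measurableType d) (mu : {measure set X -> \bar R}).
Hypothesis sf : sigma_finite setT mu.
Definition sigma_finite_copy : set X -> \bar R := mu.
HB.instance Definition _ := Measure.copy sigma_finite_copy mu.
HB.instance Definition _ := Measure_isSigmaFinite.Build _ _ _ sigma_finite_copy sf.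

(** Product measures need a factor that is bundled as sigma-finite; this bundles a
    measure whose sigma-finiteness is only a hypothesis, as it is inside an induction. *)
Lemma sigma_finite_measure_of :
  exists nu : {sigma_finite_measure set X -> \bar R}, mu = nu :> (set X -> \bar R).
Proof. by exists sigma_finite_copy. Qed.
End SigmaFinitePack.

(** Being a measure and being sigma-finite go together in the induction: one more
    coordinate gives a product measure only because the previous one is sigma-finite. The
    cubes [- i, i]^n, of finite volume, are the exhaustion, so their volumes are computed on
    the way. *)
Lemma lebesgue_tuple_is_measure n :
  exists2 mu : {sigma_finite_measure set (T n) -> \bar R}, @lebesgue_tuple R n = mu &
    forall a b, (a <= b)%R -> mu (cubeT a b) = ((b - a) ^+ n)%:E.
Proof.
elim: n => [|n [mu E cE]].
  exists (dirac [tuple]) => // a b _; rewrite /= expr0 /dirac /= indicE mem_set //.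
  by move=> [].
have m := @measurable_consT n.
pose p := measure_function_pushforward__canonical__measure_function_Measure (leb1 \x mu) m.
have pE a b : (a <= b)%R -> p (cubeT a b) = ((b - a) ^+ n.+1)%:E.
  move=> ab; rewrite /p /= /pushforward cubeT_cons product_measure1E //; last exact: measurable_cubeT.
  have LE : leb1 `[a, b]%classic = (b - a)%:E.
    rewrite lebesgue_measure_itv /= lte_fin; case: ltP => // ba.
    by suff -> : b = a; [rewrite subrr|apply/eqP; rewrite eq_le ab ba].
  by rewrite cE // (_ : _ `[a, b]%classic = (b - a)%:E) // exprS EFinM.
have sf : sigma_finite setT (p : set _ -> _).
  exists (fun i => cubeT (- i%:R) (i%:R)).
    apply/esym; rewrite -subTset => t _.
    have [N NP] : exists N : nat, forall i, (`|tnth t i| <= N%:R)%R.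
      exists (\max_(i < n.+1) `|archimedean.Num.ceil `|tnth t i|%R|)%N => i.
      apply: (@le_trans _ _ (`|archimedean.Num.ceil `|tnth t i|%R|%:R)).
        have h : (0 <= archimedean.Num.ceil `|tnth t i|%R)%R by rewrite ceil_ge0 // (lt_le_trans _ (normr_ge0 _)) ?ltrN10.
        by rewrite pmulrn gez0_abs // ceil_ge.
      by rewrite ler_nat; exact: (leq_bigmax i).
    by exists N => // i /=; rewrite in_itv /= -ler_norml.
  move=> i; split; first exact: measurable_cubeT.
  have H : (- i%:R <= i%:R :> R)%R by apply: (@le_trans _ _ 0%R); rewrite ?oppr_le0.
  by rewrite [X in (X < _)%E](pE _ _ H) ltry.
have [q qE] := sigma_finite_measure_of sf.
exists q; first by rewrite lebesgue_tupleS E -qE.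
by move=> a b ab; rewrite -qE pE.
Qed.

Let lebesgue_tuple_set0 n : @lebesgue_tuple R n set0 = 0.
Proof. by have [mu -> _] := lebesgue_tuple_is_measure n. Qed.
Let lebesgue_tuple_ge0 n (A : set (T n)) : 0 <= @lebesgue_tuple R n A.
Proof. by have [mu -> _] := lebesgue_tuple_is_measure n. Qed.
Let lebesgue_tuple_semi_sigma_additive n : semi_sigma_additive (@lebesgue_tuple R n).
Proof. by have [mu -> _] := lebesgue_tuple_is_measure n; exact: measure_semi_sigma_additive. Qed.
HB.instance Definition _ n := isMeasure.Build _ _ _ (@lebesgue_tuple R n) (lebesgue_tuple_set0 n) (@lebesgue_tuple_ge0 n) (@lebesgue_tuple_semi_sigma_additive n).
Let lebesgue_tuple_sigma_finite n : sigma_finite setT (@lebesgue_tuple R n).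
Proof. by have [mu -> _] := lebesgue_tuple_is_measure n; exact: sigma_finiteT. Qed.
HB.instance Definition _ n := Measure_isSigmaFinite.Build _ _ _ (@lebesgue_tuple R n) (@lebesgue_tuple_sigma_finite n).

Lemma lebesgue_tuple_cube n a b : (a <= b)%R ->
  @lebesgue_tuple R n (cubeT a b) = ((b - a) ^+ n)%:E.
Proof. by have [mu -> h] := lebesgue_tuple_is_measure n; exact: h. Qed.

Definition sectionvol n (A : set (T n.+1)) (x : measurableTypeR R) : \bar R :=
  lebesgue_tuple [set t : T n | A (consT (x, t))].

Lemma lebesgue_tuple_consE n (A : set (T n.+1)) :
  lebesgue_tuple A = \int[leb1]_x sectionvol A x.
Proof.
rewrite lebesgue_tupleS /pushforward /product_measure1.
by apply: eq_integral => x _ /=; congr (lebesgue_tuple _); apply/seteqP; split=> t /=; rewrite /xsection /= ?in_setE.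
Qed.

Lemma measurable_lebesgue_tuple_section n (A : set (T n.+1)) : measurable A ->
  measurable_fun setT (sectionvol A).
Proof.
move=> mA.
have mA' : measurable (@consT n @^-1` A).
  by rewrite -[X in measurable X]setTI; apply: measurable_consT.
have := measurable_fun_xsection (@lebesgue_tuple R n) mA'.
congr measurable_fun; apply/funext => x /=; rewrite /sectionvol; congr (lebesgue_tuple _).
by apply/seteqP; split=> t /=; rewrite /xsection /= ?in_setE.
Qed.

Lemma integral_lebesgue_tuple_cons n (f : T n.+1 -> \bar R) :
  measurable_fun setT f -> (forall t, 0 <= f t) ->
  \int[@lebesgue_tuple R n.+1]_t f t =
  \int[leb1]_x \int[@lebesgue_tuple R n]_t f (consT (x, t)).
Proof.
move=> mf f0; rewrite lebesgue_tupleS.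
have mfc : measurable_fun setT (f \o @consT n).
  exact: measurableT_comp mf (@measurable_consT n).
rewrite (ge0_integral_pushforward (@measurable_consT n) (leb1 \x @lebesgue_tuple R n)) //.
rewrite preimage_setT.
have F := fubini_tonelli1 (m1 := leb1) (m2 := @lebesgue_tuple R n) (f \o @consT n) mfc (fun _ => f0 _).
by rewrite F.
Qed.

Section affine1.
Variables (l c : R) (l0 : (0 < l)%R).
Definition aff1 (x : measurableTypeR R) : measurableTypeR R := (l * x + c)%R.
Lemma measurable_aff1 : measurable_fun setT aff1.
Proof. by apply: measurable_funD => //; exact: measurable_funM. Qed.

Lemma lebesgue_measure_aff1 (A : set (measurableTypeR R)) : measurable A ->
  leb1 (aff1 @^-1` A) = (l^-1)%:E * leb1 A.
Proof.
move=> mA.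
have ln0 : (0 <= l)%R by exact: ltW.
pose mu := mscale (NngNum ln0) (measure_function_pushforward__canonical__measure_function_Measure leb1 measurable_aff1).
have H : leb1 A = mu A.
  apply: lebesgue_measure_unique => // X [[a b]] _ <- /=.
  rewrite /mu /mscale /= /pushforward.
  have -> : aff1 @^-1` `]a, b]%classic = `]((a - c) / l)%R, ((b - c) / l)%R]%classic.
    apply/seteqP; split => x /=; rewrite !in_itv /= ltr_pdivrMr // ler_pdivlMr // /aff1 ![(x * l)%R]mulrC ltrBlDr lerBrDr //.
  rewrite !lebesgue_measure_itv /= !lte_fin.
  rewrite ltr_pM2r ?invr_gt0 // ltrD2r.
  case: ifP => _; last by rewrite mule0.
  rewrite -!EFinB -EFinM; congr EFin.
  by rewrite -mulrBl mulrC divfK ?gt_eqF //; lra.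
rewrite H /mu /mscale /= /pushforward muleA -EFinM mulVf ?gt_eqF // mul1e //.
Qed.

Lemma integral_aff1 (f : measurableTypeR R -> \bar R) :
  measurable_fun setT f -> (forall t, 0 <= f t) ->
  \int[leb1]_x f (aff1 x) = (l^-1)%:E * \int[leb1]_x f x.
Proof.
move=> mf f0.
have li0 : (0 <= l^-1)%R by rewrite invr_ge0 ltW.
rewrite -(ge0_integral_mscale leb1 measurableT (NngNum li0)) //.
rewrite -[in LHS](preimage_setT aff1) -(ge0_integral_pushforward measurable_aff1 leb1 (D := setT)) //.
apply: eq_measure_integral => [|H A mA _]; first exact: measurable_aff1.
exact: lebesgue_measure_aff1.
Qed.
End affine1.

(** The translation vector is indexed by nat, so that it can be shifted when the first
    coordinate is split off. *)
Definition affT n (l : R) (c : nat -> R) (t : T n) : T n :=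
  [tuple (l * tnth t i + c i)%R | i < n].

Lemma measurable_affT n l c : measurable_fun setT (@affT n l c).
Proof.
apply/measurable_fun_tnthP => i.
rewrite (_ : _ \o _ = fun t => (l * tnth t i + c i)%R); last first.
  by apply/funext => t /=; rewrite tnth_mktuple.
apply: measurable_funD => //; apply: measurable_funM => //.
exact: measurable_tnth.
Qed.

Lemma affT_cons n l c x (t : T n) :
  affT l c (consT (x, t)) = consT ((l * x + c 0%N)%R, affT l (c \o succn) t).
Proof.
apply/eq_from_tnth => i; rewrite tnth_mktuple.
have [->|i0] := eqVneq i ord0; first by rewrite /consT /= /tnth /=.
have -> : i = lift ord0 (Ordinal (let H : (i.-1 < n)%N := ltac:(by rewrite prednK ?lt0n// -ltnS) in H)).
  by apply: val_inj; rewrite /= /bump /= add1n prednK // lt0n.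
by rewrite /consT /= !tnthS tnth_mktuple.
Qed.

(** By induction: slicing along the first coordinate, the sections scale by l ^- n and
    the remaining one-dimensional integral by l^-1. *)
Lemma lebesgue_tuple_aff n (l : R) c (A : set (T n)) : (0 < l)%R -> measurable A ->
  lebesgue_tuple (@affT n l c @^-1` A) = (l ^- n)%:E * lebesgue_tuple A.
Proof.
move=> l0; elim: n c A => [|n IH] c A mA.
  rewrite expr0 invr1 mul1e; congr (lebesgue_tuple _).
  by apply/seteqP; split => t /=; rewrite [affT _ _ _]tuple0 [t]tuple0.
have step x : sectionvol (affT l c @^-1` A) x =
    (l ^- n)%:E * sectionvol A (aff1 l (c 0%N) x).
  rewrite /sectionvol -(IH (c \o succn)); last first.
    have -> : [set t : T n | A (consT (aff1 l (c 0%N) x, t))] = xsection (@consT n @^-1` A) (aff1 l (c 0%N) x).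
      by apply/seteqP; split=> t /=; rewrite /xsection /= ?in_setE.
    apply: measurable_xsection; rewrite -[X in measurable X]setTI; exact: measurable_consT.
  by congr (lebesgue_tuple _); apply/seteqP; split => t /=; rewrite affT_cons.
rewrite !lebesgue_tuple_consE; under eq_integral => x _ do rewrite step.
have mS := measurable_lebesgue_tuple_section mA.
rewrite ge0_integralZl //; last 2 first.
- exact: measurableT_comp mS (measurable_aff1 l (c 0%N)).
- by rewrite lee_fin invr_ge0 exprn_ge0 // ltW.
rewrite (integral_aff1 (c 0%N) l0 mS) // muleA -EFinM; congr (EFin _ * _).
by rewrite exprSr invfM.
Qed.

Lemma measurable_prodT n (f : nat -> measurableTypeR R -> R) : (forall i, measurable_fun setT (f i)) ->
  measurable_fun setT (fun t : T n => (\prod_(i < n) f i (tnth t i))%R).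
Proof.
move=> mf; apply: measurable_prod => i _.
by apply: measurableT_comp (mf i) (measurable_tnth i).
Qed.

(** Independence of the coordinates. This is what makes integrals of functions of a
    separable potential factor. *)
Lemma integral_prodT n (f : nat -> measurableTypeR R -> R) (c : nat -> R) :
  (forall i, measurable_fun setT (f i)) -> (forall i x, 0 <= f i x)%R ->
  (forall i, \int[leb1]_x (f i x)%:E = (c i)%:E) ->
  \int[@lebesgue_tuple R n]_t (\prod_(i < n) f i (tnth t i))%:E = (\prod_(i < n) c i)%:E.
Proof.
elim: n f c => [|n IH] f c mf f0 fc.
  rewrite big_ord0; under eq_integral do rewrite big_ord0.
  by rewrite integral_cst // mul1e /= /dirac /= indicE mem_set.
have c0 i : (0 <= c i)%R.
  by rewrite -lee_fin -fc; apply: integral_ge0 => x _; rewrite lee_fin.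
rewrite integral_lebesgue_tuple_cons; last 2 first.
- by apply/measurable_EFinP; exact: measurable_prodT.
- by move=> t; rewrite lee_fin prodr_ge0.
have step x : \int[@lebesgue_tuple R n]_t
    (\prod_(i < n.+1) f i (tnth (consT (x, t)) i))%:E =
    (f 0%N x)%:E * (\prod_(i < n) c i.+1)%:E.
  rewrite -(IH (fun i => f i.+1) (fun i => c i.+1)) // -ge0_integralZl //; last 3 first.
  - apply/measurable_EFinP; exact: (@measurable_prodT _ (fun i => f i.+1)).
  - by move=> t _; rewrite lee_fin prodr_ge0.
  - by rewrite lee_fin.
  apply: eq_integral => t _; rewrite big_ord_recl EFinM; congr (_ * (_)%:E).
  by apply: eq_bigr => i _; rewrite /consT /= tnthS.
under eq_integral do rewrite step.
rewrite ge0_integralZr //; last 3 first.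
- exact/measurable_EFinP.
- by move=> x _; rewrite lee_fin.
- by rewrite lee_fin prodr_ge0.
by rewrite fc big_ord_recl.
Qed.
End TupleMeasure.

(** * Euclidean norm and volume of sets of row vectors *)

Section Euclid.
Context {R : realType} {n : nat}.
Implicit Types (x y z : 'rV[R]_n).

Lemma std_dotC x y : std_dot x y = std_dot y x.
Proof. by apply: eq_bigr => i _; rewrite mulrC. Qed.
Lemma std_dotDl x y z : std_dot (x + y) z = std_dot x z + std_dot y z.
Proof. by rewrite -big_split; apply: eq_bigr => i _; rewrite mxE mulrDl. Qed.
Lemma std_dotZl (a : R) x y : std_dot (a *: x) y = a * std_dot x y.
Proof. by rewrite mulr_sumr; apply: eq_bigr => i _; rewrite mxE mulrA. Qed.
Lemma std_dotNl x y : std_dot (- x) y = - std_dot x y.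
Proof. by rewrite -scaleN1r std_dotZl mulN1r. Qed.
Lemma std_dotBl x y z : std_dot (x - y) z = std_dot x z - std_dot y z.
Proof. by rewrite std_dotDl std_dotNl. Qed.
Lemma std_dotDr x y z : std_dot x (y + z) = std_dot x y + std_dot x z.
Proof. by rewrite std_dotC std_dotDl !(std_dotC x). Qed.
Lemma std_dotZr (a : R) x y : std_dot x (a *: y) = a * std_dot x y.
Proof. by rewrite std_dotC std_dotZl (std_dotC x). Qed.
Lemma std_dotNr x y : std_dot x (- y) = - std_dot x y.
Proof. by rewrite std_dotC std_dotNl (std_dotC x). Qed.
Lemma std_dotBr x y z : std_dot x (y - z) = std_dot x y - std_dot x z.
Proof. by rewrite std_dotDr std_dotNr. Qed.
Lemma std_dot0l x : std_dot 0 x = 0.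
Proof. by rewrite -[0 : 'rV[R]_n](scale0r 0) std_dotZl mul0r. Qed.
Definition std_dotE := (std_dotDl, std_dotDr, std_dotZl, std_dotZr, std_dotNl, std_dotNr).

Lemma std_dot_ge0 x : 0 <= std_dot x x.
Proof. by apply: sumr_ge0 => i _; rewrite -expr2 sqr_ge0. Qed.

Lemma sqr_l2_norm x : l2_norm x ^+ 2 = std_dot x x.
Proof. by rewrite sqr_sqrtr // std_dot_ge0. Qed.
Lemma l2_norm_ge0 x : 0 <= l2_norm x. Proof. exact: sqrtr_ge0. Qed.

Lemma std_dot_eq0 x : std_dot x x = 0 -> x = 0.
Proof.
move=> /eqP; rewrite psumr_eq0 => [/allP h|i _]; last by rewrite -expr2 sqr_ge0.
apply/rowP => i; rewrite mxE; have := h i (mem_index_enum _).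
by rewrite mulf_eq0 orbb => /eqP.
Qed.

Lemma l2_norm_eq0 x : l2_norm x = 0 -> x = 0.
Proof. by move=> h; apply: std_dot_eq0; rewrite -sqr_l2_norm h expr0n. Qed.

Lemma l2_norm_gt0 x : x != 0 -> 0 < l2_norm x.
Proof.
move=> x0; rewrite lt_neqAle l2_norm_ge0 andbT eq_sym.
by apply: contra x0 => /eqP/l2_norm_eq0/eqP.
Qed.

Lemma cauchy_schwarz x y : std_dot x y <= l2_norm x * l2_norm y.
Proof.
have [->|y0] := eqVneq y 0.
  rewrite -[X in std_dot x X](scale0r 0) std_dotZr mul0r mulr_ge0 ?l2_norm_ge0 //.
have [h|h] := ltP (std_dot x y) 0.
  by rewrite (le_trans (ltW h)) // mulr_ge0 ?l2_norm_ge0.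
rewrite -ler_sqr ?nnegrE ?mulr_ge0 ?l2_norm_ge0 // exprMn !sqr_l2_norm.
have yy : 0 < std_dot y y by rewrite -sqr_l2_norm exprn_gt0 ?l2_norm_gt0.
have := std_dot_ge0 (std_dot y y *: x - std_dot x y *: y).
rewrite !std_dotE (std_dotC y x).
set a := std_dot x x; set b := std_dot x y; set c := std_dot y y.
move=> H; have {}H : 0 <= c * (a * c - b ^+ 2) by move: H; lra.
by move: H; rewrite pmulr_rge0 // subr_ge0.
Qed.

Lemma l2_normD x y : l2_norm (x + y) <= l2_norm x + l2_norm y.
Proof.
rewrite -ler_sqr ?nnegrE ?addr_ge0 ?l2_norm_ge0 // sqrrD !sqr_l2_norm !std_dotE (std_dotC y x).
by have := cauchy_schwarz x y; lra.
Qed.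

Lemma l2_normZ (a : R) x : l2_norm (a *: x) = `|a| * l2_norm x.
Proof.
by rewrite /l2_norm std_dotZl std_dotZr mulrA -expr2 sqrtrM ?sqr_ge0 // sqrtr_sqr.
Qed.
Lemma l2_normN x : l2_norm (- x) = l2_norm x.
Proof. by rewrite -scaleN1r l2_normZ normrN1 mul1r. Qed.
Lemma l2_normB x y : l2_norm (x - y) = l2_norm (y - x).
Proof. by rewrite -l2_normN opprB. Qed.
Lemma l2_norm0 : l2_norm (0 : 'rV[R]_n) = 0.
Proof. by rewrite -[0](scale0r 0) l2_normZ normr0 mul0r. Qed.
Lemma l2_norm_triangle x y z : l2_norm (x - z) <= l2_norm (x - y) + l2_norm (y - z).
Proof. by rewrite -[x - z](subrKA y) l2_normD. Qed.
Lemma l2_normB_ge x y : l2_norm x - l2_norm y <= l2_norm (x - y).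
Proof. by rewrite lerBlDr -{1}[x](subrK y) l2_normD. Qed.

Lemma coord_le_l2_norm x i : `|x 0 i| <= l2_norm x.
Proof.
rewrite -ler_sqr ?nnegrE ?l2_norm_ge0 // sqr_l2_norm /std_dot (bigD1 i) //=.
rewrite real_normK ?num_real // expr2 lerDl.
by apply: sumr_ge0 => j _; rewrite -expr2 sqr_ge0.
Qed.

Lemma l2_norm_le_sum x : l2_norm x <= \sum_i `|x 0 i|.
Proof.
rewrite -ler_sqr ?nnegrE ?l2_norm_ge0 ?sumr_ge0 // sqr_l2_norm expr2 mulr_suml.
apply: ler_sum => i _.
have -> : x 0 i * x 0 i = `|x 0 i| * `|x 0 i| by rewrite -!expr2 real_normK ?num_real.
by rewrite ler_wpM2l // (bigD1 i) //= lerDl sumr_ge0.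
Qed.

Lemma l2_norm_lt_coord x (e : R) : 0 < e ->
  (forall i, `|x 0 i| < e / n.+1%:R) -> l2_norm x < e.
Proof.
move=> e0 h; apply: (le_lt_trans (l2_norm_le_sum x)).
apply: (@le_lt_trans _ _ (\sum_(i < n) (e / n.+1%:R))).
  by apply: ler_sum => i _; exact: ltW.
rewrite sumr_const card_ord -[_ *+ _]mulr_natr mulrAC ltr_pdivrMr ?ltr0Sn //.
by rewrite ltr_pM2l // ltr_nat.
Qed.

(** The topology of row vectors comes from the sup norm; the arguments below use
    Euclidean balls. *)
Lemma open_l2P (A : set 'rV[R]_n) :
  open A <-> forall x, A x -> exists2 e : R, 0 < e & forall y, l2_norm (y - x) < e -> A y.
Proof.
split=> [oA x Ax|h].
  have /nbhs_ballP[e /= e0 He] : nbhs x A by exact: open_nbhs_nbhs.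
  exists e => // y yx; apply: He; split => // i j.
  rewrite (ord1 i) -ball_normE /= distrC.
  by apply: le_lt_trans yx; have := coord_le_l2_norm (y - x) j; rewrite !mxE.
rewrite openE => x /h [e e0 He]; apply/nbhs_ballP; exists (e / n.+1%:R).
  by rewrite /= divr_gt0.
move=> y [_ xy]; apply: He; apply: l2_norm_lt_coord => // i.
by have := xy 0 i; rewrite -ball_normE /= distrC !mxE.
Qed.

Lemma continuous_l2P (f : 'rV[R]_n -> R) :
  (forall x (e : R), 0 < e -> exists2 d : R, 0 < d & forall y, l2_norm (y - x) < d -> `|f y - f x| < e)
  <-> continuous f.
Proof.
split=> [h x|cf x e e0].
  apply/(@cvgrPdist_lt _ _ _ (nbhs x) (nbhs_filter x)) => e e0; have [d d0 Hd] := h x e e0.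
  have oB : open [set y | l2_norm (y - x) < d].
    apply/open_l2P => y /= yx; exists (d - l2_norm (y - x)); first by rewrite subr_gt0.
    by move=> z zy; apply: (le_lt_trans (l2_norm_triangle _ y _)); move: zy; lra.
  have : nbhs x [set y | l2_norm (y - x) < d].
    by apply: open_nbhs_nbhs; split => //=; rewrite subrr l2_norm0.
  by apply: (@filterS _ (nbhs x) (nbhs_filter x)) => y /Hd; rewrite /= distrC.
have oB : open (f @^-1` [set y | `|y - f x| < e]).
  apply: open_comp => [y _|]; first exact: cf.
  rewrite (_ : [set y | _] = ball (f x) e); first exact: ball_open.
  by apply/seteqP; split => y; rewrite -ball_normE /= distrC.
by have [d d0 Hd] := (open_l2P _).1 oB x (ltac:(by rewrite /= subrr normr0)); exists d.
Qed.
End Euclid.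

Section RowVolume.
Context {R : realType} {n : nat}.
Implicit Types (x y z c : 'rV[R]_n) (A B : set 'rV[R]_n).
Local Notation T := (n.-tuple (measurableTypeR R)).

Definition rowT (t : T) : 'rV[R]_n := \row_(i < n) tnth t i.

(** Measurability of the set of tuples that corresponds to A, which is the set that vol
    measures. *)
Definition measurable_rV A := measurable (rowT @^-1` A).

Lemma volE A : vol A = lebesgue_tuple (rowT @^-1` A).
Proof. by []. Qed.

Lemma measurable_coordT i : measurable_fun setT (fun t : T => rowT t 0 i).
Proof.
rewrite (_ : (fun t : T => _) = (fun t : T => tnth t i)); first exact: measurable_tnth.
by apply/funext => t; rewrite mxE.
Qed.

Lemma measurable_rV_box (q : 'rV[R]_n) (e : R) : measurable_rV [set y | forall i, `|y 0 i - q 0 i| < e].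
Proof.
rewrite /measurable_rV (_ : _ @^-1` _ = \big[setI/setT]_(i < n)
   (setT `&` (fun t => `|rowT t 0 i - q 0 i|) @^-1` `]-oo, e[%classic)).
  apply: bigsetI_measurable => i _.
  have mf : measurable_fun setT (fun t => `|rowT t 0 i - q 0 i|).
    apply: measurableT_comp => //; apply: measurable_funB => //; exact: measurable_coordT.
  by apply: mf => //; exact: measurable_itv.
apply/seteqP; split => t; rewrite -bigcap_seq /=.
  by move=> H i _; split => //=; rewrite in_itv /=; exact: H.
by move=> H i; have [_] := H i (mem_index_enum _); rewrite /= in_itv.
Qed.

(** An open set is the union of the countably many cubes with rational centres and half
    sides 1/(m+1) that it contains. *)
Lemma open_measurable_rV A : open A -> measurable_rV A.
Proof.
move=> /open_l2P oA.
pose I := (n.-tuple rat * nat)%type.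
pose q (u : n.-tuple rat) : 'rV[R]_n := \row_i ratr (tnth u i).
pose box (i : I) : set 'rV[R]_n := [set y | forall j, `|y 0 j - q i.1 0 j| < i.2.+1%:R^-1].
pose F (k : nat) : set 'rV[R]_n :=
  if unpickle k is Some i then (if `[< box i `<=` A >] then box i else set0) else set0.
rewrite /measurable_rV (_ : A = \bigcup_k F k).
  rewrite preimage_bigcup; apply: bigcup_measurable => k _; rewrite /F.
  case: unpickle => [i|]; last by rewrite preimage_set0.
  by case: ifP => _; [exact: measurable_rV_box|rewrite preimage_set0].
apply/seteqP; split => [x Ax|x [k _]]; last first.
  by rewrite /F; case: unpickle => [i|//]; case: ifP => // /asboolP; exact.
have [e e0 He] := oA x Ax.
pose d := e / n.+1%:R; have d0 : 0 < d by rewrite divr_gt0.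
have [m Hm] : exists m : nat, m.+1%:R^-1 < d / 2.
  have d2 : 0 < d / 2 by rewrite divr_gt0.
  have [N _ /(_ N (leqnn _)) /= h] := near_infty_natSinv_lt (PosNum d2).
  by exists N.
have Hr i : exists r : rat, x 0 i < ratr r < x 0 i + m.+1%:R^-1.
  have lt : x 0 i < x 0 i + m.+1%:R^-1 by rewrite ltrDl.
  by have [r] := rat_in_itvoo lt; rewrite in_itv /= => h; exists r.
pose u : n.-tuple rat := [tuple sval (cid (Hr i)) | i < n].
have Hu i : `|x 0 i - q u 0 i| < m.+1%:R^-1.
  rewrite mxE tnth_mktuple; case: cid => r /= /andP[h1 h2].
  by move: h1 h2; move: (ratr r) (x 0 i) (m.+1%:R^-1) => a b w h1 h2; rewrite ltr_norml; apply/andP; split; lra.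
exists (pickle (u, m)) => //; rewrite /F pickleK.
case: asboolP => [_ i|]; first exact: Hu.
case; move=> y Hy; apply: He; apply: l2_norm_lt_coord => // i; rewrite !mxE.
rewrite -/d; have h2 : `|y 0 i - q u 0 i| < m.+1%:R^-1 := Hy i.
have := Hu i; rewrite distrC => h1.
rewrite -[y 0 i - x 0 i](subrKA (q u 0 i)); apply: (le_lt_trans (ler_normD _ _)).
by move: h1 h2 Hm d0; move: (m.+1%:R^-1) d => w d; lra.
Qed.

Lemma closed_measurable_rV A : open (~` A) -> measurable_rV A.
Proof.
by move=> /open_measurable_rV h; rewrite /measurable_rV -[A]setCK preimage_setC; exact: measurableC.
Qed.

Definition affV (l : R) c A : set 'rV[R]_n := [set x | A (l *: x + c)].

Lemma affV_affT (l : R) c A : rowT @^-1` affV l c A =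
  @affT R n l (fun k => if insub k is Some i then c 0 i else 0) @^-1` (rowT @^-1` A).
Proof.
apply/seteqP; split => t; rewrite /affV /=; congr (A _);
  apply/rowP => i; rewrite !mxE tnth_mktuple;
  case: insubP => [j _ /val_inj ->//|]; by rewrite ltn_ord.
Qed.

Lemma measurable_rV_aff (l : R) c A : measurable_rV A -> measurable_rV (affV l c A).
Proof.
move=> mA; rewrite /measurable_rV affV_affT -[X in measurable X]setTI.
exact: measurable_affT.
Qed.

Lemma vol_aff (l : R) c A : 0 < l -> measurable_rV A ->
  vol (affV l c A) = ((l ^- n)%:E * vol A)%E.
Proof. by move=> l0 mA; rewrite !volE affV_affT lebesgue_tuple_aff. Qed.

Lemma le_vol A B : measurable_rV A -> measurable_rV B -> A `<=` B -> (vol A <= vol B)%E.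
Proof. by move=> mA mB AB; rewrite !volE; apply: le_measure; rewrite ?inE //; exact: preimage_subset. Qed.

Definition cball x (r : R) := [set y | l2_norm (y - x) <= r].
Lemma open_cballC x r : open (~` cball x r).
Proof.
apply/open_l2P => y /= /negP; rewrite -ltNge => yx.
exists (l2_norm (y - x) - r); first by rewrite subr_gt0.
move=> z zy; apply/negP; rewrite -ltNge.
by have := l2_norm_triangle y z x; rewrite (l2_normB y z); move: zy; lra.
Qed.
Lemma measurable_rV_cball x r : measurable_rV (cball x r). Proof. by apply: closed_measurable_rV; exact: open_cballC. Qed.

Lemma vol_cball x (r : R) : 0 < r ->
  vol (cball x r) = ((r ^+ n)%:E * vol (unit_ball (@l2_norm R n)))%E.
Proof.
move=> r0; have ri : 0 < r^-1 by rewrite invr_gt0.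
have E : unit_ball (@l2_norm R n) = cball 0 1.
  by apply/seteqP; split => y; rewrite /unit_ball /cball /= subr0.
rewrite E (_ : cball x r = affV r^-1 (- (r^-1 *: x)) (cball 0 1)); last first.
  have H y : (l2_norm (r^-1 *: y - r^-1 *: x) <= 1) = (l2_norm (y - x) <= r).
    by rewrite -scalerBr l2_normZ gtr0_norm // mulrC ler_pdivrMr // mul1r.
  by apply/seteqP; split=> y; rewrite /cball /affV /= subr0 H.
rewrite vol_aff //; last exact: measurable_rV_cball.
by rewrite exprVn invrK.
Qed.

Lemma vol_unit_ball_fin : (0 < n)%N ->
  exists2 w : R, 0 < w & vol (unit_ball (@l2_norm R n)) = w%:E.
Proof.
move=> n0.
have E : unit_ball (@l2_norm R n) = cball 0 1.
  by apply/seteqP; split => y; rewrite /unit_ball /cball /= subr0.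
have mB : measurable_rV (unit_ball (@l2_norm R n)) by rewrite E; exact: measurable_rV_cball.
have hi : (vol (unit_ball (@l2_norm R n)) <= ((2 : R) ^+ n)%:E)%E.
  have -> : ((2 : R) ^+ n) = (1 - (- 1)) ^+ n by rewrite opprK.
  rewrite -lebesgue_tuple_cube ?volE; last by lra.
  apply: le_measure; rewrite ?inE //; first exact: measurable_cubeT.
  move=> t /= h i; rewrite /= in_itv /= -ler_norml.
  by have := coord_le_l2_norm (rowT t) i; rewrite mxE => /le_trans; apply.
have lo : ((n%:R^-1 ^+ n)%:E <= vol (unit_ball (@l2_norm R n)))%E.
  have n1 : (0 : R) <= n%:R^-1 by rewrite invr_ge0.
  rewrite -[X in X ^+ n]subr0 -lebesgue_tuple_cube ?volE //.
  apply: le_measure; rewrite ?inE //; first exact: measurable_cubeT.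
  move=> t /= h; apply: (le_trans (l2_norm_le_sum _)).
  apply: (@le_trans _ _ (\sum_(i < n) n%:R^-1)).
    apply: ler_sum => i _; rewrite mxE; have := h i; rewrite /= in_itv /= => /andP[h1 h2].
    by rewrite ger0_norm.
  by rewrite sumr_const card_ord -[_ *+ _]mulr_natr mulVf // pnatr_eq0 -lt0n.
move: hi lo; case: (vol _) => [w| |] //= _; rewrite lee_fin => lo; exists w => //.
by apply: lt_le_trans lo; rewrite exprn_gt0 // invr_gt0 ltr0n.
Qed.
End RowVolume.

(** * Vitali's covering theorem and Hausdorff measure *)

Section Greedy.
Context {R : realType} {I : Type} (rad : I -> R) (D : I -> I -> Prop) (G : set I) (M : R).
Hypothesis rad_gt0 : forall i, G i -> 0 < rad i.
Hypothesis rad_le : forall i, G i -> rad i <= M.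

(** A supremum need not be attained, whence the factor 2. *)
Lemma almost_largest (P : set I) : P `<=` G -> P !=set0 ->
  exists2 j, P j & forall i, P i -> rad i <= 2 * rad j.
Proof.
move=> PG [i0 Pi0].
have hs : has_sup (rad @` P).
  by split; [exists (rad i0), i0|exists M => _ [i /PG Gi <-]; exact: rad_le].
have le_s i : P i -> rad i <= sup (rad @` P).
  by move=> Pi; apply: sup_upper_bound => //; exists i.
have s0 : 0 < sup (rad @` P) / 2.
  by rewrite divr_gt0 // (lt_le_trans (rad_gt0 (PG _ Pi0))) // le_s.
have [_ [j Pj <-] sj] := sup_adherent s0 hs.
by exists j => // i /le_s; move: sj; lra.
Qed.

(** At each step an almost largest remaining element is selected and everything that
    conflicts with it is discarded. An element that conflicts with no earlier choice is
    still available at step k, so the choice at step k is at least half as large. *)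
Lemma greedy_selection : exists b : nat -> option I,
  [/\ forall k i, b k = Some i -> G i,
      forall k l i j, (k < l)%N -> b k = Some i -> b l = Some j -> D i j &
      forall k i, G i -> (forall l j, (l < k)%N -> b l = Some j -> D j i) ->
        exists2 j, b k = Some j & rad i <= 2 * rad j].
Proof.
have /choice[pick pickP] : forall P : set I, exists o : option I, P `<=` G ->
    if o is Some j then P j /\ forall i, P i -> rad i <= 2 * rad j
    else forall i, ~ P i.
  move=> P; have [PG|nPG] := pselect (P `<=` G); last by exists None.
  have [ne|ne] := pselect (P !=set0).
    by have [j Pj jP] := almost_largest PG ne; exists (Some j).
  by exists None => _ i Pi; apply: ne; exists i.
pose avail := fix avail k := if k is k'.+1 then
  [set i | avail k' i /\ if pick (avail k') is Some j then D j i else True] else G.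
have availG k : avail k `<=` G by elim: k => [//|k IH] i [/IH].
have availP k i : avail k i <-> G i /\ forall l j, (l < k)%N -> pick (avail l) = Some j -> D j i.
  elim: k => [|k [IH1 IH2]]; first by split=> [|[]//] Gi; split.
  split=> [[/IH1[Gi H] Hk]|[Gi H]].
    split=> // l j; rewrite ltnS leq_eqVlt => /predU1P[->|lk]; last exact: H.
    by move: Hk; case: (pick (avail k)) => // j' + [<-].
  split; first by apply: IH2; split => // l j lk; apply: H; rewrite ltnW.
  by case E : (pick (avail k)) => [j|//]; exact: (H k).
exists (fun k => pick (avail k)); split=> [k i E|k l i j kl Ei Ej|k i Gi H].
- by have := pickP (avail k) (availG k); rewrite E => -[/availG].
- have := pickP (avail l) (availG l); rewrite Ej => -[/availP[_ H] _].
  exact: H Ei.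
- have := pickP (avail k) (availG k); case: (pick (avail k)) => [j [_ Hj]|nope].
    by exists j => //; apply: Hj; apply/availP.
  by case: (nope i); apply/availP.
Qed.
End Greedy.

Section Tail.
Context {R : realType}.
Lemma small_tail (a : nat -> R) (A e : R) : (forall k, 0 <= a k) ->
  (forall K, \sum_(k < K) a k <= A) -> 0 < e ->
  exists N, forall K, \sum_(k < K | (N <= k)%N) a k <= e.
Proof.
move=> a0 aA e0; pose E := range (fun K => \sum_(k < K) a k).
have hs : has_sup E by split; [exists 0, 0%N; rewrite ?big_ord0|exists A => _ [K _ <-]].
have [_ [N _ <-] HN] := sup_adherent e0 hs.
exists N => K.
have [KN|NK] := leqP K N.
  rewrite big_pred0 ?ltW // => i; apply/negbTE; rewrite -ltnNge.
  exact: leq_trans KN.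
have : \sum_(k < K) a k <= sup E by apply: sup_upper_bound => //; exists K.
rewrite (bigID (fun k : 'I_K => (N <= k)%N)) /=.
have -> : \sum_(k < K | ~~ (N <= k)%N) a k = \sum_(k < N) a k.
  rewrite (big_ord_widen K a (ltnW NK)); apply: eq_bigl => i; by rewrite ltnNge.
by move: HN; set s := sup E; set t := \sum_(k < N) a k; set u := \sum_(_ < _ | _) _; lra.
Qed.
End Tail.

Section Vitali.
Context {R : realType} {n : nat}.
Implicit Types (x y z : 'rV[R]_n) (p q : 'rV[R]_n * R) (b : nat -> option ('rV[R]_n * R)).

Definition disjoint_balls p q := forall z, ~ (cball p.1 p.2 z /\ cball q.1 q.2 z).

Definition ball_packing (G : set ('rV[R]_n * R)) b :=
  (forall k p, b k = Some p -> G p) /\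
  (forall k l p q, k != l -> b k = Some p -> b l = Some q -> disjoint_balls p q).

Definition rad_pow (d : nat) (o : option ('rV[R]_n * R)) : R :=
  if o is Some p then p.2 ^+ d else 0.

(** Tripling only the balls after the first N makes the loss as small as one likes,
    since it concerns the tail of a convergent series. *)
Definition enlarged (N k : nat) (o : option ('rV[R]_n * R)) : set 'rV[R]_n :=
  if o is Some p then cball p.1 (if (k < N)%N then p.2 else 3 * p.2) else set0.

Lemma disjoint_ballsC p q : disjoint_balls p q -> disjoint_balls q p.
Proof. by move=> h z [h1 h2]; apply: (h z). Qed.

(** The balls are closed, so a point outside finitely many of them has a neighbourhood
    outside. *)
Lemma finite_avoid (b : nat -> option ('rV[R]_n * R)) N x :
  (forall k p, (k < N)%N -> b k = Some p -> ~ cball p.1 p.2 x) ->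
  exists2 e : R, 0 < e & forall k p r, (k < N)%N -> b k = Some p -> r < e -> disjoint_balls p (x, r).
Proof.
elim: N => [|N IH] H; first by exists 1.
have [k p kN|e e0 He] := IH _; first by apply: H; exact: ltnW.
case E : (b N) => [p|]; last first.
  exists e => // k p r; rewrite ltnS leq_eqVlt => /predU1P[->|]; first by rewrite E.
  exact: He.
have [e' e'0 He'] := (open_l2P _).1 (@open_cballC _ _ p.1 p.2) x (H N p (ltnSn N) E).
exists (Num.min e e'); first by rewrite lt_min e0.
move=> k q r; rewrite ltnS leq_eqVlt lt_min => /predU1P[->|kN] Ek /andP[re re']; last exact: He Ek re.
move: Ek; rewrite E => -[<-] z [/= h1 h2].
by apply: (He' z) h1; apply: le_lt_trans h2 re'.
Qed.

(** A point x outside the first N balls has a ball in G that is so small that it avoids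
    them. This ball meets a selected one: otherwise it would stay available forever, all
    radii would be at least half of its radius, and the sums of their powers would be
    unbounded. The first selected ball that it meets has an index at least N and a radius at
    least half as large, so tripling it covers x. *)
Lemma vitali_covering d (S : set 'rV[R]_n) (G : set ('rV[R]_n * R)) (M A : R) :
  (forall p, G p -> 0 < p.2 <= M) ->
  (forall x e, S x -> 0 < e -> exists2 r : R, r < e & G (x, r)) ->
  (forall b, ball_packing G b -> forall K, \sum_(k < K) rad_pow d (b k) <= A) ->
  exists2 b, ball_packing G b & forall N, S `<=` \bigcup_k enlarged N k (b k).
Proof.
move=> Grad fine bdd.
have g0 p : G p -> 0 < p.2 by move=> /Grad/andP[].
have gM p : G p -> p.2 <= M by move=> /Grad/andP[].
have [b [bG bD bP]] := greedy_selection disjoint_balls g0 gM.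
have pack : ball_packing G b.
  split=> // k l p q; rewrite neq_ltn => /orP[kl|lk] Ek El; first exact: bD Ek El.
  by apply: disjoint_ballsC; exact: bD El Ek.
exists b => // N x Sx.
have [[k [p [kN Ek px]]]|out] := pselect (exists k p, [/\ (k < N)%N, b k = Some p & cball p.1 p.2 x]).
  by exists k => //; rewrite Ek /= kN.
have [e e0 He] : exists2 e : R, 0 < e & forall k p r, (k < N)%N -> b k = Some p -> r < e -> disjoint_balls p (x, r).
  by apply: finite_avoid => k p kN Ek px; apply: out; exists k, p.
have [r re Gxr] := fine x e Sx e0.
have r0 := g0 _ Gxr; rewrite /= in r0.
have [k [p [Ek kD kmin]]] : exists k p, [/\ b k = Some p, ~ disjoint_balls p (x, r) &
    forall l q, (l < k)%N -> b l = Some q -> disjoint_balls q (x, r)].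
  have [ex|nex] := pselect (exists k, `[< exists2 p, b k = Some p & ~ disjoint_balls p (x, r) >]).
    case: (ex_minnP ex) => k /asboolP[p Ek kD] kmin.
    exists k, p; split=> // l q lk El; apply: contrapT => nD.
    have /kmin : `[< exists2 p, b l = Some p & ~ disjoint_balls p (x, r) >] by apply/asboolP; exists q.
    by rewrite leqNgt lk.
  exfalso.
  have big k : exists2 p, b k = Some p & r <= 2 * p.2.
    apply: (bP k _ Gxr) => l j _ El; apply: contrapT => nD.
    by apply: nex; exists l; apply/asboolP; exists j.
  have rd : 0 < (r / 2) ^+ d by rewrite exprn_gt0 // divr_gt0.
  pose K := Num.bound `|A / (r / 2) ^+ d|.
  have := bdd b pack K; apply/negP; rewrite -ltNge.
  apply: (@lt_le_trans _ _ (\sum_(k < K) (r / 2) ^+ d)).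
    rewrite sumr_const card_ord -[_ *+ K]mulr_natl.
    have : A / (r / 2) ^+ d < K%:R by apply: le_lt_trans (ler_norm _) _; apply: archi_boundP.
    by rewrite ltr_pdivrMr.
  apply: ler_sum => k _; have [p -> /= hp] := big k.
  by apply: lerXn2r; rewrite ?nnegrE; move: hp r0; lra.
have Nk : (N <= k)%N.
  by rewrite leqNgt; apply/negP => kN; apply: kD; exact: He Ek re.
exists k => //; rewrite Ek /= ltnNge Nk /=.
have [p' + hp] := bP k _ Gxr kmin; rewrite Ek => -[pE]; rewrite -pE /= in hp.
move: kD => /existsNP[z /contrapT[/= zp zx]].
rewrite /cball /=; apply: (le_trans (l2_norm_triangle x z _)).
rewrite (l2_normB x z); move: zp zx hp; rewrite /cball /=; lra.
Qed.

Lemma hausdorff_cost_le d (F : set 'rV[R]_n) y (r : R) : 0 <= r -> F `<=` cball y r ->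
  (hausdorff_cost d F <= ((2 * r) ^+ d)%:E)%E.
Proof.
move=> r0 Fy; rewrite /hausdorff_cost; case: pselect => [_|/eqP/set0P[x Fx]] /=.
  by rewrite lee_fin exprn_ge0 // mulr_ge0.
have hi : (diam F <= (2 * r)%:E)%E.
  apply: ge_ereal_sup => _ [u Fu [v Fv <-]]; rewrite lee_fin.
  apply: (le_trans (l2_norm_triangle u y v)); rewrite (l2_normB y v).
  by have := Fy _ Fu; have := Fy _ Fv; rewrite /cball /=; lra.
have lo : (0 <= diam F)%E.
  by apply: ereal_sup_ubound; exists x => //; exists x => //; rewrite subrr l2_norm0.
move: hi lo; case: (diam F) => [s| |] //; rewrite !lee_fin => hi lo.
by rewrite -EFin_expe lee_fin lerXn2r ?nnegrE // mulr_ge0.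
Qed.

Lemma diam_le (F : set 'rV[R]_n) y (r e : R) : 2 * r <= e -> F `<=` cball y r ->
  (diam F <= e%:E)%E.
Proof.
move=> re Fy; apply: ge_ereal_sup => _ [u Fu [v Fv <-]]; rewrite lee_fin.
apply: (le_trans (l2_norm_triangle u y v)); rewrite (l2_normB y v).
by have := Fy _ Fu; have := Fy _ Fv; move: re; rewrite /cball /=; lra.
Qed.

(** In the Vitali covering the first N balls contribute at most A, and the tripled tail
    is made to contribute at most A as well by taking N large: this is the factor 2. The
    diameters are twice the radii, which cancels the factor 2 ^- d in the normalization of
    the Hausdorff measure. *)
Lemma hausdorff_le d (S : set 'rV[R]_n) (G : set ('rV[R]_n * R)) (A : R) :
  (0 < d)%N -> 0 < A ->
  (forall p, G p -> 0 < p.2) ->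
  (forall x e, S x -> 0 < e -> exists2 r : R, r < e & G (x, r)) ->
  (forall b, ball_packing G b -> forall K, \sum_(k < K) rad_pow d (b k) <= A) ->
  (hausdorff d S <= vol (unit_ball (@l2_norm R d)) * (2 * A)%:E)%E.
Proof.
move=> d0 A0 Gpos fine bdd.
have vol0 : (0 <= vol (unit_ball (@l2_norm R d)))%E by rewrite volE; exact: measure_ge0.
rewrite /hausdorff -muleA; apply: lee_wpmul2l => //.
have two : (2 ^- d * (2 ^+ d * (2 * A)) = 2 * A :> R) by rewrite mulKf // expf_neq0.
rewrite -two EFinM; apply: lee_wpmul2l; first by rewrite lee_fin invr_ge0 exprn_ge0.
apply: ge_ereal_sup => _ [delta /= delta0 <-].
pose G' p := G p /\ p.2 <= delta / 6.
have G'pos p : G' p -> 0 < p.2 <= delta / 6 by move=> [/Gpos -> ->].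
have G'fine x e : S x -> 0 < e -> exists2 r : R, r < e & G' (x, r).
  move=> Sx e0; have [|r] := fine x (Num.min e (delta / 6)) Sx.
    by rewrite lt_min e0 divr_gt0.
  by rewrite lt_min => /andP[re rd] Gr; exists r => //; split => //; exact: ltW.
have G'bdd b : ball_packing G' b -> forall K, \sum_(k < K) rad_pow d (b k) <= A.
  by move=> [h1 h2]; apply: bdd; split=> // k p /h1[].
have [b bp cov] := vitali_covering G'pos G'fine G'bdd.
have a0 k : 0 <= rad_pow d (b k).
  case E : (b k) => [p|] //=; rewrite exprn_ge0 //.
  by have /G'pos/andP[/ltW] := bp.1 _ _ E.
have e3 : 0 < A / 3 ^+ d by rewrite divr_gt0 // exprn_gt0.
have [N HN] := small_tail a0 (G'bdd b bp) e3.
pose F k := enlarged N k (b k).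
pose rho k : R := if b k is Some p then (if (k < N)%N then p.2 else 3 * p.2) else 0.
have rho0 k : 0 <= rho k <= delta / 2.
  rewrite /rho; case E : (b k) => [p|]; last by rewrite lexx divr_ge0 // ltW.
  by have /G'pos/andP[h1 h2] := bp.1 _ _ E; case: ifP => _; apply/andP; split; lra.
have Frho k : exists y, F k `<=` cball y (rho k).
  by rewrite /F /enlarged /rho; case: (b k) => [p|]; [exists p.1|exists 0].
have dF k : (diam (F k) <= delta%:E)%E.
  have [y Fy] := Frho k; apply: diam_le Fy.
  by have /andP[_] := rho0 k; lra.
apply: (@le_trans _ _ (\sum_(0 <= k <oo) hausdorff_cost d (F k))%E).
  by apply: ereal_inf_lbound; exists F => //; split => // ; exact: cov.
have c0 k : (0 <= hausdorff_cost d (F k))%E.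
  rewrite /hausdorff_cost; case: pselect => [//|/eqP/set0P[x Fx]] /=.
  rewrite expe_ge0 //; apply: ereal_sup_ubound; exists x => //; exists x => //.
  by rewrite subrr l2_norm0.
apply: lime_le; first by apply: is_cvg_nneseries => k _ _; exact: c0.
near=> K.
rewrite big_mkord; apply: (@le_trans _ _ (\sum_(k < K) ((2 * rho k) ^+ d)%:E)%E).
  apply: lee_sum => k _; have [y Fy] := Frho k.
  by apply: hausdorff_cost_le Fy; case/andP: (rho0 k).
rewrite sumEFin lee_fin.
under eq_bigr do rewrite exprMn.
rewrite -mulr_sumr ler_wpM2l ?exprn_ge0 //.
apply: (@le_trans _ _ (\sum_(k < K) rad_pow d (b k) + 3 ^+ d * \sum_(k < K | (N <= k)%N) rad_pow d (b k))).
  rewrite mulr_sumr [X in _ + X]big_mkcond -big_split; apply: ler_sum => k _ /=.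
  rewrite /rho ltnNge; case E : (b k) (a0 k) => [p|] /= p0; last first.
    by rewrite expr0n gtn_eqF //=; case: ifP; rewrite ?mulr0 addr0.
  by case: (N <= k)%N => /=; [rewrite exprMn lerDr|rewrite addr0].
have := G'bdd b bp K; have := HN K.
rewrite ler_pdivlMr ?exprn_gt0 // mulrC.
by set u := 3 ^+ d * _; lra.
Unshelve. all: by end_near.
Qed.
End Vitali.

(** * Invariance of the volume under isometries *)

Section Packing.
Context {R : realType} {n : nat}.
Local Notation T := (n.-tuple (measurableTypeR R)).
Local Open Scope ereal_scope.

Lemma packing_integral (w : T -> \bar R) (E : nat -> set T) (U : set T) :
  measurable_fun setT w -> (forall t, 0 <= w t) ->
  (forall k, measurable (E k)) -> trivIset setT E -> measurable U ->
  (forall k, E k `<=` U) -> forall K,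
  \sum_(k < K) \int[@lebesgue_tuple R n]_(t in E k) w t <= \int[@lebesgue_tuple R n]_(t in U) w t.
Proof.
move=> mw w0 mE tE mU EU K.
have mUE : measurable (\bigcup_k E k) by exact: bigcup_measurable.
apply: (@le_trans _ _ (\int[@lebesgue_tuple R n]_(t in \bigcup_k E k) w t)).
  rewrite ge0_integral_bigcup //; last exact: measurable_funS mw.
  rewrite -(big_mkord xpredT (fun k => \int[@lebesgue_tuple R n]_(t in E k) w t)).
  apply: (nneseries_lim_ge (P := xpredT)) => k _ _.
  by apply: integral_ge0 => t _.
apply: ge0_subset_integral => //; first exact: measurable_funS mw.
by move=> t [k _]; exact: EU.
Qed.

Lemma vol_integral (A : set 'rV[R]_n) : measurable_rV A ->
  vol A = \int[@lebesgue_tuple R n]_(t in rowT @^-1` A) 1.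
Proof. by move=> mA; rewrite integral_cst // mul1e. Qed.
End Packing.

Section Rotation.
Context {R : realType} {n : nat}.
Hypothesis n0 : (0 < n)%N.
Variables Q P : 'rV[R]_n -> 'rV[R]_n.
Hypothesis Qiso : forall x y, l2_norm (Q x - Q y) = l2_norm (x - y).
Hypothesis QP : forall x, Q (P x) = x.

Lemma open_isometry_preimage (F : set 'rV[R]_n) : open F -> open (Q @^-1` F).
Proof.
move=> /open_l2P oF; apply/open_l2P => x /oF[e e0 He]; exists e => // y yx.
by apply: He; rewrite Qiso.
Qed.

(** By Vitali, F is covered by balls contained in F up to a tail of small volume. The
    isometry takes these disjoint balls to disjoint balls of the same radii in the preimage
    of F, and balls of equal radii have equal volumes. *)
Lemma vol_isometry_preimage (F : set 'rV[R]_n) : open F ->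
  (vol F <= vol (Q @^-1` F))%E.
Proof.
move=> oF; have [w w0 wE] := @vol_unit_ball_fin R n n0.
have mQF := open_measurable_rV (open_isometry_preimage oF).
have : (0 <= vol (Q @^-1` F))%E by rewrite volE; exact: measure_ge0.
case E : (vol (Q @^-1` F)) => [A| |] //; last by move=> _; rewrite leey.
rewrite lee_fin => A0; apply/lee_addgt0Pr => e e0; rewrite -EFinD.
pose G (p : 'rV[R]_n * R) := 0 < p.2 <= 1 /\ cball p.1 p.2 `<=` F.
have bdd b : ball_packing G b -> forall K, \sum_(k < K) rad_pow n (b k) <= A / w.
  move=> [bG bD] K.
  pose H k : set 'rV[R]_n := if b k is Some p then cball (P p.1) p.2 else set0.
  have HQ k p : b k = Some p -> H k = Q @^-1` cball p.1 p.2.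
    move=> Ek; rewrite /H Ek; apply/seteqP; split=> y; rewrite /cball /= -(Qiso y) QP //.
  have mH k : measurable_rV (H k).
    by rewrite /H; case: (b k) => [p|]; [exact: measurable_rV_cball|rewrite /measurable_rV preimage_set0].
  have := @packing_integral R n (cst 1%E) (fun k => rowT @^-1` H k) (rowT @^-1` (Q @^-1` F))
     _ _ mH _ mQF _ K.
  rewrite -vol_integral // E => /(_ _ _ _ _) pk.
  have {pk} pk : (\sum_(k < K) vol (H k) <= A%:E)%E.
    under eq_bigr do rewrite vol_integral //.
    apply: pk => //.
    - move=> k l _ _ [t [/= tk tl]].
      apply/eqP/negP => /negP kl.
      move: tk tl; rewrite /H; case Ek : (b k) => [p|//]; case El : (b l) => [q|//].
      rewrite -/(H k) -/(H l).
      have := HQ k p Ek; have := HQ l q El; rewrite /H Ek El => -> -> h1 h2.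
      exact: (bD k l p q kl Ek El (Q (rowT t))).
    - move=> k t /=; case Ek : (b k) => [p|]; last by rewrite /H Ek.
      by rewrite (HQ _ _ Ek) => h; exact: (bG k p Ek).2.
  rewrite ler_pdivlMr // mulr_suml -lee_fin -sumEFin; apply: le_trans pk.
  apply: lee_sum => k _; rewrite /H; case Ek : (b k) => [p|] /=; last first.
    by rewrite mul0r volE; exact: measure_ge0.
  by rewrite vol_cball ?wE // ; have [/andP[]] := bG _ _ Ek.
have G01 p : G p -> 0 < p.2 <= 1 by move=> [].
have fine x d : F x -> 0 < d -> exists2 r : R, r < d & G (x, r).
  move=> Fx d0; have [r r0 Hr] := (open_l2P _).1 oF x Fx.
  have m0 : 0 < Num.min 1 (Num.min d r) by rewrite !lt_min ltr01 d0.
  exists (Num.min 1 (Num.min d r) / 2).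
    apply: (@lt_le_trans _ _ (Num.min 1 (Num.min d r))); first by lra.
    by rewrite !ge_min lexx !orbT.
  have m1 : Num.min 1 (Num.min d r) <= 1 by rewrite ge_min lexx.
  have mr : Num.min 1 (Num.min d r) <= r by rewrite !ge_min lexx !orbT.
  split=> /=; first by apply/andP; split; lra.
  by move=> y; rewrite /cball /= => yx; apply: Hr; lra.
have [b bp cov] := vitali_covering G01 fine bdd.
have a0 k : 0 <= rad_pow n (b k).
  case Ek : (b k) => [p|] //=; rewrite exprn_ge0 //.
  by have /G01/andP[/ltW] := bp.1 _ _ Ek.
have w3 : 0 < w * 3 ^+ n by rewrite mulr_gt0 // exprn_gt0.
have e3 : 0 < e / (w * 3 ^+ n) by rewrite divr_gt0.
have [N HN] := small_tail a0 (bdd b bp) e3.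
have mEn k : measurable_rV (enlarged N k (b k)).
  by rewrite /enlarged; case: (b k) => [p|]; [exact: measurable_rV_cball|rewrite /measurable_rV preimage_set0].
apply: (@le_trans _ _ (\sum_(0 <= k <oo) vol (enlarged N k (b k)))%E).
  rewrite volE; apply: measure_sigma_subadditive => //.
  - exact: open_measurable_rV.
  - by move=> t /= /(cov N)[k _ h]; exists k.
apply: lime_le.
  by apply: is_cvg_nneseries => k _ _; rewrite volE; exact: measure_ge0.
near=> K; rewrite big_mkord.
apply: (@le_trans _ _ (\sum_(k < K) (w * (if (k < N)%N then 1 else 3 ^+ n) * rad_pow n (b k))%:E)%E).
  apply: lee_sum => k _; rewrite /enlarged /rad_pow; case Ek : (b k) => [p|]; last first.
    by rewrite mulr0 volE measure0.
  have /G01/andP[p0 _] := bp.1 _ _ Ek.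
  case: ifP => _; rewrite vol_cball ?mulr_gt0 // wE -EFinM lee_fin ?mulr1 1?mulrC //.
  by rewrite exprMn mulrA.
rewrite sumEFin lee_fin.
apply: (@le_trans _ _ (w * \sum_(k < K) rad_pow n (b k) + (w * 3 ^+ n) * \sum_(k < K | (N <= k)%N) rad_pow n (b k))).
  rewrite !mulr_sumr [X in _ + X]big_mkcond -big_split; apply: ler_sum => k _ /=.
  rewrite ltnNge; case: (N <= k)%N => /=; last by rewrite mulr1 addr0.
  by rewrite lerDr mulr_ge0 // ltW.
have := bdd b bp K; have := HN K.
rewrite !ler_pdivlMr // ![_ * w]mulrC (mulrC _ (w * _)).
by set u := w * _; set v := w * 3 ^+ n * _; lra.
Unshelve. all: by end_near.
Qed.
End Rotation.

Section Householder.
Context {R : realType} {n : nat}.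
Variable w : 'rV[R]_n.
Let c := 2 / std_dot w w.

(** A reflection can send any direction to a coordinate axis, so reflections are the
    only rotations needed to compute the volume of a cylinder. *)
Definition householder (x : 'rV[R]_n) : 'rV[R]_n := x - (c * std_dot w x) *: w.

Let hc : c * (c * std_dot w w) = 2 * c.
Proof.
have [w0|w0] := eqVneq (std_dot w w) 0; first by rewrite /c w0 invr0 mulr0 !mul0r mulr0.
by rewrite /c divfK // mulrC.
Qed.

Lemma householderK x : householder (householder x) = x.
Proof.
rewrite /householder !std_dotE; set s := std_dot w x; set ww := std_dot w w.
have -> : c * (s - c * s * ww) = - (c * s).
  have -> : c * (s - c * s * ww) = c * s - s * (c * (c * ww)) by lra.
  by rewrite hc; lra.
by rewrite scaleNr opprK subrK.
Qed.

Lemma householder_dot x y : std_dot (householder x) y = std_dot x (householder y).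
Proof. by rewrite /householder !std_dotE (std_dotC x w); lra. Qed.

Lemma householder_iso x y : l2_norm (householder x - householder y) = l2_norm (x - y).
Proof.
have -> : householder x - householder y = householder (x - y).
  rewrite /householder !std_dotE.
  by apply/rowP => i; rewrite !mxE; lra.
by rewrite /l2_norm -householder_dot householderK.
Qed.
End Householder.

Lemma householder_swap {R : realType} {n : nat} (u v : 'rV[R]_n) :
  std_dot u u = std_dot v v -> householder (u - v) v = u.
Proof.
move=> uv; rewrite /householder.
have [E|E] := eqVneq (std_dot (u - v) (u - v)) 0.
  by have /eqP := std_dot_eq0 E; rewrite subr_eq0 => /eqP ->; rewrite subrr scaler0 subr0.
suff -> : 2 / std_dot (u - v) (u - v) * std_dot (u - v) v = -1.
  by rewrite scaleN1r opprK addrC subrK.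
rewrite mulrAC; apply: (canLR (mulfK E)).
by move: uv; rewrite !std_dotE (std_dotC v u); lra.
Qed.

(** * Cylinders over discs in a tangent hyperplane *)

Section Lipschitz.
Context {R : realType} {n : nat}.
Implicit Types (x y z a : 'rV[R]_n).

Lemma normr_std_dot x y : `|std_dot x y| <= l2_norm x * l2_norm y.
Proof.
rewrite ler_norml cauchy_schwarz andbT lerNl -std_dotNl.
by apply: (le_trans (cauchy_schwarz _ _)); rewrite l2_normN.
Qed.

Lemma open_lipschitz_lt (f : 'rV[R]_n -> R) (L c : R) : 0 <= L ->
  (forall y z, f z - f y <= L * l2_norm (z - y)) -> open [set z | f z < c].
Proof.
move=> L0 lip; apply/open_l2P => y /= fy.
have L1 : 0 < L + 1 by lra.
exists ((c - f y) / (L + 1)); first by rewrite divr_gt0 // subr_gt0.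
move=> z; rewrite ltr_pdivlMr // => zy.
have := lip y z; have := l2_norm_ge0 (z - y); move: zy; set u := l2_norm _; lra.
Qed.
End Lipschitz.

Section Frustum.
Context {R : realType} {m : nat}.
Hypothesis m0 : (0 < m)%N.
Variables (x a : 'rV[R]_m.+1).
Hypothesis ax : 0 < std_dot a x.

(** With t = <a, z> / <a, x> the point z lies in the hyperplane of t x that is
    orthogonal to a, and is at a distance less than rho from t x: all these slices, for 1 <
    t < 1 + k, are discs of the same radius rho. Since t > 1, the cylinder lies in the cone
    from 0 over its base. *)
Definition tangent_cylinder (rho k : R) : set 'rV[R]_m.+1 :=
  [set z | [/\ std_dot a x < std_dot a z, std_dot a z < (1 + k) * std_dot a x &
     l2_norm (z - (std_dot a z / std_dot a x) *: x) < rho]].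

Lemma open_tangent_cylinder rho k : open (tangent_cylinder rho k).
Proof.
have -> : tangent_cylinder rho k = [set z | - std_dot a z < - std_dot a x] `&`
   [set z | std_dot a z < (1 + k) * std_dot a x] `&`
   [set z | l2_norm (z - (std_dot a z / std_dot a x) *: x) < rho].
  by apply/seteqP; split => z /=; rewrite ltrN2 => -[]; [|case].
have a0 := l2_norm_ge0 a.
apply: openI; first apply: openI.
- apply: (open_lipschitz_lt (L := l2_norm a)) => // y z.
  by rewrite opprK addrC -std_dotBr (l2_normB z); exact: cauchy_schwarz.
- apply: (open_lipschitz_lt (L := l2_norm a)) => // y z.
  by rewrite -std_dotBr; exact: cauchy_schwarz.
pose L := 1 + l2_norm a / std_dot a x * l2_norm x.
have L0 : 0 <= l2_norm a / std_dot a x * l2_norm x.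
  by rewrite mulr_ge0 ?l2_norm_ge0 // divr_ge0 // ltW.
apply: (open_lipschitz_lt (L := L)) => [|y z]; first by rewrite /L; lra.
apply: (le_trans (l2_normB_ge _ _)).
have -> : z - (std_dot a z / std_dot a x) *: x - (y - (std_dot a y / std_dot a x) *: x) =
  (z - y) - (std_dot a (z - y) / std_dot a x) *: x.
  by rewrite std_dotBr; apply/rowP => i; rewrite !mxE; lra.
apply: (le_trans (l2_normD _ _)); rewrite l2_normN l2_normZ /L mulrDl mul1r lerD2l.
rewrite mulrAC ler_wpM2r ?l2_norm_ge0 // normrM (gtr0_norm (x := _^-1)) ?invr_gt0 //.
by rewrite mulrAC ler_wpM2r ?invr_ge0 ?(ltW ax) // normr_std_dot.
Qed.

(** A reflection turns the slices orthogonal to a into slices of constant first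
    coordinate. Each contains a closed ball of radius rho', and the height of the cylinder
    is k <a, x> / |a|. *)
Lemma vol_tangent_cylinder (rho rho' k w : R) : 0 < rho' < rho -> 0 < k ->
  vol (unit_ball (@l2_norm R m)) = w%:E -> 0 < w ->
  ((w * rho' ^+ m * (k * (std_dot a x / l2_norm a)))%:E <= vol (tangent_cylinder rho k))%E.
Proof.
move=> /andP[r0 rr] k0 wE w0.
have a0 : a != 0 by apply: contraTneq ax => ->; rewrite std_dot0l ltxx.
have na0 := l2_norm_gt0 a0.
have na1 : l2_norm a != 0 by rewrite gt_eqF.
pose e0 : 'rV[R]_m.+1 := delta_mx 0 0.
have e0E y : std_dot e0 y = y 0 0.
  rewrite /std_dot (bigD1 ord0) //= big1 ?addr0 => [|i i0]; first by rewrite mxE !eqxx mul1r.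
  by rewrite mxE eqxx /= (negbTE i0) mul0r.
pose nu := (l2_norm a)^-1 *: a.
have nu1 : std_dot nu nu = std_dot e0 e0.
  rewrite e0E mxE !eqxx /nu std_dotZl std_dotZr -sqr_l2_norm expr2.
  by rewrite mulKf // mulVf.
pose Q := householder (e0 - nu).
have Qnu : Q nu = e0 by apply: householder_swap.
have aQ u : std_dot a (Q u) = l2_norm a * u 0 0.
  have -> : a = l2_norm a *: nu by rewrite /nu scalerA mulfV // scale1r.
  by rewrite std_dotZl -householder_dot -/Q Qnu e0E l2_normZ ger0_norm ?l2_norm_ge0 // /nu l2_normZ normfV ger0_norm ?l2_norm_ge0 // mulVf // mulr1.
set c := std_dot a x; pose h := c / l2_norm a.
have h0 : 0 < h by rewrite divr_gt0.
have Qx0 : (Q x) 0 0 = h.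
  by rewrite /h /c -[x in std_dot a x](householderK (e0 - nu)) aQ mulrC mulKf.
have [q qE] : exists q, Q x = q by exists (Q x).
rewrite qE in Qx0.
have QK y : Q (Q y) = y by exact: householderK.
have Qiso y z : l2_norm (Q y - Q z) = l2_norm (y - z) by exact: householder_iso.
set F := tangent_cylinder rho k.
have oF' : open (Q @^-1` F) by apply: (open_isometry_preimage Qiso); exact: open_tangent_cylinder.
have F'F : (vol (Q @^-1` F) <= vol F)%E.
  have := @vol_isometry_preimage R m.+1 (ltn0Sn m) Q Q Qiso QK _ oF'.
  by rewrite -comp_preimage (_ : Q \o Q = id) // ; apply/funext => y; exact: QK.
apply: le_trans F'F; rewrite volE lebesgue_tuple_consE.
have mF' := open_measurable_rV oF'.
pose y : 'rV[R]_m := \row_j q 0 (lift ord0 j).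
have sec t (u : m.-tuple (measurableTypeR R)) : h < t < (1 + k) * h ->
    l2_norm (rowT u - (t / h) *: y) <= rho' -> F (Q (rowT (consT (t, u)))).
  move=> /andP[ht th] le; rewrite /F /tangent_cylinder /= aQ mxE /consT /= (tnth_nth 0) /= -/c.
  have cE : c = l2_norm a * h by rewrite /h mulrC divfK.
  have tc : l2_norm a * t / c = t / h by rewrite cE -mulf_div mulfV // mul1r.
  split; first by rewrite cE ltr_pM2l.
    by rewrite cE mulrCA ltr_pM2l.
  rewrite tc.
  have -> : Q (rowT [tuple of t :: u]) - (t / h) *: x = Q (rowT [tuple of t :: u]) - Q ((t / h) *: Q x).
    congr (_ - _); rewrite /Q /householder std_dotZr.
    have := QK x; rewrite /Q {1}/householder => {1}<-.
    by rewrite scalerBr scalerA; congr (_ - _ *: _); lra.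
  rewrite Qiso qE; apply: le_lt_trans rr; apply: le_trans le.
  rewrite /l2_norm ler_sqrt ?std_dot_ge0 // /std_dot big_ord_recl.
  rewrite !mxE Qx0 (tnth_nth 0) /= divfK ?gt_eqF // subrr mul0r add0r.
  by apply: ler_sum => i _; rewrite !mxE tnthS.
have mS := measurable_lebesgue_tuple_section mF'.
apply: (@le_trans _ _ (\int[lebesgue_measure]_(t in `]h, ((1 + k) * h)%R[%classic) (w * rho' ^+ m)%:E)%E).
  rewrite integral_cst //= (lebesgue_measure_itv `]h, (1 + k) * h[) /= lte_fin.
  have hk : h < (1 + k) * h by rewrite mulrDl mul1r ltrDl mulr_gt0.
  by rewrite hk -EFinB -EFinM lee_fin -/h; lra.
apply: (@le_trans _ _ (\int[lebesgue_measure]_(t in `]h, ((1 + k) * h)%R[%classic) sectionvol (rowT @^-1` (Q @^-1` F)) t)%E); last first.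
  by apply: ge0_subset_integral => // t _; exact: measure_ge0.
apply: ge0_le_integral => //.
- by move=> t _; rewrite lee_fin mulr_ge0 ?exprn_ge0 // ltW.
- exact: measurable_funS mS.
move=> t /=; rewrite in_itv /= => ht.
have -> : (w * rho' ^+ m)%:E = vol (cball ((t / h) *: y) rho') by rewrite vol_cball // wE -EFinM mulrC.
rewrite volE; apply: le_measure; rewrite ?inE.
- exact: measurable_rV_cball.
- rewrite (_ : [set u | _] = xsection (@consT R m @^-1` (rowT @^-1` (Q @^-1` F))) t).
    apply: measurable_xsection; rewrite -[X in measurable X]setTI; exact: measurable_consT.
  by apply/seteqP; split=> u /=; rewrite /xsection /= ?in_setE.
by move=> u /= hu; apply: sec.
Qed.
End Frustum.

(** * Surface area of level sets of convex functions *)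

Lemma bernoulli_inequality {R : realType} (e : R) m : 0 <= e <= 1 -> 1 - m%:R * e <= (1 - e) ^+ m.
Proof.
move=> /andP[e0 e1]; elim: m => [|m IH]; first by rewrite expr0 mul0r subr0.
rewrite exprS; have e1' : 0 <= 1 - e by lra.
have := ler_wpM2l e1' IH; apply: le_trans.
rewrite -natr1; have : 0 <= m%:R * (e * e) :> R by rewrite !mulr_ge0.
by move: (m%:R) => M; lra.
Qed.

Section Area.
Context {R : realType} {m : nat}.
Hypothesis m0 : (0 < m)%N.
Implicit Types (x y z : 'rV[R]_m.+1).
Variables (Phi : 'rV[R]_m.+1 -> R) (g : 'rV[R]_m.+1 -> 'rV[R]_m.+1).
Hypothesis Phi_grad : forall x y, Phi x + std_dot (g x) (y - x) <= Phi y.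
Hypothesis Phi_cont : continuous Phi.
Hypothesis g_cont : forall x (e : R), 0 < e ->
  exists2 d : R, 0 < d & forall y, l2_norm (y - x) < d -> l2_norm (g y - g x) < e.
Hypothesis g_mono : forall (t : R) z, 1 <= t -> l2_norm (g z) <= l2_norm (g (t *: z)).
Variables (s sigma k : R).
Hypotheses (sigma0 : 0 < sigma) (s_sigma : Phi 0 + sigma <= s) (k0 : 0 < k).

Lemma convex_segment (b : R) y : 0 <= b <= 1 -> Phi (b *: y) <= b * Phi y + (1 - b) * Phi 0.
Proof.
move=> /andP[b0 b1]; have h1 := Phi_grad (b *: y) y; have h0 := Phi_grad (b *: y) 0.
move: h1 h0; rewrite sub0r !std_dotE; set p := std_dot _ y => h1 h0.
have := ler_wpM2l b0 h1; have b1' : 0 <= 1 - b by lra.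
have := ler_wpM2l b1' h0; lra.
Qed.

(** On a ray Phi is convex and starts below s, so it takes the value s at most once. *)
Lemma ray_hits_once (b b' : R) y y' : 0 < b -> 0 < b' -> Phi y = s -> Phi y' = s ->
  b *: y = b' *: y' -> y = y'.
Proof.
wlog bb : b b' y y' / b <= b' => [H b0 b'0 Py Py' E|b0 b'0 Py Py' E].
  have [bb|bb] := leP b b'; first exact: (H b b' y y').
  by apply/esym; apply: (H b' b y' y) => //; exact: ltW.
have Ey : y' = (b / b') *: y.
  by rewrite mulrC -scalerA E scalerA mulVf ?gt_eqF // scale1r.
have bi : 0 <= b / b' <= 1 by rewrite divr_ge0 ?(ltW b0) ?(ltW b'0) //= ler_pdivrMr // mul1r.
have := convex_segment y bi; rewrite -Ey Py Py' => H.
have {}H : 0 <= (1 - b / b') * (Phi 0 - s) by move: H; lra.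
suff -> : y' = y by [].
have [b1|b1] := eqVneq (b / b') 1; first by rewrite Ey b1 scale1r.
case/andP: bi => _; rewrite le_eqVlt (negbTE b1) /= => blt.
by exfalso; move: H; rewrite pmulr_rge0 ?subr_gt0 //; move: s_sigma sigma0; lra.
Qed.

Variable eps : R.
Hypothesis eps01 : 0 < eps < 1.

(** The balls on which the area is estimated. The third condition says that the cylinder
    erected at the centre lies in the cone over the part of the level set inside the ball,
    so that disjoint balls have disjoint cylinders; the fourth one keeps it inside the
    dilated body; the last one makes the gradient on it comparable to the gradient at the
    centre. *)
Definition area_ball (p : 'rV[R]_m.+1 * R) : Prop :=
  [/\ 0 < p.2, Phi p.1 = s,
   forall z, tangent_cylinder p.1 (g p.1) ((1 - eps) * p.2) k z ->
     exists b y, [/\ 0 < b, z = b *: y, Phi y = s & cball p.1 p.2 y],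
   tangent_cylinder p.1 (g p.1) ((1 - eps) * p.2) k `<=` [set z | Phi ((1 + 2 * k)^-1 *: z) <= s] &
   forall z, tangent_cylinder p.1 (g p.1) ((1 - eps) * p.2) k z -> l2_norm (g p.1) / 2 <= l2_norm (g z)].

(** The affine minorant of Phi that touches it at x is at most Phi(0) <= s - sigma at
    the origin. *)
Lemma grad_dot_ge x : Phi x = s -> sigma <= std_dot (g x) x.
Proof.
by move=> Px; have := Phi_grad x 0; rewrite sub0r std_dotNr Px; move: s_sigma; lra.
Qed.

Lemma cross_level x w (th : R) : th <= 1 -> Phi (th *: w) <= s -> s <= Phi w ->
  exists2 t : R, th <= t <= 1 & Phi (t *: w) = s.
Proof.
move=> th1 lo hi.
pose f (t : R) := Phi (t *: w).
have cf : {within `[th, 1], continuous f}.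
  apply: continuous_subspaceT => t.
  apply: (@continuous_comp _ _ _ (fun t : R => t *: w) Phi); last exact: Phi_cont.
  exact: scalel_continuous.
have [|t tI ft] := @IVT R f th 1 s th1 cf.
  by rewrite /f scale1r ge_min lo le_max hi orbT.
by exists t.
Qed.

(** By convexity Phi >= s on the tangent hyperplane at x. For a point w of this
    hyperplane close to x, moving towards 0 by a factor th slightly less than 1 decreases
    Phi to first order by (1 - th) <grad Phi(x), x>, while the error of the linear
    approximation at w is of lower order because the gradient is continuous. So the ray of w
    crosses the level set very near w, inside the ball. *)
Lemma small_area_ball x (e : R) : Phi x = s -> 0 < e -> exists2 r, r < e & area_ball (x, r).
Proof.
move=> Px e0; have /andP[ep0 ep1] := eps01.
set a := g x; have cs : sigma <= std_dot a x by exact: grad_dot_ge.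
set c := std_dot a x in cs *; have c0 : 0 < c by exact: lt_le_trans cs.
have a0 : 0 < l2_norm a.
  by apply: l2_norm_gt0; apply: contraTneq c0; rewrite /c => ->; rewrite std_dot0l ltxx.
have X0 : 0 < l2_norm x.
  by apply: l2_norm_gt0; apply: contraTneq c0; rewrite /c => ->; rewrite std_dotC std_dot0l ltxx.
set X := l2_norm x in X0.
have [d1 d10 H1] := g_cont x (divr_gt0 (mulr_gt0 ep0 c0) (mulr_gt0 (ltr0n R 2) X0)).
have [d2 d20 H2] := g_cont x (divr_gt0 a0 (ltr0n R 2)).
pose d3 := k * X / (1 + 2 * k).
have k1 : 0 < 1 + 2 * k by rewrite addr_gt0 // mulr_gt0.
have d30 : 0 < d3 by rewrite divr_gt0 // mulr_gt0.
(* r < d1 makes the linear approximation good enough for th below, r < d2 keeps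
   the gradient at least half as large, and r < d3 ensures (1 + k) / th <= 1 + 2k *)
pose M := Num.min e (Num.min X (Num.min d1 (Num.min d2 d3))).
have M0 : 0 < M by rewrite !lt_min e0 X0 d10 d20 d30.
have [r [rM r0]] : exists r, r < M /\ 0 < r.
  by exists (M / 2); move: (M) M0 => M' M'0; split; lra.
move: (rM); rewrite !lt_min => /and5P[re rX rd1 rd2 rd3].
exists r => //.
(* moving points of norm at most 2 X by the factor th costs at most eps r, which is
   the room left between the base of the cylinder and the ball *)
pose th := 1 - eps * r / (2 * X).
have thX : (1 - th) * (2 * X) = eps * r.
  by rewrite /th opprB addrC subrK divfK // mulf_neq0 // gt_eqF.
have th1 : th < 1.
  by rewrite /th ltrBlDr ltrDl divr_gt0 // mulr_gt0.
have erX : eps * r < X by apply: lt_trans rX; rewrite -[X in _ < X]mul1r ltr_pM2r.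
have th0 : 1 / 2 < th.
  have : (1 - th) * (2 * X) < X by rewrite thX.
  rewrite mulrA -[X in _ < X]mul1r ltr_pM2r //; lra.
have thk : (1 - th) * (1 + 2 * k) <= k.
  have : (1 - th) * (2 * X) <= r by rewrite thX -[X in _ <= X]mul1r ler_wpM2r // ltW.
  move: rd3; rewrite /d3 ltr_pdivlMr // => rd3 h.
  rewrite -(ler_pM2r X0); have := ler_wpM2r (ltW k1) h; set u := (1 - th).
  have u0 : 0 <= u * X * (1 + 2 * k) by rewrite !mulr_ge0 // ?ltW // /u; lra.
  by move: rd3 u0; lra.
have key z : tangent_cylinder x a ((1 - eps) * r) k z -> exists t w,
    [/\ 1 < t < 1 + k, z = t *: w, std_dot a (w - x) = 0 & l2_norm (w - x) < (1 - eps) * r].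
  move=> [z1 z2 z3]; pose t := std_dot a z / c.
  have t1 : 1 < t by rewrite /t ltr_pdivlMr // mul1r.
  have t0 : 0 < t by lra.
  exists t, (t^-1 *: z); split.
  - by rewrite t1 /t ltr_pdivrMr.
  - by rewrite scalerA mulfV ?gt_eqF // scale1r.
  - rewrite std_dotBr std_dotZr /t invf_div divfK ?subrr // gt_eqF //.
    exact: lt_trans z1.
  have -> : t^-1 *: z - x = t^-1 *: (z - t *: x).
    by rewrite scalerBr scalerA mulVf ?gt_eqF // scale1r.
  rewrite l2_normZ gtr0_norm ?invr_gt0 //.
  apply: le_lt_trans z3; rewrite -[X in _ <= X]mul1r ler_wpM2r ?l2_norm_ge0 //.
  by rewrite invf_le1 // ltW.
have near_x w t : l2_norm (w - x) < (1 - eps) * r -> th <= t <= 1 -> l2_norm (t *: w - x) < r.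
  move=> wx /andP[tht t1].
  have -> : t *: w - x = (w - x) - (1 - t) *: w.
    by apply/rowP => i; rewrite !mxE; lra.
  apply: (le_lt_trans (l2_normD _ _)); rewrite l2_normN l2_normZ ger0_norm; last by lra.
  have wX : l2_norm w <= 2 * X.
    rewrite -[w](subrK x); apply: (le_trans (l2_normD _ _)); rewrite -/X.
    have : (1 - eps) * r <= r by rewrite -[X in _ <= X]mul1r ler_wpM2r //; lra.
    by move: wx rX; lra.
  have : (1 - t) * l2_norm w <= (1 - th) * (2 * X).
    by apply: ler_pM; rewrite ?l2_norm_ge0 //; lra.
  by rewrite thX; move: wx; lra.
have hit w : std_dot a (w - x) = 0 -> l2_norm (w - x) < (1 - eps) * r ->
    exists2 t : R, th <= t <= 1 & Phi (t *: w) = s.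
  move=> aw wx.
  have thy := near_x w th wx; rewrite lexx (ltW th1) in thy; have {}thy := thy isT.
  apply: (cross_level x (ltW th1)).
    have := Phi_grad (th *: w) x; rewrite Px => /(le_trans _) h.
    have g1 : std_dot (g (th *: w) - a) (th *: w - x) <= eps * c / (2 * X) * r.
      apply: (le_trans (cauchy_schwarz _ _)); apply: ler_pM; rewrite ?l2_norm_ge0 ?ltW //.
      by apply: H1; apply: lt_trans rd1.
    have g2 : std_dot a (th *: w - x) = - ((1 - th) * c).
      have -> : th *: w - x = th *: (w - x) - (1 - th) *: x.
        by apply/rowP => i; rewrite !mxE; lra.
      by rewrite std_dotBr !std_dotZr aw mulr0 sub0r.
    have g3 : eps * c / (2 * X) * r = (1 - th) * c.
      have -> : 1 - th = eps * r / (2 * X) by rewrite /th; lra.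
      lra.
    have := Phi_grad (th *: w) x; rewrite Px.
    have -> : x - th *: w = - (th *: w - x) by rewrite opprB.
    rewrite std_dotNr; move: g1; rewrite std_dotBl g2 g3; lra.
  by have := Phi_grad x w; rewrite Px -/a aw addr0.
split => //=.
- move=> z /key[t [w [/andP[t1 tk] -> aw wx]]].
  have [tau tauI Ptau] := hit w aw wx; have /andP[tau1 tau2] := tauI.
  exists (t / tau), (tau *: w); split => //; first by rewrite divr_gt0 //; lra.
    by rewrite scalerA divfK //; apply: lt0r_neq0; lra.
  by rewrite /cball /= ltW // near_x.
- move=> z /key[t [w [/andP[t1 tk] -> aw wx]]] /=.
  have [tau tauI Ptau] := hit w aw wx; have /andP[tau1 tau2] := tauI.
  have tau0 : 0 < tau by lra.
  pose b := (1 + 2 * k)^-1 * t / tau.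
  have -> : (1 + 2 * k)^-1 *: (t *: w) = b *: (tau *: w).
    by rewrite !scalerA /b divfK ?gt_eqF.
  have b01 : 0 <= b <= 1.
    apply/andP; split; first by rewrite /b divr_ge0 ?ltW // mulr_gt0 ?invr_gt0 //; lra.
    rewrite /b ler_pdivrMr // mul1r mulrC ler_pdivrMr //.
    have : th * (1 + 2 * k) <= tau * (1 + 2 * k) by rewrite ler_wpM2r // ltW.
    move: thk tk; lra.
  apply: (le_trans (convex_segment _ b01)); rewrite Ptau.
  have /andP[_ b1] := b01; have b1' : 0 <= 1 - b by lra.
  have Ps : Phi 0 - s <= 0 by move: s_sigma sigma0; lra.
  have := mulr_ge0_le0 b1' Ps; lra.
move=> z /key[t [w [/andP[t1 tk] -> aw wx]]].
apply: le_trans (g_mono w (ltW t1)).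
have wr : l2_norm (w - x) < d2.
  apply: lt_trans rd2; apply: lt_trans wx _.
  by rewrite -[X in _ < X]mul1r ltr_pM2r //; lra.
have := H2 w wr; rewrite -/a => h.
by have := l2_normB_ge a (g w); rewrite l2_normB; lra.
Qed.

Definition grad_norm (t : m.+1.-tuple (measurableTypeR R)) : \bar R :=
  (l2_norm (g (rowT t)))%:E.

(** The factor 1 + 2k, rather than 1 + k, absorbs the fact that the cylinder starts on
    the tangent hyperplane and not on the level set. *)
Definition dilated_body : set 'rV[R]_m.+1 := [set z | Phi ((1 + 2 * k)^-1 *: z) <= s].
End Area.

Section AreaBound.
Context {R : realType} {m : nat}.
Hypothesis m0 : (0 < m)%N.
Implicit Types (x y z : 'rV[R]_m.+1).
Variables (Phi : 'rV[R]_m.+1 -> R) (g : 'rV[R]_m.+1 -> 'rV[R]_m.+1).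
Hypothesis Phi_grad : forall x y, Phi x + std_dot (g x) (y - x) <= Phi y.
Hypothesis Phi_cont : continuous Phi.
Hypothesis g_cont : forall x (e : R), 0 < e ->
  exists2 d : R, 0 < d & forall y, l2_norm (y - x) < d -> l2_norm (g y - g x) < e.
Hypothesis g_mono : forall (t : R) z, 1 <= t -> l2_norm (g z) <= l2_norm (g (t *: z)).
Variables (s sigma k : R).
Hypotheses (sigma0 : 0 < sigma) (s_sigma : Phi 0 + sigma <= s) (k0 : 0 < k).

(** For a ball of radius r centred at x, the cylinder has a volume of about r^m k <g x,
    x> / |g x|, so the integral of |g| over it is at least a constant times k sigma r^m: the
    size of the gradient cancels. The cylinders of a packing are disjoint and lie in the
    dilated body, so the sums of r^m over packings are bounded, and the Vitali bound for the
    Hausdorff measure applies. *)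
Theorem hausdorff_level_le (I : R) : 0 < I ->
  measurable_rV (dilated_body Phi s k) -> measurable_fun setT (grad_norm g) ->
  (\int[@lebesgue_tuple R m.+1]_(t in rowT @^-1` dilated_body Phi s k) grad_norm g t <= I%:E)%E ->
  (hausdorff m [set x | Phi x = s] <= (8 / (k * sigma) * I)%:E)%E.
Proof.
move=> I0 mU mg gI.
have [w w0 wE] := @vol_unit_ball_fin R m m0.
have m1 : (1 : R) <= m%:R by rewrite ler1n.
(* by Bernoulli's inequality this is small enough for (1 - 2 eps)^m >= 1/2 *)
pose eps : R := (4 * m%:R)^-1.
have epsm : eps * m%:R = 1 / 4 by rewrite /eps invfM -mulrA mulVf ?mulr1 ?div1r // gt_eqF // ltr0n.
have eps0 : 0 < eps by rewrite invr_gt0 mulr_gt0 // ltr0n.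
have eps4 : eps <= 1 / 4 by rewrite -epsm ler_peMr // ltW.
have eps01 : 0 < eps < 1 by rewrite eps0 /=; apply: le_lt_trans eps4 _; lra.
have half : 1 / 2 <= (1 - 2 * eps) ^+ m.
  apply: le_trans (@bernoulli_inequality R (2 * eps) m _).
    by rewrite mulrCA (mulrC _ eps) epsm; lra.
  by apply/andP; split; move: eps0 eps4; clearbody eps; lra.
have ks0 : 0 < k * sigma by rewrite mulr_gt0.
pose A := 4 * I / (w * (k * sigma)).
have A0 : 0 < A by rewrite divr_gt0 // !mulr_gt0.
have -> : 8 / (k * sigma) * I = w * (2 * A).
  have -> : w * (2 * A) = (w / w) * (8 / (k * sigma) * I) by rewrite /A invfM; lra.
  by rewrite mulfV ?gt_eqF // mul1r.
rewrite EFinM -wE.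
pose G := area_ball Phi g s k eps.
apply: (@hausdorff_le R m.+1 m _ G) => //; first by move=> p [].
  by move=> x e Px e0; exact: (small_area_ball Phi_grad Phi_cont g_cont g_mono sigma0 s_sigma k0 eps01 Px e0).
move=> b [bG bD] K.
pose O (p : 'rV[R]_m.+1 * R) := tangent_cylinder p.1 (g p.1) ((1 - eps) * p.2) k.
pose E j : set (m.+1.-tuple (measurableTypeR R)) := if b j is Some p then rowT @^-1` O p else set0.
have mO p : G p -> measurable_rV (O p).
  move=> [_ Px _ _ _]; apply: open_measurable_rV; apply: open_tangent_cylinder.
  by apply: (lt_le_trans sigma0); apply: grad_dot_ge s_sigma _ Px.
have mE j : measurable (E j).
  by rewrite /E; case Ej : (b j) => [p|//]; apply: mO; exact: bG Ej.
have pk : (\sum_(j < K) \int[@lebesgue_tuple R m.+1]_(t in E j) grad_norm g t <= I%:E)%E.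
  apply: le_trans gI; apply: packing_integral => //.
  - by move=> t; rewrite lee_fin l2_norm_ge0.
  - move=> i j _ _ [t [/= ti tj]]; apply: contrapT => /eqP ij.
    move: ti tj; rewrite /E; case Ei : (b i) => [p|//]; case Ej : (b j) => [q|//] hp hq.
    have [_ _ /(_ _ hp)[c [y [c0 Ey Py py]]] _ _] := bG _ _ Ei.
    have [_ _ /(_ _ hq)[c' [y' [c'0 Ey' Py' qy']]] _ _] := bG _ _ Ej.
    have yy : y = y' by apply: (ray_hits_once Phi_grad sigma0 s_sigma c0 c'0 Py Py'); rewrite -Ey -Ey'.
    by apply: (bD i j p q ij Ei Ej y); rewrite {2}yy.
  - move=> j t; rewrite /E; case Ej : (b j) => [p|//] h.
    by have [_ _ _ + _] := bG _ _ Ej; exact.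
have C0 : 0 < w * (k * sigma) / 4 by rewrite divr_gt0 // mulr_gt0.
have -> : A = I / (w * (k * sigma) / 4).
  by rewrite /A invf_div [RHS]mulrA (mulrC I).
rewrite ler_pdivlMr // mulr_suml -lee_fin -sumEFin; apply: le_trans pk.
apply: lee_sum => j _; rewrite /E; case Ej : (b j) => [p|] /=; last first.
  by rewrite mul0r; apply: integral_ge0 => [|t []]; exact: measurable_consT.
have Gp := bG _ _ Ej; have [r0 Px _ _ wt] := Gp.
have gx : sigma <= std_dot (g p.1) p.1 by apply: grad_dot_ge s_sigma _ Px.
have gx0 : 0 < std_dot (g p.1) p.1 by exact: lt_le_trans gx.
have a0 : 0 < l2_norm (g p.1).
  by apply: l2_norm_gt0; apply: contraTneq gx0 => ->; rewrite std_dot0l ltxx.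
apply: (@le_trans _ _ (\int[@lebesgue_tuple R m.+1]_(t in rowT @^-1` O p) (l2_norm (g p.1) / 2)%:E)%E); last first.
  apply: ge0_le_integral => //; first exact: mO.
  - by move=> t _; rewrite lee_fin divr_ge0 // ltW.
  - exact: measurable_funS mg.
  - by move=> t /= Ot; rewrite lee_fin; exact: wt.
rewrite integral_cst; last exact: mO.
have rr : 0 < (1 - 2 * eps) * p.2 < (1 - eps) * p.2.
  have h1 : 0 < 1 - 2 * eps by move: eps0 eps4; clearbody eps; lra.
  by rewrite mulr_gt0 //= ltr_pM2r //; move: eps0; clearbody eps; lra.
have := vol_tangent_cylinder gx0 rr k0 wE w0.
rewrite -[vol _]/(lebesgue_tuple (rowT @^-1` O p)) => V.
apply: le_trans (lee_wpmul2l _ V); last by rewrite lee_fin divr_ge0 // ltW.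
rewrite -EFinM lee_fin exprMn.
set a := l2_norm (g p.1) in a0 *; set c := std_dot _ _ in gx gx0 *.
have -> : a / 2 * (w * ((1 - 2 * eps) ^+ m * p.2 ^+ m) * (k * (c / a))) =
   (a / a) * (w * p.2 ^+ m * k) / 2 * ((1 - 2 * eps) ^+ m * c) by lra.
rewrite mulfV ?gt_eqF // mul1r.
have -> : p.2 ^+ m * (w * (k * sigma) / 4) = w * p.2 ^+ m * k / 2 * (1 / 2 * sigma) by lra.
apply: ler_wpM2l; first by rewrite divr_ge0 // !mulr_ge0 ?exprn_ge0 // ltW.
by apply: ler_pM; rewrite // ltW.
Qed.
End AreaBound.

(** * Canonical position from signed permutations *)

Section Canonical.
Context {R : realType} {n' : nat}.
Local Notation n := n'.+1.
Implicit Types (x y : 'rV[R]_n) (A B : 'M[R]_n) (s : 'I_n -> 'I_n) (e : 'I_n -> bool).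
Variable N : 'rV[R]_n -> R.
Hypothesis normN : is_norm N.
Hypothesis symN : forall e s x, injective s -> N (\row_j ((-1) ^+ e j * x 0 (s j))) = N x.
Variable b : R.
Hypothesis b0 : 0 < b.
Hypothesis coordN : forall x i, b * `|x 0 i| <= N x.

Definition isom_mx A := forall x, N (x *m A) = N x.

Lemma isom_mx_unit A : isom_mx A -> A \in unitmx.
Proof.
move=> isoA; rewrite -row_free_unit; apply/inj_row_free => x xA.
have [_ N0 Nz] := normN; apply: Nz; rewrite -isoA xA.
by have := N0 0 0; rewrite scale0r normr0 mul0r.
Qed.

Lemma isom_mxM A B : isom_mx A -> isom_mx B -> isom_mx (A *m B).
Proof. by move=> isoA isoB x; rewrite mulmxA isoB isoA. Qed.

Lemma isom_mx1 : isom_mx 1%:M. Proof. by move=> x; rewrite mulmx1. Qed.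

Lemma isom_mxV A : isom_mx A -> isom_mx (invmx A).
Proof. by move=> isoA x; rewrite -isoA mulmxKV // isom_mx_unit. Qed.

Lemma isom_mx_Isom A : isom_mx A -> Isom N (mulmxr A : {linear 'rV[R]_n -> 'rV[R]_n}).
Proof.
move=> isoA; have uA := isom_mx_unit isoA; split; last by move=> x /=; exact: isoA.
by exists (mulmxr (invmx A)) => x /=; rewrite ?mulmxK ?mulmxKV.
Qed.

Lemma Isom_isom_mx (f : {linear 'rV[R]_n -> 'rV[R]_n}) : Isom N f -> isom_mx (lin1_mx f).
Proof. by move=> [_ Nf] x; rewrite mul_rV_lin1 Nf. Qed.

Definition monomial_mx e s : 'M[R]_n := \matrix_(i, j) ((-1) ^+ e j * (i == s j)%:R).

Lemma mul_monomial_mx m (A : 'M[R]_(m, n)) e s i j :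
  (A *m monomial_mx e s) i j = (-1) ^+ e j * A i (s j).
Proof.
rewrite mxE (bigD1 (s j)) //= big1 => [|k ksj]; first by rewrite addr0 mxE eqxx mulr1 mulrC.
by rewrite mxE (negbTE ksj) !mulr0.
Qed.

Lemma isom_monomial e s : injective s -> isom_mx (monomial_mx e s).
Proof.
move=> si x; rewrite -(symN e x si); congr N.
by apply/rowP => j; rewrite mul_monomial_mx mxE.
Qed.

Definition sqr_hs_norm A := \sum_i \sum_j A i j ^+ 2.

Lemma sqr_hs_norm_ge0 A : 0 <= sqr_hs_norm A.
Proof. by apply: sumr_ge0 => i _; apply: sumr_ge0 => j _; exact: sqr_ge0. Qed.

Lemma sqr_hs_norm_trace A : sqr_hs_norm A = \tr (A *m A^T).
Proof.
by apply: eq_bigr => i _; rewrite mxE; apply: eq_bigr => j _; rewrite mxE expr2.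
Qed.

Lemma sqr_hs_norm1 : sqr_hs_norm 1%:M = n%:R.
Proof. by rewrite sqr_hs_norm_trace trmx1 mulmx1 mxtrace1. Qed.

Lemma sum_signs k l : \sum_(e : {ffun 'I_n -> bool}) (-1) ^+ e k * (-1) ^+ e l =
  (k == l)%:R * #|{ffun 'I_n -> bool}|%:R :> R.
Proof.
have [<-|kl] := eqVneq k l.
  under eq_bigr do rewrite -expr2 sqrr_sign.
  by rewrite sumr_const mul1r.
pose flip (e : {ffun 'I_n -> bool}) : {ffun 'I_n -> bool} := [ffun i => if i == k then ~~ e i else e i].
have flipK : involutive flip.
  by move=> e; apply/ffunP => i; rewrite !ffunE; case: eqP => // _; rewrite negbK.
rewrite mul0r; set S := \sum_(_ | _) _; suff : S = - S by lra.
rewrite {1}/S (reindex_inj (inv_inj flipK)) /= -sumrN; apply: eq_bigr => e _.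
rewrite !ffunE eqxx (negbTE (_ : l != k)) 1?eq_sym // signrN mulNr //.
Qed.

(** Independent signs are orthogonal, so the cross terms vanish on average. *)
Lemma sqr_hs_norm_sign_average A B :
  \sum_(e : {ffun 'I_n -> bool}) \sum_i \sum_j (\sum_k A i k * (-1) ^+ e k * B k j) ^+ 2 =
  #|{ffun 'I_n -> bool}|%:R * \sum_k (\sum_i A i k ^+ 2) * (\sum_j B k j ^+ 2).
Proof.
rewrite exchange_big /= [in RHS]mulr_sumr.
transitivity (\sum_i \sum_j \sum_k #|{ffun 'I_n -> bool}|%:R * (A i k ^+ 2 * B k j ^+ 2)).
  apply: eq_bigr => i _; rewrite exchange_big /=; apply: eq_bigr => j _.
  transitivity (\sum_(e : {ffun 'I_n -> bool}) \sum_k \sum_l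
      (A i k * B k j * A i l * B l j) * ((-1) ^+ e k * (-1) ^+ e l)).
    apply: eq_bigr => e _; rewrite expr2 mulr_suml; apply: eq_bigr => k _.
    by rewrite mulr_sumr; apply: eq_bigr => l _; lra.
  rewrite exchange_big /=; apply: eq_bigr => k _; rewrite exchange_big /=.
  rewrite (bigD1 k) //= [X in _ + X]big1 => [|l lk]; last first.
    by rewrite -mulr_sumr sum_signs eq_sym (negbTE lk) mul0r mulr0.
  by rewrite addr0 -mulr_sumr sum_signs eqxx mul1r; lra.
under eq_bigr => i _ do rewrite exchange_big.
rewrite exchange_big /=; apply: eq_bigr => k _.
rewrite mulr_suml mulr_sumr; apply: eq_bigr => i _.
by rewrite !mulr_sumr; apply: eq_bigr => j _.
Qed.

(** Averaging over all signs and all cyclic shifts replaces |A P B|^2 by |A|^2 |B|^2 /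
    n, so some P does at least as well as the average. *)
Lemma sqr_hs_norm_average A B : exists e s, injective s /\
  sqr_hs_norm A * sqr_hs_norm B <= n%:R * sqr_hs_norm (A *m monomial_mx e s *m B).
Proof.
apply: contrapT => H.
have {}H e s : injective s -> n%:R * sqr_hs_norm (A *m monomial_mx e s *m B) < sqr_hs_norm A * sqr_hs_norm B.
  by move=> si; rewrite ltNge; apply/negP => h; apply: H; exists e, s.
pose c : R := #|{ffun 'I_n -> bool}|%:R.
have c0 : 0 < c by rewrite /c ltr0n; apply/card_gt0P; exists [ffun=> false].
have sh (r : 'I_n) : injective (fun k : 'I_n => (k + r)%R) by move=> i j /addIr.
pose M (e : {ffun 'I_n -> bool}) (r : 'I_n) := monomial_mx e (fun k => (k + r)%R).
have signs r : \sum_(e : {ffun 'I_n -> bool}) sqr_hs_norm (A *m M e r *m B) =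
    c * \sum_k (\sum_i A i (k + r) ^+ 2) * (\sum_j B k j ^+ 2).
  pose A' : 'M[R]_n := \matrix_(i, k) A i (k + r).
  transitivity (c * \sum_k (\sum_i A' i k ^+ 2) * (\sum_j B k j ^+ 2)); last first.
    congr (_ * _); apply: eq_bigr => k _; congr (_ * _); apply: eq_bigr => i _.
    by rewrite mxE.
  rewrite -sqr_hs_norm_sign_average.
  apply: eq_bigr => e _; apply: eq_bigr => i _; apply: eq_bigr => j _; congr (_ ^+ 2).
  by rewrite mxE; apply: eq_bigr => k _; rewrite mul_monomial_mx !mxE (mulrC (A _ _)).
have E : \sum_(r : 'I_n) \sum_(e : {ffun 'I_n -> bool}) sqr_hs_norm (A *m M e r *m B) = c * (sqr_hs_norm A * sqr_hs_norm B).
  under eq_bigr do rewrite signs.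
  rewrite -mulr_sumr exchange_big /=; congr (_ * _).
  rewrite [X in _ * X]/sqr_hs_norm mulr_sumr; apply: eq_bigr => k _.
  rewrite -mulr_suml; congr (_ * _).
  rewrite exchange_big [RHS]/sqr_hs_norm; apply: eq_bigr => i _ /=.
  by rewrite [RHS](reindex_inj (@addrI _ k)).
have : n%:R * (\sum_(r : 'I_n) \sum_(e : {ffun 'I_n -> bool}) sqr_hs_norm (A *m M e r *m B)) <
   \sum_(r : 'I_n) \sum_(e : {ffun 'I_n -> bool}) sqr_hs_norm A * sqr_hs_norm B.
  rewrite mulr_sumr; apply: ltr_sum; first by apply/hasP; exists ord0 => //; exact: mem_index_enum.
  move=> r _; rewrite mulr_sumr; apply: ltr_sum => [|e _]; last exact: H.
  by apply/hasP; exists [ffun=> false] => //; exact: mem_index_enum.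
under [in X in _ < X]eq_bigr do rewrite sumr_const.
by rewrite E sumr_const card_ord -[X in _ < X]mulr_natl -[_ *+ #|_|]mulr_natl -/c ltxx.
Qed.

Lemma sqr_hs_norm_isom_bounded : exists T, forall A, isom_mx A -> sqr_hs_norm A <= T.
Proof.
pose U := \sum_i \sum_(j < n) (N (delta_mx 0 i) / b) ^+ 2.
exists U => A isoA; apply: ler_sum => i _; apply: ler_sum => j _.
rewrite -[A i j ^+ 2]real_normK ?num_real //.
apply: lerXn2r; rewrite ?nnegrE //.
  rewrite divr_ge0 ?(ltW b0) //; apply: le_trans (coordN _ ord0).
  by rewrite mulr_ge0 // ltW.
rewrite ler_pdivlMr // mulrC -(isoA (delta_mx 0 i)) -rowE.
by apply: le_trans (coordN _ j); rewrite mxE.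
Qed.

(** Let T be the supremum over all isometries. Then T |A|^2 <= n T: apply the averaging
    to B and A with B almost extremal, and note that B P A is an isometry again. *)
Lemma sqr_hs_norm_isom_le A : isom_mx A -> sqr_hs_norm A <= n%:R.
Proof.
move=> isoA; have [T HT] := sqr_hs_norm_isom_bounded.
pose E := [set sqr_hs_norm B | B in isom_mx].
have hsE : has_sup E.
  by split; [exists (sqr_hs_norm 1%:M), 1%:M; [exact: isom_mx1|]|exists T => _ [B /= isoB <-]; exact: HT].
have E1 : n%:R <= sup E.
  rewrite -sqr_hs_norm1; apply: sup_upper_bound => //; exists 1%:M => //; exact: isom_mx1.
have supE0 : 0 < sup E by apply: lt_le_trans E1; rewrite ltr0n.
have [A0|A0] := eqVneq (sqr_hs_norm A) 0; first by rewrite A0.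
have {}A0 : 0 < sqr_hs_norm A by rewrite lt_neqAle eq_sym A0 sqr_hs_norm_ge0.
rewrite -(ler_pM2l supE0) -ler_pdivlMr //.
apply: ge_sup; first by exists (sqr_hs_norm 1%:M), 1%:M => //; exact: isom_mx1.
move=> _ [B /= isoB <-].
have [e [s [si h]]] := sqr_hs_norm_average B A.
rewrite ler_pdivlMr //; apply: (le_trans h); rewrite mulrC ler_pM2r ?ltr0n //.
apply: sup_upper_bound => //; exists (B *m monomial_mx e s *m A) => //.
by apply: isom_mxM => //; apply: isom_mxM => //; exact: isom_monomial.
Qed.

(** Both A and its inverse have squared norm at most n, hence |A - A^-T|^2 = |A|^2 +
    |A^-1|^2 - 2 n <= 0. *)
Lemma isom_mx_orthogonal A : isom_mx A -> A *m A^T = 1%:M.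
Proof.
move=> isoA; have uA := isom_mx_unit isoA.
have h1 := sqr_hs_norm_isom_le isoA; have h2 := sqr_hs_norm_isom_le (isom_mxV isoA).
pose D := A - (invmx A)^T.
have hD : sqr_hs_norm D = sqr_hs_norm A + sqr_hs_norm (invmx A) - 2 * n%:R.
  rewrite !sqr_hs_norm_trace /D linearB /= trmxK mulmxBl !mulmxBr !linearB /=.
  rewrite mulmxV // -trmx_mul mulmxV // trmx1 !mxtrace1.
  rewrite (_ : \tr ((invmx A)^T *m invmx A) = \tr (invmx A *m (invmx A)^T)); last exact: mxtrace_mulC.
  by lra.
have {}hD : sqr_hs_norm D = 0 by apply/eqP; rewrite eq_le sqr_hs_norm_ge0 andbT; lra.
have D0 : D = 0.
  apply/matrixP => i j; rewrite [RHS]mxE.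
  move/eqP: hD; rewrite psumr_eq0 => [/allP/(_ i (mem_index_enum _))|k _]; last first.
    by apply: sumr_ge0 => l _; exact: sqr_ge0.
  rewrite /= psumr_eq0 => [/allP/(_ j (mem_index_enum _))|k _]; last exact: sqr_ge0.
  by rewrite /= sqrf_eq0 => /eqP.
have -> : A^T = invmx A by rewrite -[RHS]trmxK; congr (_^T); apply/eqP; rewrite -subr_eq0 -/D D0.
by rewrite mulmxV.
Qed.

Lemma std_dot_mulmx x y : std_dot x y = (x *m y^T) 0 0.
Proof. by rewrite mxE; apply: eq_bigr => i _; rewrite mxE. Qed.

Lemma std_dot_Isom_invariant : Isom_invariant N std_dot.
Proof.
move=> f /Isom_isom_mx/isom_mx_orthogonal AA x y.
rewrite -!(mul_rV_lin1 f) !std_dot_mulmx trmx_mul mulmxA -(mulmxA x) AA mulmx1 //.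
Qed.

(** Invariance under a single change of sign makes the standard basis orthogonal, and
    invariance under transpositions makes all its vectors equally long. *)
Lemma Isom_invariant_dot (B : {dot 'rV[R]_n for idfun}) : Isom_invariant N B ->
  forall x y, B x y = B (delta_mx 0 0) (delta_mx 0 0) * std_dot x y.
Proof.
move=> Binv x y.
have inv e s u v : injective s -> B (u *m monomial_mx e s) (v *m monomial_mx e s) = B u v.
  by move=> /(isom_monomial e)/isom_mx_Isom/Binv/(_ u v).
have off i j : i != j -> B (delta_mx 0 i) (delta_mx 0 j) = 0.
  move=> ij; have := inv (fun k => k == i) id (delta_mx 0 i) (delta_mx 0 j) (@inj_id _).
  have -> : delta_mx 0 i *m monomial_mx (fun k => k == i) id = - delta_mx 0 i :> 'rV[R]_n.
    apply/rowP => k; rewrite mul_monomial_mx !mxE eqxx /=.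
    by case: (eqVneq k i) => _; rewrite ?mulr0 ?oppr0 // expr1 mulr1.
  have -> : delta_mx 0 j *m monomial_mx (fun k => k == i) id = delta_mx 0 j :> 'rV[R]_n.
    apply/rowP => k; rewrite mul_monomial_mx !mxE eqxx /=.
    by case: (eqVneq k j) => [->|_]; rewrite ?mulr0 // eq_sym (negbTE ij) mulr1.
  by rewrite linearNl => h; lra.
have diag i : B (delta_mx 0 i) (delta_mx 0 i) = B (delta_mx 0 0) (delta_mx 0 0).
  pose s (k : 'I_n) := if k == i then 0 else if k == 0 then i else k.
  have si : injective s.
    apply: inv_inj => k; rewrite /s; case: (eqVneq k i) => [->|ki].
      by case: (eqVneq 0 i) => [//|_]; rewrite eqxx.
    case: (eqVneq k 0) => [->|k0]; first by rewrite eqxx.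
    by rewrite (negbTE ki) (negbTE k0).
  rewrite -(inv (fun=> false) s (delta_mx 0 0) (delta_mx 0 0) si).
  have -> // : delta_mx 0 0 *m monomial_mx (fun=> false) s = delta_mx 0 i :> 'rV[R]_n.
  apply/rowP => k; rewrite mul_monomial_mx !mxE eqxx expr0 mul1r /= /s.
  by case: (eqVneq k i) => // ki; case: (eqVneq k 0) => [k0|/negbTE ->] //; rewrite -k0 eq_sym (negbTE ki).
rewrite [in LHS](row_sum_delta x) [in LHS](row_sum_delta y).
rewrite linear_sumlz mulr_sumr; apply: eq_bigr => i _ /=.
rewrite linear_sumr (bigD1 i) //= big1 => [|j ji]; last first.
  by rewrite linearZl_LR linearZr_LR /= off ?mulr0 // eq_sym.
by rewrite addr0 linearZl_LR linearZr_LR /= diag; lra.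
Qed.

Theorem canonically_positioned_of_symmetric : canonically_positioned N.
Proof.
split; last exact: std_dot_Isom_invariant.
move=> B1 B2 inv1 inv2.
have d0 : delta_mx 0 0 != 0 :> 'rV[R]_n.
  by apply/eqP => /rowP/(_ 0)/eqP; rewrite !mxE !eqxx oner_eq0.
have B20 : 0 < B2 (delta_mx 0 0) (delta_mx 0 0) by exact: neq0_dnorm_gt0.
exists (B1 (delta_mx 0 0) (delta_mx 0 0) / B2 (delta_mx 0 0) (delta_mx 0 0)) => x y.
by rewrite (Isom_invariant_dot inv1 x y) (Isom_invariant_dot inv2 x y) mulrA divfK ?gt_eqF.
Qed.
End Canonical.

(** * The one-dimensional potential *)

Section Profile.
Context {R : realType}.
Implicit Types (x y u w t a b : R).

Lemma expr_grad k u w : 0 <= u -> 0 <= w -> u ^+ k.+1 + k.+1%:R * u ^+ k * (w - u) <= w ^+ k.+1.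
Proof.
move=> u0 w0; elim: k => [|k IH]; first by rewrite expr0 !expr1; lra.
have := ler_wpM2l w0 IH; rewrite -exprS; apply: le_trans.
have h : 0 <= k.+1%:R * u ^+ k * (w - u) ^+ 2 by apply: mulr_ge0; [apply: mulr_ge0 => //; exact: exprn_ge0|exact: sqr_ge0].
move: h; rewrite expr2 !exprS -[k.+2%:R]natr1.
by move: (k.+1%:R) (u ^+ k) => K U h; lra.
Qed.

(** The tangent line inequality of the convex function b `^ r, in the form of Young's
    inequality for b and a `^ (r - 1). *)
Lemma powR_grad (r : R) a b : 1 <= r -> 0 < a -> 0 <= b ->
  a `^ r + r * a `^ (r - 1) * (b - a) <= b `^ r.
Proof.
move=> r1 a0 b0; have [->|rn1] := eqVneq r 1.
  by rewrite subrr powRr0 !powRr1 // ?(ltW a0) //; lra.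
have r1' : 0 < r - 1 by rewrite subr_gt0 lt_neqAle eq_sym rn1.
have r0 : 0 < r by lra.
have q0 : 0 < r / (r - 1) by rewrite divr_gt0.
have conj : r^-1 + (r / (r - 1))^-1 = 1.
  rewrite invf_div -[X in X + _]div1r -mulrDl addrC subrK divff //; lra.
have := conjugate_powR b0 (powR_ge0 a (r - 1)) r0 q0 conj.
rewrite -powRrM (mulrC (r - 1)) divfK ?gt_eqF // invf_div => H.
have aa : a * a `^ (r - 1) = a `^ r by rewrite mulr_powRB1 // ltW.
have := ler_wpM2l (ltW r0) H.
rewrite mulrDr.
have -> : r * (b `^ r / r) = b `^ r by rewrite mulrC divfK ?gt_eqF.
have -> : r * (a `^ r * ((r - 1) / r)) = (r - 1) * a `^ r.
  by rewrite mulrC -!mulrA mulVf ?gt_eqF // mulr1 mulrC.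
rewrite -aa; move: (a `^ (r - 1)) (b `^ r) => A B; lra.
Qed.

(** The truncations of 1 / (1 - x) and of - log (1 - x). *)
Definition geom_poly q : {poly R} := \sum_(k < q) 'X^k.
Definition log_poly q : {poly R} := \sum_(k < q) (k.+1%:R^-1 : R) *: 'X^(k.+1).

Lemma geom_polyE q x : (geom_poly q).[x] = \sum_(k < q) x ^+ k.
Proof. by rewrite horner_sum; apply: eq_bigr => k _; rewrite hornerXn. Qed.
Lemma log_polyE q x : (log_poly q).[x] = \sum_(k < q) x ^+ k.+1 / k.+1%:R.
Proof. by rewrite horner_sum; apply: eq_bigr => k _; rewrite hornerZ hornerXn mulrC. Qed.

Lemma geom_polyS q : geom_poly q.+1 = 1 + 'X * geom_poly q.
Proof. by rewrite /geom_poly big_ord_recl expr0 mulr_sumr; congr (_ + _); apply: eq_bigr => k _; rewrite exprS. Qed.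

Lemma deriv_log_poly q : (log_poly q)^`() = geom_poly q.
Proof.
rewrite /log_poly linear_sum; apply: eq_bigr => k _ /=.
by rewrite derivZ derivXn -scalerMnr scalerMnl -[_ *+ _]mulr_natr mulVf ?scale1r // pnatr_eq0.
Qed.

Lemma geom_poly_ge0 q x : 0 <= x -> 0 <= (geom_poly q).[x].
Proof. by move=> x0; rewrite geom_polyE sumr_ge0 // => k _; rewrite exprn_ge0. Qed.

(** What remains, after truncation, of the identity (1 / (1 - x))' = (1 / (1 - x))^2. *)
Lemma deriv_geom_poly_le q x : 0 <= x -> ((geom_poly q)^`()).[x] <= (geom_poly q).[x] ^+ 2.
Proof.
move=> x0; elim: q => [|q IH]; first by rewrite /geom_poly big_ord0 deriv0 horner0 expr0n.
rewrite geom_polyS derivD derivC derivM derivX !hornerE.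
have g0 := geom_poly_ge0 q x0.
have gle : (geom_poly q).[x] <= 1 + x * (geom_poly q).[x].
  have -> : 1 + x * (geom_poly q).[x] = (geom_poly q.+1).[x] by rewrite geom_polyS !hornerE.
  by rewrite !geom_polyE big_ord_recr /= lerDl exprn_ge0.
have := ler_wpM2l x0 IH; move: g0 gle; move: (geom_poly q).[x] (geom_poly q)^`().[x] => g d g0 gle h.
have xg : 0 <= x * g by rewrite mulr_ge0.
have : 0 <= (1 + x * g - g) * (1 + x * g) by apply: mulr_ge0; lra.
lra.
Qed.

(** For q > 0 the quotient of both sides is 1 at 0 and decreases, by the bound on the
    derivative of the truncated geometric series. Without truncation there is equality: 1 /
    (1 - x) = exp (- log (1 - x)). *)
Lemma geom_poly_le_expR q x : 0 <= x -> (geom_poly q).[x] <= expR (log_poly q).[x].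
Proof.
move=> x0; case: q => [|q].
  by rewrite /geom_poly /log_poly !big_ord0 !horner0 expR_ge0.
pose f (x : R) := (geom_poly q.+1).[x] * expR (- (log_poly q.+1).[x]).
have df y : is_derive y 1 f (((geom_poly q.+1)^`()).[y] * expR (- (log_poly q.+1).[y]) -
   (geom_poly q.+1).[y] ^+ 2 * expR (- (log_poly q.+1).[y])).
  have d1 : is_derive y 1 (horner (geom_poly q.+1)) ((geom_poly q.+1)^`()).[y].
    by apply: DeriveDef; [exact: derivable_horner|rewrite -derive1E -derivE].
  have d2 : is_derive y 1 (horner (log_poly q.+1)) (geom_poly q.+1).[y].
    by apply: DeriveDef; [exact: derivable_horner|rewrite -derive1E -derivE deriv_log_poly].
  have d3 : is_derive y 1 (fun z => expR (- (log_poly q.+1).[z])) (expR (- (log_poly q.+1).[y]) * (- (geom_poly q.+1).[y])).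
    have : is_derive y 1 (fun z => - (log_poly q.+1).[z]) (- (geom_poly q.+1).[y]) by exact: is_deriveN.
    by move=> d; exact: (@is_derive1_comp _ expR (fun z => - (log_poly q.+1).[z])).
  have D := is_deriveM d1 d3.
  have E : (geom_poly q.+1).[y] *: (expR (- (log_poly q.+1).[y]) * (- (geom_poly q.+1).[y])) +
      expR (- (log_poly q.+1).[y]) *: ((geom_poly q.+1)^`()).[y] =
    ((geom_poly q.+1)^`()).[y] * expR (- (log_poly q.+1).[y]) - (geom_poly q.+1).[y] ^+ 2 * expR (- (log_poly q.+1).[y]).
    by rewrite /GRing.scale /=; lra.
  by rewrite -E.
have fx : f x <= f 0.
  have [x00|xn0] := eqVneq x 0; first by rewrite x00.
  have xp : 0 < x by rewrite lt_neqAle eq_sym xn0.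
  have der z : derivable f z 1 by exact: (@ex_derive _ _ _ _ _ _ _ (df z)).
  apply: (@ler0_derive1_nincr R f 0 x); rewrite ?lexx ?(ltW xp) //.
  - move=> z; rewrite in_itv /= => /andP[z0 _]; rewrite derive1E (@derive_val _ _ _ _ _ _ _ (df z)).
    by rewrite -mulrBl mulr_le0_ge0 ?expR_ge0 // subr_le0 deriv_geom_poly_le // ltW.
  - by apply: derivable_within_continuous => z _.
have L0 : (log_poly q.+1).[0] = 0 by rewrite log_polyE big1 // => k _; rewrite expr0n mul0r.
have G0 : (geom_poly q.+1).[0] = 1 by rewrite geom_polyS !hornerE /= ?mul0r ?addr0.
by move: fx; rewrite /f L0 G0 oppr0 expR0 mulr1 expRN ler_pdivrMr ?expR_gt0 // mul1r.
Qed.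

Lemma log_poly_grad q u w : 0 <= u -> 0 <= w ->
  (log_poly q).[u] + (geom_poly q).[u] * (w - u) <= (log_poly q).[w].
Proof.
move=> u0 w0; rewrite !log_polyE geom_polyE mulr_suml -big_split; apply: ler_sum => k _ /=.
have K0 : (0 : R) < k.+1%:R by [].
rewrite ler_pdivlMr // mulrDl divfK ?gt_eqF //.
by rewrite [X in _ + X]mulrC mulrA; exact: expr_grad.
Qed.

Lemma log_poly_ge_term q u k : 0 <= u -> (k < q)%N -> u ^+ k.+1 / k.+1%:R <= (log_poly q).[u].
Proof.
move=> u0 kq; rewrite log_polyE (bigD1 (Ordinal kq)) //= lerDl sumr_ge0 // => i _.
by rewrite divr_ge0 // exprn_ge0.
Qed.

Lemma log_poly_le q u w : 0 <= u -> u <= w -> (log_poly q).[u] <= (log_poly q).[w].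
Proof.
move=> u0 uw; have w0 := le_trans u0 uw; apply: le_trans (log_poly_grad q u0 w0).
by rewrite lerDl mulr_ge0 ?geom_poly_ge0 // subr_ge0.
Qed.

Lemma log_poly_le_geom q u : 0 <= u < 1 -> (log_poly q).[u] <= u / (1 - u).
Proof.
move=> /andP[u0 u1]; have d0 : 0 < 1 - u by lra.
rewrite ler_pdivlMr // log_polyE.
have geom : (\sum_(k < q) u ^+ k.+1) * (1 - u) = u - u ^+ q.+1.
  elim: q => [|q IH]; first by rewrite big_ord0 mul0r expr1 subrr.
  by rewrite big_ord_recr /= mulrDl IH [in RHS]exprS !exprS; lra.
apply: (@le_trans _ _ (u - u ^+ q.+1)); last by rewrite gerBl exprn_ge0.
rewrite -geom; apply: ler_wpM2r; first exact: ltW.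
apply: ler_sum => k _; rewrite ler_pdivrMr // ler_peMr ?exprn_ge0 // ?ler1n //.
Qed.

(** A smooth substitute for |t|, which makes the potential differentiable at 0. *)
Definition hyp_norm t : R := Num.sqrt (1 + t ^+ 2).
Lemma sqr_hyp_norm t : hyp_norm t ^+ 2 = 1 + t ^+ 2.
Proof. by rewrite sqr_sqrtr // addr_ge0 ?sqr_ge0. Qed.
Lemma hyp_norm_ge1 t : 1 <= hyp_norm t.
Proof. by rewrite -[leLHS]sqrtr1 ler_sqrt ?addr_ge0 ?sqr_ge0 // lerDl sqr_ge0. Qed.
Lemma hyp_norm_gt0 t : 0 < hyp_norm t.
Proof. exact: lt_le_trans (hyp_norm_ge1 t). Qed.
Lemma normr_le_hyp_norm t : `|t| <= hyp_norm t.
Proof. by rewrite -sqrtr_sqr ler_sqrt ?addr_ge0 ?sqr_ge0 // lerDr. Qed.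
Lemma hyp_norm_le t : hyp_norm t <= 1 + `|t|.
Proof.
rewrite -ler_sqr ?nnegrE ?addr_ge0 ?(ltW (hyp_norm_gt0 _)) // sqr_hyp_norm.
rewrite -[t ^+ 2]real_normK ?num_real //; have := normr_ge0 t; move: `|t| => a; lra.
Qed.
Lemma hyp_normN t : hyp_norm (- t) = hyp_norm t.
Proof. by rewrite /hyp_norm sqrrN. Qed.
Lemma hyp_norm0 : hyp_norm 0 = 1.
Proof. by rewrite /hyp_norm expr0n addr0 sqrtr1. Qed.

Lemma hyp_norm_grad x y : hyp_norm x + x / hyp_norm x * (y - x) <= hyp_norm y.
Proof.
have vx := hyp_norm_gt0 x; have vy := hyp_norm_gt0 y.
have h : 1 + x * y <= hyp_norm x * hyp_norm y.
  have [n0|p0] := ltP (1 + x * y) 0; first by rewrite (le_trans (ltW n0)) // mulr_ge0 // ltW.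
  rewrite -ler_sqr ?nnegrE ?mulr_ge0 ?(ltW vx) ?(ltW vy) // exprMn !sqr_hyp_norm.
  by have := sqr_ge0 (x - y); lra.
have -> : hyp_norm x + x / hyp_norm x * (y - x) = (1 + x * y) / hyp_norm x.
  rewrite mulrAC -[X in X + _](mulfK (lt0r_neq0 vx)) -expr2 sqr_hyp_norm -mulrDl; congr (_ / _); lra.
by rewrite ler_pdivrMr // (mulrC (hyp_norm y)).
Qed.

Lemma hyp_norm_scale (l : R) t : 1 <= l -> hyp_norm (l * t) <= l * hyp_norm t.
Proof.
move=> l1; rewrite -ler_sqr ?nnegrE ?mulr_ge0 ?(ltW (hyp_norm_gt0 _)) //; last by lra.
rewrite exprMn !sqr_hyp_norm exprMn mulrDr mulr1 lerD2r.
by rewrite -[leLHS](expr1n _ 2) ler_sqr ?nnegrE //; lra.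
Qed.

Lemma continuous_hyp_norm : continuous hyp_norm.
Proof.
move=> t; apply: (@continuous_comp _ _ _ (fun t => 1 + t ^+ 2) Num.sqrt).
  by apply: cvgD; [exact: cvg_cst|exact: exprn_continuous].
exact: sqrt_continuous.
Qed.

Section WithExponent.
Variables (p : R) (p1 : 1 <= p).

(** Splitting p as the product of an integer and a factor in [1, 2] leaves an integer
    truncation order for the logarithm while the top term still grows like the power p. *)
Definition int_exp : nat := Num.truncn p.
Definition frac_exp : R := p / int_exp%:R.

Lemma int_exp_itv : int_exp%:R <= p < int_exp.+1%:R.
Proof. by apply: truncn_itv; exact: le_trans ler01 p1. Qed.
Lemma int_exp_gt0 : (0 < int_exp)%N.
Proof.
have /andP[_] := int_exp_itv; rewrite lt0n; apply: contraTneq => ->; rewrite -leNgt //.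
Qed.
Lemma int_expR_gt0 : (0 : R) < int_exp%:R. Proof. by rewrite ltr0n int_exp_gt0. Qed.
Lemma frac_exp_itv : 1 <= frac_exp <= 2.
Proof.
have /andP[h1 h2] := int_exp_itv; rewrite /frac_exp ler_pdivlMr ?int_expR_gt0 // mul1r h1 /=.
rewrite ler_pdivrMr ?int_expR_gt0 // (le_trans (ltW h2)) // -natr1.
have : (1 : R) <= int_exp%:R by rewrite ler1n int_exp_gt0.
by move: (int_exp%:R) => a; lra.
Qed.
Lemma frac_int_exp : frac_exp * int_exp%:R = p. Proof. by rewrite /frac_exp divfK // gt_eqF // int_expR_gt0. Qed.

(** The factor 1/2 keeps the argument well inside the interval of convergence [0, 1)
    when t is small, where phi must be bounded independently of p. *)
Definition phi_arg t := (hyp_norm t / 2) `^ frac_exp.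
Definition dphi_arg t := frac_exp * (hyp_norm t / 2) `^ (frac_exp - 1) * (t / hyp_norm t / 2).

Let v2 t : 0 < hyp_norm t / 2. Proof. by rewrite divr_gt0 // hyp_norm_gt0. Qed.
Lemma phi_arg_ge0 t : 0 <= phi_arg t. Proof. exact: powR_ge0. Qed.

Lemma phi_arg_grad x y : phi_arg x + dphi_arg x * (y - x) <= phi_arg y.
Proof.
have /andP[r1 r2] := frac_exp_itv.
apply: le_trans (powR_grad r1 (v2 x) (ltW (v2 y))); rewrite -/(phi_arg x) lerD2l.
have -> : dphi_arg x * (y - x) = frac_exp * (hyp_norm x / 2) `^ (frac_exp - 1) * (x / hyp_norm x * (y - x) / 2).
  by rewrite /dphi_arg; lra.
apply: ler_wpM2l; first by rewrite mulr_ge0 ?powR_ge0 //; lra.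
by have := hyp_norm_grad x y; lra.
Qed.

Definition phi t := (log_poly int_exp).[phi_arg t] - (log_poly int_exp).[phi_arg 0].
Definition dphi t := (geom_poly int_exp).[phi_arg t] * dphi_arg t.

Lemma dphi_arg0 : dphi_arg 0 = 0. Proof. by rewrite /dphi_arg mul0r mul0r mulr0. Qed.
Lemma dphi0 : dphi 0 = 0. Proof. by rewrite /dphi dphi_arg0 mulr0. Qed.
Lemma phi0 : phi 0 = 0. Proof. by rewrite /phi subrr. Qed.
Lemma phiN t : phi (- t) = phi t. Proof. by rewrite /phi /phi_arg hyp_normN. Qed.

(** phi is convex, being a composition of convex functions of which the outer ones are
    nondecreasing. *)
Lemma phi_grad x y : phi x + dphi x * (y - x) <= phi y.
Proof.
rewrite /phi addrAC lerD2r; apply: le_trans (log_poly_grad int_exp (phi_arg_ge0 x) (phi_arg_ge0 y)).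
rewrite lerD2l /dphi -mulrA; apply: ler_wpM2l; first exact: geom_poly_ge0 (phi_arg_ge0 _).
by have := phi_arg_grad x y; lra.
Qed.

Lemma phi_arg_ge t : hyp_norm t / 2 - 1 <= phi_arg t.
Proof.
have /andP[r1 r2] := frac_exp_itv.
have [h|h] := leP 1 (hyp_norm t / 2).
  by apply: le_trans (le1r_powR h r1); lra.
by apply: (@le_trans _ _ 0); [lra|exact: phi_arg_ge0].
Qed.

Lemma phi_arg0 : 1 / 4 <= phi_arg 0 <= 1 / 2.
Proof.
have /andP[r1 r2] := frac_exp_itv.
have h : (0 < 1 / 2 :> R) && (1 / 2 <= 1 :> R) by rewrite divr_gt0 //= ler_pdivrMr // mul1r ler1n.
rewrite /phi_arg hyp_norm0; apply/andP; split; last exact: ge1r_powR.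
apply: le_trans (ger_powR h r2); rewrite (@powR_mulrn _ _ 2); lra.
Qed.

Lemma log_poly_phi_arg0 : (log_poly int_exp).[phi_arg 0] <= 1.
Proof.
have /andP[h1 h2] := phi_arg0; have h : 0 <= phi_arg 0 < 1 by apply/andP; split; lra.
apply: (le_trans (log_poly_le_geom int_exp h)).
by rewrite ler_pdivrMr; lra.
Qed.

(** The linear term of the logarithm alone gives a linear growth that does not depend on
    p. *)
Lemma phi_lower t : (hyp_norm t - 1) / 4 <= phi t.
Proof.
have /andP[r1 r2] := frac_exp_itv; have /andP[h1 h2] := phi_arg0.
have g1 : 1 <= (geom_poly int_exp).[phi_arg 0].
  case: int_exp int_exp_gt0 => // q _; rewrite geom_polyS !hornerE /= lerDl mulr_ge0 ?geom_poly_ge0 //; exact: phi_arg_ge0.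
have d : (hyp_norm t - 1) / 4 <= phi_arg t - phi_arg 0.
  have -> : phi_arg t = hyp_norm t `^ frac_exp * phi_arg 0.
    by rewrite /phi_arg hyp_norm0 -powRM // ?divr_ge0 // ?(ltW (hyp_norm_gt0 _)) // mul1r.
  have := le1r_powR (hyp_norm_ge1 t) r1; have := hyp_norm_ge1 t.
  move: (hyp_norm t) (hyp_norm t `^ frac_exp) (phi_arg 0) h1 h2 => b a c h1 h2 b1 ab.
  have : 0 <= (c - 1 / 4) * (a - 1) by apply: mulr_ge0; lra.
  lra.
have := log_poly_grad int_exp (phi_arg_ge0 0) (phi_arg_ge0 t); rewrite /phi.
have v1 := hyp_norm_ge1 t.
move: d g1 v1; move: (geom_poly int_exp).[phi_arg 0] (log_poly int_exp).[phi_arg t] (log_poly int_exp).[phi_arg 0] => G L L0.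
move: (hyp_norm t) (phi_arg 0) (phi_arg t) => v u0 u d g1 v1 h.
have : 0 <= (G - 1) * (u - u0) by apply: mulr_ge0; lra.
lra.
Qed.

(** By convexity it is enough to bound phi at 0, where it vanishes, and at 1, where the
    argument of the logarithm is at most 3/4. *)
Lemma phi_small t : `|t| <= 1 -> phi t <= 3 * `|t|.
Proof.
move=> t1; wlog t0 : t t1 / 0 <= t => [H|].
  have [t0|t0] := leP 0 t; first exact: H.
  by rewrite -phiN -normrN; apply: H; rewrite ?normrN // oppr_ge0 ltW.
rewrite ger0_norm // in t1 *.
have p1le : phi 1 <= 3.
  have u1 : phi_arg 1 <= 3 / 4.
    have /andP[r1 r2] := frac_exp_itv.
    have v1 : hyp_norm 1 <= 3 / 2.
      have h32 : (0 : R) <= 3 / 2 by lra.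
      rewrite -ler_sqr ?nnegrE ?h32 ?(ltW (hyp_norm_gt0 _)) // sqr_hyp_norm; lra.
    have h : 0 < hyp_norm 1 / 2 <= 1 by rewrite v2 /=; lra.
    by apply: (le_trans (ge1r_powR h r1)); lra.
  have h : 0 <= phi_arg 1 < 1 by rewrite phi_arg_ge0 /=; lra.
  have l0 : 0 <= (log_poly int_exp).[phi_arg 0].
    by rewrite log_polyE sumr_ge0 // => k _; rewrite divr_ge0 // exprn_ge0 // phi_arg_ge0.
  have := log_poly_le_geom int_exp h; rewrite ler_pdivlMr; last by lra.
  move: l0 u1 h; rewrite /phi; move: (phi_arg 1) (log_poly int_exp).[phi_arg 1] (log_poly int_exp).[phi_arg 0] => U L L0 l0 u1 /andP[U0 U1] h.
  have : L * (1 / 4) <= L * (1 - U) \/ L < 0.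
    have [l|l] := leP 0 L; last by right.
    by left; apply: ler_wpM2l => //; lra.
  by case; lra.
have h1 := phi_grad t 1; have h0 := phi_grad t 0.
have t1' : 0 <= 1 - t by rewrite subr_ge0.
have := ler_wpM2l t0 p1le; have := ler_wpM2l t0 h1; have := ler_wpM2l t1' h0; rewrite phi0.
move: (phi t) (phi 1) (dphi t) => a b d; lra.
Qed.

Lemma phi_arg_exp t : phi_arg t ^+ int_exp = (hyp_norm t / 2) `^ p.
Proof. by rewrite /phi_arg -powR_mulrn ?powR_ge0 // -powRrM frac_int_exp. Qed.

Lemma int_exp_le_powR : int_exp%:R <= 2 `^ p.
Proof.
apply: (@le_trans _ _ (2 ^+ int_exp)).
  by rewrite -natrX ler_nat ltnW // ltn_expl.
by rewrite -powR_mulrn // ler_powR //; [lra|case/andP: int_exp_itv].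
Qed.

(** The last term of the truncated logarithm, of degree p in |t|; its coefficient 1/q is
    absorbed by 2 `^ p. *)
Lemma phi_power_lower t : (`|t| / 2) `^ p <= 2 `^ p * (phi t + 1).
Proof.
have p0 : 0 <= p by exact: le_trans ler01 p1.
have h : (`|t| / 2) `^ p <= phi_arg t ^+ int_exp.
  rewrite phi_arg_exp; apply: ge0_ler_powR; rewrite ?nnegrE ?divr_ge0 // ?(ltW (hyp_norm_gt0 _)) //.
  by have := normr_le_hyp_norm t; lra.
have := @log_poly_ge_term int_exp (phi_arg t) int_exp.-1 (phi_arg_ge0 t).
rewrite prednK ?int_exp_gt0 // leqnn => /(_ isT); rewrite ler_pdivrMr ?int_expR_gt0 // => h2.
have := log_poly_phi_arg0; have := int_exp_le_powR; move: h h2; rewrite /phi.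
have L0 : 0 <= (log_poly int_exp).[phi_arg t].
  by rewrite log_polyE sumr_ge0 // => k _; rewrite divr_ge0 // exprn_ge0 // phi_arg_ge0.
move: (2 `^ p) (int_exp%:R) (powR_ge0 2 p) => P Q P0 h h2 QP l0.
have := ler_wpM2l L0 QP; move: h2 h; move: (_ `^ p) (phi_arg t ^+ int_exp) => a b h2 h h3.
have : 0 <= P * (1 - (log_poly int_exp).[phi_arg 0]) by rewrite mulr_ge0 // subr_ge0.
lra.
Qed.

(** With the argument replaced by its maximum with 1, all terms of the truncated
    logarithm are at most the last power, and there are at most 2 `^ p of them. *)
Lemma phi_power_upper t : phi t <= (2 * (1 + `|t|)) `^ p.
Proof.
have p0 : 0 <= p by exact: le_trans ler01 p1.
pose U := Num.max 1 (phi_arg t).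
have U1 : 1 <= U by rewrite le_max lexx.
have hU : (log_poly int_exp).[phi_arg t] <= int_exp%:R * U ^+ int_exp.
  have l : phi_arg t <= U by rewrite le_max lexx orbT.
  apply: (le_trans (log_poly_le int_exp (phi_arg_ge0 t) l)).
  have -> : int_exp%:R * U ^+ int_exp = \sum_(k < int_exp) U ^+ int_exp by rewrite sumr_const card_ord mulr_natl.
  rewrite log_polyE; apply: ler_sum => k _.
  apply: (@le_trans _ _ (U ^+ k.+1)).
    by rewrite ler_pdivrMr // ler_peMr ?ler1n // exprn_ge0 //; lra.
  by apply: ler_weXn2l => //.
have UU : U ^+ int_exp <= (1 + `|t|) `^ p.
  have a1 : 1 <= 1 + `|t| by rewrite lerDl.
  rewrite /U; have [_|_] := leP 1 (phi_arg t).
    rewrite phi_arg_exp; apply: ge0_ler_powR; rewrite ?nnegrE ?(ltW (v2 t)) ?(le_trans ler01 a1) //.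
    by have := hyp_norm_le t; have := hyp_norm_gt0 t; lra.
  rewrite expr1n; apply: (@le_trans _ _ ((1 : R) `^ p)); first by rewrite powR1.
  by apply: ge0_ler_powR; rewrite ?nnegrE ?(le_trans ler01 a1).
have l0 : 0 <= (log_poly int_exp).[phi_arg 0].
  by rewrite log_polyE sumr_ge0 // => k _; rewrite divr_ge0 // exprn_ge0 // phi_arg_ge0.
rewrite powRM //; apply: (@le_trans _ _ (int_exp%:R * U ^+ int_exp)).
  by rewrite /phi; lra.
by apply: ler_pM => //; [apply: exprn_ge0; lra|exact: int_exp_le_powR].
Qed.

Lemma dphi_arg_le t : `|dphi_arg t| <= `|t|.
Proof.
have /andP[r1 r2] := frac_exp_itv; have v1 := hyp_norm_ge1 t; have v0 := hyp_norm_gt0 t.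
have h : (hyp_norm t / 2) `^ (frac_exp - 1) <= hyp_norm t.
  have r0 : 0 <= frac_exp - 1 by lra.
  apply: (@le_trans _ _ (hyp_norm t `^ (frac_exp - 1))).
    by apply: ge0_ler_powR; rewrite ?nnegrE ?(ltW (v2 t)) ?(ltW v0) //; lra.
  by apply: ler1_powR => //; lra.
rewrite /dphi_arg; move: (frac_exp) r1 r2 h => r r1 r2 h.
rewrite !normrM !normfV (ger0_norm (powR_ge0 _ _)) (gtr0_norm v0) normr_nat.
rewrite (ger0_norm (x := r)); last by lra.
have hv : (hyp_norm t / 2) `^ (r - 1) / hyp_norm t <= 1 by rewrite ler_pdivrMr // mul1r.
have hv0 : 0 <= (hyp_norm t / 2) `^ (r - 1) / hyp_norm t by rewrite divr_ge0 ?powR_ge0 // ltW.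
have -> : r * (hyp_norm t / 2) `^ (r - 1) * (`|t| / hyp_norm t / 2) =
   `|t| * (r / 2 * ((hyp_norm t / 2) `^ (r - 1) / hyp_norm t)) by lra.
rewrite -[leRHS]mulr1 ler_wpM2l // -[leRHS]mulr1; apply: ler_pM => //; lra.
Qed.

(** Dilating t multiplies the argument by at most l `^ (p / q), hence the monomials, of
    degree less than q, by at most l `^ p. *)
Lemma geom_poly_dilate (l E : R) t : 1 <= l -> l `^ p <= E -> (geom_poly int_exp).[phi_arg (l * t)] <= E * (geom_poly int_exp).[phi_arg t].
Proof.
move=> l1 lE; have /andP[r1 r2] := frac_exp_itv; have l0 : 0 <= l by lra.
have pr0 : 0 <= frac_exp by exact: le_trans ler01 r1.
have h : phi_arg (l * t) <= l `^ frac_exp * phi_arg t.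
  have lv : 0 <= l * (hyp_norm t / 2) by rewrite mulr_ge0 // ltW.
  rewrite /phi_arg -powRM ?(ltW (v2 t)) //; apply: ge0_ler_powR; rewrite ?nnegrE ?(ltW (v2 _)) ?lv ?pr0 //.
  by have := hyp_norm_scale t l1; lra.
have lr1 : 1 <= l `^ frac_exp.
  apply: (@le_trans _ _ ((1 : R) `^ frac_exp)); first by rewrite powR1.
  by apply: ge0_ler_powR; rewrite ?nnegrE.
rewrite !geom_polyE mulr_sumr; apply: ler_sum => k _.
apply: (@le_trans _ _ ((l `^ frac_exp * phi_arg t) ^+ k)).
  by apply: lerXn2r; rewrite ?nnegrE ?mulr_ge0 ?powR_ge0 ?phi_arg_ge0.
rewrite exprMn; apply: ler_wpM2r; first by rewrite exprn_ge0 ?phi_arg_ge0.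
apply: le_trans lE; apply: (@le_trans _ _ ((l `^ frac_exp) ^+ int_exp)).
  by apply: ler_weXn2l => //; exact: ltnW.
by rewrite -powR_mulrn ?powR_ge0 // -powRrM frac_int_exp.
Qed.

Lemma sqr_le_expR (x : R) : 0 <= x -> x ^+ 2 <= 4 * expR x.
Proof.
move=> x0; have h := expR_ge1Dx (x / 2).
have -> : expR x = expR (x / 2) ^+ 2 by rewrite -expRM_natl; congr expR; lra.
have : (x / 2) ^+ 2 <= expR (x / 2) ^+ 2 by apply: lerXn2r; rewrite ?nnegrE ?expR_ge0; lra.
rewrite expr_div_n; lra.
Qed.

(** Up to constants, dphi (l t)^2 is at most t^2 exp (2 L) and exp (- 4 phi) is exp (- 4
    L), where L is the truncated logarithm. There remains t^2 exp (- 2 L), and L >= |t| / 2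
    - 1. *)
Lemma dphi_dilate (l E : R) t : 1 <= l <= 2 -> l `^ p <= E ->
  dphi (l * t) ^+ 2 * expR (- (4 * phi t)) <= 64 * E ^+ 2 * expR 6 * expR (- (`|t| / 2)).
Proof.
move=> /andP[l1 l2] lE.
have E0 : 0 <= E by apply: le_trans lE; exact: powR_ge0.
set L := (log_poly int_exp).[phi_arg t]; set L0 := (log_poly int_exp).[phi_arg 0].
have G : `|dphi (l * t)| <= 2 * E * `|t| * expR L.
  rewrite /dphi normrM ger0_norm; last exact: geom_poly_ge0 (phi_arg_ge0 _).
  have h1 := geom_poly_dilate t l1 lE; have h2 := geom_poly_le_expR int_exp (phi_arg_ge0 t).
  have h3 := dphi_arg_le (l * t); rewrite (normrM l t) (ger0_norm (x := l)) in h3; last by lra.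
  apply: (@le_trans _ _ ((E * expR L) * (2 * `|t|))); last by lra.
  apply: ler_pM => //; first exact: geom_poly_ge0 (phi_arg_ge0 _).
    by apply: (le_trans h1); apply: ler_wpM2l.
  by apply: (le_trans h3); apply: ler_wpM2r.
have G2 : dphi (l * t) ^+ 2 <= (2 * E * `|t| * expR L) ^+ 2.
  rewrite -[leLHS]real_normK ?num_real //; apply: lerXn2r; rewrite ?nnegrE //.
  by rewrite !mulr_ge0 ?expR_ge0.
have L00 : L0 <= 1 by exact: log_poly_phi_arg0.
have Lu : `|t| / 2 - 1 <= L.
  apply: (@le_trans _ _ (phi_arg t)).
    by have := phi_arg_ge t; have := normr_le_hyp_norm t; lra.
  by have := @log_poly_ge_term int_exp (phi_arg t) 0 (phi_arg_ge0 t) int_exp_gt0; rewrite expr1 divr1.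
apply: (le_trans (ler_wpM2r (expR_ge0 _) G2)).
have t2 : `|t| ^+ 2 <= 16 * expR (`|t| / 2).
  have := @sqr_le_expR (`|t| / 2); rewrite divr_ge0 // => /(_ isT).
  rewrite expr_div_n; lra.
have -> : (2 * E * `|t| * expR L) ^+ 2 * expR (- (4 * phi t)) =
   4 * E ^+ 2 * (`|t| ^+ 2 * (expR L ^+ 2 * expR (- (4 * phi t)))) by lra.
have -> : 64 * E ^+ 2 * expR 6 * expR (- (`|t| / 2)) = 4 * E ^+ 2 * (16 * expR (`|t| / 2) * expR (6 - `|t|)).
  have -> : expR (6 - `|t|) = expR 6 * expR (- (`|t| / 2)) * expR (- (`|t| / 2)).
    by rewrite -!expRD; congr expR; lra.
  have : expR (`|t| / 2) * expR (- (`|t| / 2)) = 1 by rewrite -expRD subrr expR0.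
  move: (expR (`|t| / 2)) (expR (- (`|t| / 2))) (expR 6) => a b c ab.
  have -> : 4 * E ^+ 2 * (16 * a * (c * b * b)) = 64 * E ^+ 2 * c * b * (a * b) by lra.
  by rewrite ab mulr1.
apply: ler_wpM2l; first by rewrite mulr_ge0 // sqr_ge0.
apply: ler_pM; rewrite ?sqr_ge0 ?mulr_ge0 ?expR_ge0 ?sqr_ge0 //.
rewrite -expRM_natl -expRD ler_expR /phi -/L -/L0; lra.
Qed.

Lemma continuous_powR_pos (f : R -> R) (r : R) : continuous f -> (forall t, 0 < f t) ->
  continuous (fun t => f t `^ r).
Proof.
move=> cf f0.
have -> : (fun t => f t `^ r) = (fun t => expR (r * ln (f t))).
  by apply/funext => t; rewrite /powR gt_eqF.
move=> t.
have C : {for t, continuous (@ln R \o f)}.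
  by apply: continuous_comp; [exact: cf|exact: continuous_ln].
have C2 : {for t, continuous (fun t => r * (@ln R \o f) t)}.
  by apply: cvgM; [exact: cvg_cst|exact: C].
exact: (continuous_comp C2 (@continuous_expR _ _)).
Qed.

Lemma continuous_half_hyp : continuous (fun t => hyp_norm t / 2).
Proof. by move=> t; apply: cvgM; [exact: continuous_hyp_norm|exact: cvg_cst]. Qed.

Lemma continuous_phi_arg : continuous phi_arg.
Proof. exact: continuous_powR_pos continuous_half_hyp v2. Qed.

Lemma continuous_phi : continuous phi.
Proof.
move=> t; apply: cvgB; last exact: cvg_cst.
apply: (@continuous_comp _ _ _ phi_arg (horner (log_poly int_exp))); first exact: continuous_phi_arg.
exact: continuous_horner.
Qed.

Lemma continuous_dphi : continuous dphi.
Proof.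
move=> t; apply: cvgM.
  apply: (@continuous_comp _ _ _ phi_arg (horner (geom_poly int_exp))); first exact: continuous_phi_arg.
  exact: continuous_horner.
apply: cvgM; first apply: cvgM.
- exact: cvg_cst.
- exact: continuous_powR_pos continuous_half_hyp v2 _.
apply: cvgM; last exact: cvg_cst.
apply: cvgM; first exact: cvg_id.
apply: cvgV; last exact: continuous_hyp_norm.
by rewrite gt_eqF // hyp_norm_gt0.
Qed.
End WithExponent.
End Profile.

(** * One-dimensional integrals of the potential *)

Section OneDim.
Context {R : realType}.
Notation leb1 := (@lebesgue_measure R).
Implicit Types (c t : R).

Lemma measurable_exp_abs c : measurable_fun setT (fun t : measurableTypeR R => expR (- (c * `|t|))).
Proof.
by apply: measurableT_comp => //; apply: measurableT_comp => //; apply: measurable_funM.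
Qed.

Lemma integral_reflect (f : measurableTypeR R -> \bar R) : measurable_fun setT f ->
  (forall t, 0 <= f t)%E -> (\int[leb1]_t f (- t)%R = \int[leb1]_t f t)%E.
Proof.
move=> mf f0.
have mN : measurable_fun setT (fun t : measurableTypeR R => (- t : measurableTypeR R)).
  by apply: continuous_measurable_fun; exact: opp_continuous.
rewrite -[in LHS](preimage_setT (fun t : measurableTypeR R => (- t : measurableTypeR R))).
rewrite -(ge0_integral_pushforward mN leb1 (D := setT)) //.
by apply: eq_measure_integral => A mA _; exact: lebesgue_measureN.
Qed.

Lemma integral_exp_abs_le c : 0 < c ->
  (\int[leb1]_t (expR (- (c * `|t|)))%:E <= (2 / c)%:E)%E.
Proof.
move=> c0.
have mp : measurable_fun setT (fun t : measurableTypeR R => (exponential_pdf c t)%:E).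
  by apply/measurable_EFinP; exact: measurable_exponential_pdf.
have pos t : 0 <= exponential_pdf c t by apply: exponential_pdf_ge0; exact: ltW.
have mN : measurable_fun setT (fun t : measurableTypeR R => (exponential_pdf c (- t))%:E).
  apply: (measurableT_comp mp (_ : measurable_fun setT (fun t : measurableTypeR R => (- t : measurableTypeR R)))).
  by apply: continuous_measurable_fun; exact: opp_continuous.
have -> : (2 / c)%:E = ((c^-1)%:E * (\int[leb1]_t ((exponential_pdf c t)%:E + (exponential_pdf c (- t))%:E)))%E.
  rewrite ge0_integralD //; try by move=> t _; rewrite lee_fin.
  rewrite (integral_reflect mp) ?integral_exponential_pdf //.
  by rewrite -EFinD -EFinM; congr EFin; lra.
rewrite -ge0_integralZl_EFin ?invr_ge0 ?(ltW c0) //; last 2 first.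
- by move=> t _; rewrite -EFinD lee_fin addr_ge0.
- exact: emeasurable_funD.
apply: ge0_le_integral => //.
- by apply/measurable_EFinP; exact: measurable_exp_abs.
- by apply: measurable_funeM; exact: emeasurable_funD.
move=> t _; rewrite -EFinD -EFinM lee_fin.
have E u : 0 <= u -> exponential_pdf c u = c * expR (- (c * u)).
  by move=> u0; rewrite exponential_pdfE // mulNr.
have [t0|t0] := leP 0 t.
  rewrite ger0_norm // (E _ t0); apply: (@le_trans _ _ (c^-1 * (c * expR (- (c * t))))).
    by rewrite mulKf ?gt_eqF.
  by rewrite ler_wpM2l ?invr_ge0 ?(ltW c0) // lerDl.
rewrite ltr0_norm // [X in _ + X]E ?oppr_ge0 ?(ltW t0) //.
apply: (@le_trans _ _ (c^-1 * (c * expR (- (c * - t))))).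
  by rewrite mulKf ?gt_eqF.
by rewrite ler_wpM2l ?invr_ge0 ?(ltW c0) // lerDr.
Qed.

Lemma integral_le_exp_abs (f : measurableTypeR R -> R) (A c : R) : measurable_fun setT f ->
  (forall t, 0 <= f t <= A * expR (- (c * `|t|))) -> 0 <= A -> 0 < c ->
  exists2 z, (\int[leb1]_t (f t)%:E)%E = z%:E & 0 <= z <= A * (2 / c).
Proof.
move=> mf fA A0 c0.
have lo : (0 <= \int[leb1]_t (f t)%:E)%E.
  by apply: integral_ge0 => t _; rewrite lee_fin; case/andP: (fA t).
have hi : (\int[leb1]_t (f t)%:E <= (A * (2 / c))%:E)%E.
  apply: (@le_trans _ _ (\int[leb1]_t (A%:E * (expR (- (c * `|t|)))%:E))%E).
    apply: ge0_le_integral => //.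
    - by move=> t _; rewrite lee_fin; case/andP: (fA t).
    - exact/measurable_EFinP.
    - by apply: measurable_funeM; apply/measurable_EFinP; exact: measurable_exp_abs.
    - by move=> t _; rewrite -EFinM lee_fin; case/andP: (fA t).
  rewrite ge0_integralZl_EFin //; last by apply/measurable_EFinP; exact: measurable_exp_abs.
  by rewrite EFinM; apply: lee_wpmul2l => //; exact: integral_exp_abs_le.
move: lo hi; case: (\int[leb1]_t (f t)%:E)%E => [z| |] //; rewrite !lee_fin => h1 h2.
by exists z => //; rewrite h1.
Qed.

Variables (p : R) (p1 : 1 <= p).

Lemma measurable_phi : measurable_fun setT (phi p : measurableTypeR R -> R).
Proof. by apply: continuous_measurable_fun; exact: continuous_phi. Qed.
Lemma measurable_dphi : measurable_fun setT (dphi p : measurableTypeR R -> R).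
Proof. by apply: continuous_measurable_fun; exact: continuous_dphi. Qed.

Lemma measurable_exp_phi k : measurable_fun setT (fun t : measurableTypeR R => expR (- (k * phi p t))).
Proof.
apply: measurableT_comp => //; apply: measurableT_comp => //.
by apply: measurable_funM => //; exact: measurable_phi.
Qed.

Lemma phi_ge_abs t : (`|t| - 1) / 4 <= phi p t.
Proof. by have := phi_lower p1 t; have := normr_le_hyp_norm t; lra. Qed.

Lemma phi_ge0 t : 0 <= phi p t.
Proof. by have := phi_lower p1 t; have := hyp_norm_ge1 t; lra. Qed.

Lemma integral_exp_phi k : 0 < k -> exists2 z,
  (\int[leb1]_t (expR (- (k * phi p t)))%:E)%E = z%:E & 0 <= z <= expR (k / 4) * (8 / k).
Proof.
move=> k0; have k4 : 0 < k / 4 by lra.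
have [||z -> hz] := integral_le_exp_abs (measurable_exp_phi k) (A := expR (k / 4)) (c := k / 4) _ _ k4.
- move=> t; rewrite expR_ge0 /= -expRD ler_expR.
  have := ler_wpM2l (ltW k0) (phi_ge_abs t); lra.
- exact: expR_ge0.
exists z => //; move: hz; rewrite (_ : 2 / (k / 4) = 8 / k) //.
by rewrite invf_div; lra.
Qed.

(** The tangent line of hyp_norm at tau gives k phi(t) >= tau / (v - 1) |t| - 1 with v =
    hyp_norm tau, and 2 (v - 1) <= tau^2. The constant k is stated explicitly because it
    must not depend on p. *)
Lemma integral_exp_phi_small (tau : R) : 0 < tau -> exists k, 0 < k /\
  k = 4 * hyp_norm tau / (hyp_norm tau - 1) /\
  exists2 z, (\int[leb1]_t (expR (- (k * phi p t)))%:E)%E = z%:E & 0 <= z <= expR 1 * tau.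
Proof.
move=> tau0; set v := hyp_norm tau.
have v2 : v ^+ 2 = 1 + tau ^+ 2 by exact: sqr_hyp_norm.
have v1 : 1 <= v by exact: hyp_norm_ge1.
have tt : 0 < tau ^+ 2 by rewrite exprn_gt0.
have v1' : 0 < v - 1.
  rewrite subr_gt0 lt_neqAle v1 andbT; apply: contraTneq tt => v1E.
  by move: v2; rewrite -v1E expr1n => h; rewrite -leNgt; lra.
have v0 : 0 < v by lra.
pose k := 4 * v / (v - 1); exists k.
have k0 : 0 < k by rewrite divr_gt0 // mulr_gt0.
split=> //; split=> //.
have c0 : 0 < tau / (v - 1) by rewrite divr_gt0.
have [||z -> hz] := integral_le_exp_abs (measurable_exp_phi k) (A := expR 1) (c := tau / (v - 1)) _ _ c0.
- move=> t; rewrite expR_ge0 /= -expRD ler_expR.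
  have h1 := ler_wpM2l (ltW k0) (phi_lower p1 t).
  have h2 : (1 + tau * `|t|) / v <= hyp_norm t.
    rewrite ler_pdivrMr //; have := hyp_norm_grad tau `|t|; rewrite -/v.
    have -> : hyp_norm `|t| = hyp_norm t by rewrite /hyp_norm real_normK ?num_real.
    have -> : v + tau / v * (`|t| - tau) = (1 + tau * `|t|) / v.
      rewrite mulrAC -[X in X + _](mulfK (lt0r_neq0 v0)) -expr2 v2 -mulrDl; congr (_ / _); lra.
    by rewrite ler_pdivrMr.
  have h3 : k * ((hyp_norm t - 1) / 4) = (v * hyp_norm t - v) / (v - 1) by rewrite /k; lra.
  have h4 : (1 + tau * `|t| - v) / (v - 1) <= (v * hyp_norm t - v) / (v - 1).
    by rewrite ler_pM2r ?invr_gt0 //; move: h2; rewrite ler_pdivrMr // => h2; lra.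
  have h5 : (1 + tau * `|t| - v) / (v - 1) = tau / (v - 1) * `|t| - 1.
    have -> : 1 + tau * `|t| - v = tau * `|t| - (v - 1) by lra.
    by rewrite mulrBl divff ?gt_eqF //; lra.
  lra.
- exact: expR_ge0.
exists z => //; case/andP: hz => -> /= /le_trans; apply; apply: ler_wpM2l; first exact: expR_ge0.
rewrite invf_div mulrA ler_pdivrMr //.
have : 0 <= (v - 1) ^+ 2 by exact: sqr_ge0.
by rewrite -expr2; move: v2; lra.
Qed.

Lemma integral_exp_phi_ge :
  ((expR (- 12))%:E <= \int[leb1]_t (expR (- (4 * phi p t)))%:E)%E.
Proof.
have -> : (expR (-12))%:E = (\int[leb1]_(t in `[0%R, 1%R]%classic) (expR (-12))%:E)%E :> \bar R.
  rewrite integral_cst //= (lebesgue_measure_itv `[0, 1]) /= lte_fin ltr01 -EFinB subr0.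
  by rewrite mule1.
apply: (@le_trans _ _ (\int[leb1]_(t in `[0%R, 1%R]%classic) (expR (- (4 * phi p t)))%:E)%E); last first.
  apply: ge0_subset_integral => //.
  by apply/measurable_EFinP; exact: measurable_exp_phi.
apply: ge0_le_integral => //.
- by apply/measurable_EFinP; apply: measurable_funTS; exact: measurable_exp_phi.
move=> t /=; rewrite in_itv /= => /andP[t0 t1]; rewrite lee_fin ler_expR.
have t1' : `|t| <= 1 by rewrite ger0_norm.
by have := phi_small p1 t1'; rewrite ger0_norm //; lra.
Qed.

Lemma integral_dphi_dilate (l E : R) : 1 <= l <= 2 -> l `^ p <= E -> exists2 z,
  (\int[leb1]_t (dphi p (l * t) ^+ 2 * expR (- (4 * phi p t)))%:E)%E = z%:E &
  0 <= z <= 256 * E ^+ 2 * expR 6.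
Proof.
move=> l12 lE.
have mf : measurable_fun setT (fun t : measurableTypeR R => dphi p (l * t) ^+ 2 * expR (- (4 * phi p t))).
  apply: measurable_funM; last exact: measurable_exp_phi.
  apply: measurable_funX; apply: (measurableT_comp measurable_dphi).
  exact: measurable_funM.
have c0 : (0 : R) < 1 / 2 by lra.
have [||z -> hz] := integral_le_exp_abs mf (A := 64 * E ^+ 2 * expR 6) (c := 1 / 2) _ _ c0.
- move=> t; rewrite mulr_ge0 ?sqr_ge0 ?expR_ge0 //=.
  rewrite (_ : 1 / 2 * `|t| = `|t| / 2); last by lra.
  exact: dphi_dilate.
- by apply: mulr_ge0; [apply: mulr_ge0 => //; exact: sqr_ge0|exact: expR_ge0].
by exists z => //; case/andP: hz => -> /= /le_trans; apply; lra.
Qed.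
End OneDim.

(** * Integrals over sublevel sets of the separable potential *)

Section Pointwise.
Context {R : realType}.
Implicit Types y : R.

Lemma expR_Nhalf : expR (- 4) <= 1 / 2 :> R.
Proof.
rewrite expRN; have h := expR_ge1Dx (4 : R); have e0 := expR_gt0 (4 : R).
rewrite -[X in X <= _]div1r ler_pdivrMr //; lra.
Qed.

(** A geometric series starting at the first integer k >= y; the bound with K inside is
    the form that can be proved by induction. *)
Lemma level_sum_le y K : 0 <= y ->
  \sum_(k < K) (if y <= k%:R then expR (- (4 * k%:R)) else 0) <= 2 * expR (- (4 * y)).
Proof.
move=> y0.
suff : \sum_(k < K) (if y <= k%:R then expR (- (4 * k%:R)) else 0) <=
    2 * Num.max 0 (expR (- (4 * y)) - expR (- (4 * K%:R))).
  move/le_trans; apply; apply: ler_wpM2l => //.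
  by rewrite ge_max expR_ge0 gerBl expR_ge0.
elim: K => [|K IH]; first by rewrite big_ord0 mulr_ge0 // le_max lexx.
rewrite big_ord_recr /=; case: (leP y K%:R) => [yK|Ky]; last first.
  rewrite addr0; apply: (le_trans IH); apply: ler_wpM2l => //.
  have h : expR (- (4 * y)) - expR (- (4 * K%:R)) <= 0.
    by rewrite subr_le0 ler_expR; lra.
  by rewrite ge_max !le_max lexx h.
apply: (le_trans (lerD IH (lexx _))).
have h1 : expR (- (4 * K%:R)) <= expR (- (4 * y)) :> R by rewrite ler_expR; lra.
have -> : expR (- (4 * K.+1%:R)) = expR (- 4) * expR (- (4 * K%:R)) :> R.
  by rewrite -expRD; congr expR; rewrite -natr1; lra.
have h2 : expR (- 4) * expR (- (4 * K%:R)) <= 1 / 2 * expR (- (4 * K%:R)) :> R.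
  by rewrite ler_wpM2r ?expR_ge0 // expR_Nhalf.
have e0 := expR_ge0 (- (4 * K%:R) : R).
rewrite (max_idPr _); last by rewrite subr_ge0.
rewrite (max_idPr _); last by move: h1 h2 e0; lra.
by move: h1 h2 e0; lra.
Qed.

(** The three terms take care of y < k0, of k0 <= y < k1, where the first integer above
    y is one of the summation indices, and of y >= k1. *)
Lemma exp_split (kap y : R) (k0 k1 : nat) : 0 <= y -> 0 <= kap ->
  expR (- (4 * y)) <= expR 4 * (\sum_(k < k1.+1) (if (k0 < k)%N then (if y <= k%:R then expR (- (4 * k%:R)) else 0) else 0))
     + expR (kap * k0%:R) * expR (- (kap * y)) + expR (- (2 * k1%:R)) * expR (- (2 * y)).
Proof.
move=> y0 kap0.
have s0 : 0 <= expR 4 * (\sum_(k < k1.+1) (if (k0 < k)%N then (if y <= k%:R then expR (- (4 * k%:R)) else 0) else 0)) :> R.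
  by rewrite mulr_ge0 ?expR_ge0 // sumr_ge0 // => k _; case: ifP => // _; case: ifP => // _; exact: expR_ge0.
have [yk0|k0y] := ltP y k0%:R.
  apply: (@le_trans _ _ (expR (kap * k0%:R) * expR (- (kap * y)))); last first.
    rewrite -addrA addrCA lerDl addr_ge0 // mulr_ge0 ?expR_ge0 //.
  rewrite -expRD ler_expR; have : 0 <= kap * (k0%:R - y) by apply: mulr_ge0 => //; lra.
  lra.
have [k1y|yk1] := leP k1%:R y.
  apply: (@le_trans _ _ (expR (- (2 * k1%:R)) * expR (- (2 * y)))); last first.
    by rewrite lerDr addr_ge0 // mulr_ge0 ?expR_ge0.
  by rewrite -expRD ler_expR; lra.
apply: (@le_trans _ _ (expR 4 * (\sum_(k < k1.+1) (if (k0 < k)%N then (if y <= k%:R then expR (- (4 * k%:R)) else 0) else 0)))); last first.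
  by rewrite -addrA lerDl addr_ge0 // mulr_ge0 ?expR_ge0.
have /andP[t1 t2] := truncn_itv y0.
set t := Num.truncn y in t1 t2.
have tk1 : (t.+1 < k1.+1)%N.
  by rewrite ltnS -(ltr_nat R); apply: le_lt_trans yk1.
have k0t : (k0 < t.+1)%N.
  by rewrite -(ltr_nat R); apply: le_lt_trans t2.
rewrite (bigD1 (Ordinal tk1)) //= k0t (ltW t2) mulrDr.
apply: (@le_trans _ _ (expR 4 * expR (- (4 * t.+1%:R)))).
  by rewrite -expRD ler_expR -natr1; lra.
rewrite lerDl mulr_ge0 ?expR_ge0 // sumr_ge0 // => k _.
by case: ifP => // _; case: ifP => // _; exact: expR_ge0.
Qed.
End Pointwise.

Section PsiFun.
Context {R : realType} (p : R) (p1 : 1 <= p) (n : nat).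
Local Notation T := (n.-tuple (measurableTypeR R)).
Local Notation mu := (@lebesgue_tuple R n).

Definition Psi (x : 'rV[R]_n) : R := \sum_i phi p (x 0 i).
Definition gradsq (l : R) (x : 'rV[R]_n) : R := \sum_i dphi p (l * x 0 i) ^+ 2.
Definition sublevel (s : R) : set 'rV[R]_n := [set x | Psi x <= s].

Lemma Psi_ge0 x : 0 <= Psi x. Proof. by apply: sumr_ge0 => i _; exact: phi_ge0. Qed.
Lemma gradsq_ge0 l x : 0 <= gradsq l x.
Proof. by apply: sumr_ge0 => i _; exact: sqr_ge0. Qed.

Lemma measurable_Psi : measurable_fun setT (fun t : T => Psi (rowT t)).
Proof.
apply: measurable_sum => i; apply: (measurableT_comp (measurable_phi p)).
exact: measurable_coordT.
Qed.

Lemma measurable_gradsq l : measurable_fun setT (fun t : T => gradsq l (rowT t)).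
Proof.
apply: measurable_sum => i; apply: measurable_funX; apply: (measurableT_comp (measurable_dphi p)).
by apply: measurable_funM => //; exact: measurable_coordT.
Qed.

Lemma measurable_exp_Psi k : measurable_fun setT (fun t : T => expR (- (k * Psi (rowT t)))).
Proof.
apply: measurableT_comp => //; apply: measurableT_comp => //.
by apply: measurable_funM => //; exact: measurable_Psi.
Qed.

Lemma measurable_sublevel s : measurable_rV (sublevel s).
Proof.
rewrite /measurable_rV (_ : _ @^-1` _ = setT `&` (fun t => Psi (rowT t)) @^-1` `]-oo, s]%classic).
  by apply: measurable_Psi => //; exact: measurable_itv.
by apply/seteqP; split=> t; rewrite /sublevel /= in_itv /=; [split|case].
Qed.

Lemma integral_exp_Psi k z : (\int[@lebesgue_measure R]_t (expR (- (k * phi p t)))%:E)%E = z%:E ->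
  (\int[mu]_t (expR (- (k * Psi (rowT t))))%:E)%E = (z ^+ n)%:E.
Proof.
move=> hz.
transitivity (\int[mu]_t (\prod_(i < n) (fun _ : nat => fun u : R => expR (- (k * phi p u))) i (tnth t i))%:E)%E.
  apply: eq_integral => t _; congr EFin; rewrite /Psi mulr_sumr -sumrN expR_sum.
  by apply: eq_bigr => i _; rewrite mxE.
have -> := @integral_prodT R n (fun _ : nat => fun u : measurableTypeR R => expR (- (k * phi p u))) (fun _ => z)
  (fun _ => measurable_exp_phi p k) (fun _ _ => expR_ge0 _) (fun _ => hz).
by rewrite prodr_const card_ord.
Qed.

(** Each of the n summands of gradsq depends on a single coordinate, so its integral is
    a product of one factor J and n - 1 factors z. *)
Lemma integral_gradsq_exp l z J : 0 < z ->
  (\int[@lebesgue_measure R]_t (expR (- (4 * phi p t)))%:E)%E = z%:E ->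
  (\int[@lebesgue_measure R]_t (dphi p (l * t) ^+ 2 * expR (- (4 * phi p t)))%:E)%E = J%:E ->
  (\int[mu]_t (gradsq l (rowT t) * expR (- (4 * Psi (rowT t))))%:E)%E = (n%:R * (J / z * z ^+ n))%:E.
Proof.
move=> z0 hz hJ.
pose f (i j : nat) (u : measurableTypeR R) : R :=
  (if j == i then dphi p (l * u) ^+ 2 else 1) * expR (- (4 * phi p u)).
pose c (i j : nat) : R := if j == i then J else z.
have mf i j : measurable_fun setT (f i j).
  apply: measurable_funM; last exact: measurable_exp_phi.
  case: (j == i) => //; apply: measurable_funX; apply: (measurableT_comp (measurable_dphi p)).
  exact: measurable_funM.
have f0 i j u : 0 <= f i j u by rewrite mulr_ge0 ?expR_ge0 //; case: ifP => // _; exact: sqr_ge0.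
have fc i j : (\int[@lebesgue_measure R]_u (f i j u)%:E)%E = (c i j)%:E.
  by rewrite /f /c; case: (j == i) => //; under eq_integral do rewrite mul1r.
have cE (i : 'I_n) : \prod_(j < n) c i j = J / z * z ^+ n.
  have -> : z ^+ n = \prod_(j < n) z by rewrite prodr_const card_ord.
  rewrite (bigD1 i) //= [in RHS](bigD1 i) //= mulrA divfK ?gt_eqF // {1}/c eqxx; congr (_ * _).
  by apply: eq_bigr => j ji; rewrite /c ifF //; exact/negbTE.
transitivity (\int[mu]_t (\sum_(i < n) (\prod_(j < n) f i j (tnth t j))%:E))%E.
  apply: eq_integral => t _; rewrite sumEFin; congr EFin; rewrite /gradsq mulr_suml.
  apply: eq_bigr => i _; rewrite /f big_split /=; congr (_ * _).
    rewrite (bigD1 i) //= eqxx big1 => [|j ji]; last by rewrite ifF //; exact/negbTE.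
    by rewrite mulr1 mxE.
  by rewrite /Psi mulr_sumr -sumrN expR_sum; apply: eq_bigr => j _; rewrite mxE.
rewrite ge0_integral_sum //; last 2 first.
- by move=> i; apply/measurable_EFinP; exact: measurable_prodT.
- by move=> i t _; rewrite lee_fin prodr_ge0.
under eq_bigr => i _ do rewrite (@integral_prodT R n (f i) (c i) (mf i) (f0 i) (fc i)) cE.
by rewrite sumEFin sumr_const card_ord mulr_natl.
Qed.

(** Chernoff's bound. *)
Lemma vol_sublevel_fin k z s : 0 < k -> (\int[@lebesgue_measure R]_t (expR (- (k * phi p t)))%:E)%E = z%:E ->
  (vol (sublevel s) <= (expR (k * s) * z ^+ n)%:E)%E.
Proof.
move=> k0 hz; rewrite (vol_integral (measurable_sublevel s)).
rewrite EFinM -(integral_exp_Psi hz) -ge0_integralZl_EFin ?expR_ge0 //; last first.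
  by apply/measurable_EFinP; exact: measurable_exp_Psi.
apply: (@le_trans _ _ (\int[mu]_(t in rowT @^-1` sublevel s) ((expR (k * s))%:E * (expR (- (k * Psi (rowT t))))%:E))%E).
  apply: ge0_le_integral => //.
  - exact: measurable_sublevel.
  - apply: measurable_funeM; apply/measurable_EFinP; apply: measurable_funTS; exact: measurable_exp_Psi.
  move=> t /= ts; rewrite -EFinM lee_fin -expRD -expR0 ler_expR.
  have : 0 <= k * (s - Psi (rowT t)) by rewrite mulr_ge0 ?(ltW k0) // subr_ge0.
  lra.
apply: ge0_subset_integral => //; first exact: measurable_sublevel.
by apply: measurable_funeM; apply/measurable_EFinP; exact: measurable_exp_Psi.
Qed.

(** The sublevel set contains the cube [0, s / (3 n)]^n, since phi t <= 3 |t| near 0. *)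
Lemma vol_sublevel_gt0 s : 0 < s -> (0 < n)%N -> s <= 3 * n%:R -> ((((s / (3 * n%:R)) ^+ n))%:E <= vol (sublevel s))%E.
Proof.
move=> s0 n0 sn.
have n0' : (0 : R) < n%:R by rewrite ltr0n.
pose d := s / (3 * n%:R); have d0 : 0 < d by rewrite divr_gt0 // mulr_gt0.
have d1 : d <= 1 by rewrite ler_pdivrMr ?mul1r // mulr_gt0.
rewrite -[X in X ^+ n]subr0 -/d -lebesgue_tuple_cube ?(ltW d0) // volE.
apply: le_measure; rewrite ?inE; [exact: measurable_cubeT|exact: measurable_sublevel|].
move=> t /= h; rewrite /sublevel /Psi /=.
apply: (@le_trans _ _ (\sum_(i < n) 3 * d)).
  apply: ler_sum => i _; rewrite mxE; have := h i; rewrite /= in_itv /= => /andP[h1 h2].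
  have t1 : `|tnth t i| <= 1 by rewrite ger0_norm // (le_trans h2).
  by apply: (le_trans (phi_small p1 t1)); rewrite ger0_norm // ler_wpM2l.
rewrite sumr_const card_ord -[_ *+ n]mulr_natr /d.
have -> : 3 * (s / (3 * n%:R)) * n%:R = s / (3 * n%:R) * (3 * n%:R) by lra.
by rewrite divfK // gt_eqF // mulr_gt0.
Qed.

Lemma integral_sublevel_indic s (f : T -> R) : measurable_fun setT f ->
  (\int[mu]_(t in rowT @^-1` sublevel s) (f t)%:E =
   \int[mu]_t (if Psi (rowT t) <= s then f t else 0)%:E)%E.
Proof.
move=> mf; rewrite integral_mkcond; apply: eq_integral => t _.
rewrite patchE; case: ifP => [|/negbT] ts.
  by rewrite ifT //; move: ts; rewrite in_setE.
by rewrite ifF //; apply/negbTE; apply: contra ts => ts; rewrite in_setE.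
Qed.

Lemma measurable_if_sublevel s (f : T -> R) : measurable_fun setT f ->
  measurable_fun setT (fun t => if Psi (rowT t) <= s then f t else 0).
Proof.
move=> mf; apply: measurable_fun_ifT => //.
by apply: measurable_fun_ler => //; exact: measurable_Psi.
Qed.

(** The energy is taken at the dilated point l x, because the area bound integrates the
    gradient over a dilated body. *)
Definition level_energy l (k : R) : \bar R := (\int[mu]_(t in rowT @^-1` sublevel k) (gradsq l (rowT t))%:E)%E.

(** Sum over k of the pointwise bound: a point with Psi = y counts in all levels k >= y,
    with a total weight of at most 2 exp (- 4 y). *)
Lemma level_energy_sum l K D :
  (\int[mu]_t (gradsq l (rowT t) * expR (- (4 * Psi (rowT t))))%:E)%E = D%:E ->
  (\sum_(k < K) (expR (- (4 * k%:R)))%:E * level_energy l k%:R <= (2 * D)%:E)%E.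
Proof.
move=> hD.
have E (k : nat) : ((expR (- (4 * k%:R)))%:E * level_energy l k%:R =
   \int[mu]_t (if (Psi (rowT t) <= k%:R)%R then expR (- (4 * k%:R)) * gradsq l (rowT t) else 0)%:E)%E.
  rewrite /level_energy -ge0_integralZl_EFin ?expR_ge0 //; last 3 first.
  - exact: measurable_sublevel.
  - by move=> t _; rewrite lee_fin gradsq_ge0.
  - by apply/measurable_EFinP; apply: measurable_funTS; exact: measurable_gradsq.
  rewrite -integral_sublevel_indic; last by apply: measurable_funM => //; exact: measurable_gradsq.
  by apply: eq_integral => t _; rewrite EFinM.
under eq_bigr do rewrite E.
rewrite -(@ge0_integral_sum _ _ _ mu _ measurableT _ (fun (k : 'I_K) t => (if Psi (rowT t) <= k%:R then expR (- (4 * k%:R)) * gradsq l (rowT t) else 0)%:E)); last 2 first.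
- move=> k; apply/measurable_EFinP; apply: measurable_if_sublevel.
  by apply: measurable_funM => //; exact: measurable_gradsq.
- by move=> k t _; rewrite lee_fin; case: ifP => // _; rewrite mulr_ge0 ?expR_ge0 ?gradsq_ge0.
have mR : measurable_fun setT (fun t : T => gradsq l (rowT t) * expR (- (4 * Psi (rowT t)))).
  by apply: measurable_funM; [exact: measurable_gradsq|exact: measurable_exp_Psi].
rewrite EFinM -hD -ge0_integralZl_EFin //; last 2 first.
- by move=> t _; rewrite lee_fin mulr_ge0 ?gradsq_ge0 ?expR_ge0.
- exact/measurable_EFinP.
apply: ge0_le_integral => //.
- by move=> t _; apply: sume_ge0 => k _; rewrite lee_fin; case: ifP => // _; rewrite mulr_ge0 ?expR_ge0 ?gradsq_ge0.
- apply: emeasurable_sum => k; apply/measurable_EFinP; apply: measurable_if_sublevel.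
  by apply: measurable_funM => //; exact: measurable_gradsq.
- by apply: measurable_funeM; exact/measurable_EFinP.
move=> t _; rewrite sumEFin -EFinM lee_fin.
rewrite (_ : \sum_(k < K) _ = gradsq l (rowT t) * \sum_(k < K) (if Psi (rowT t) <= k%:R then expR (- (4 * k%:R)) else 0)).
  rewrite mulrCA; apply: ler_wpM2l; first exact: gradsq_ge0.
  by apply: level_sum_le; exact: Psi_ge0.
by rewrite mulr_sumr; apply: eq_bigr => k _; case: ifP => _; rewrite ?mulr0 // mulrC.
Qed.

(** Integrating the pointwise splitting of exp (- 4 Psi): the last two terms bound the
    mass carried by very low and by very high values of Psi. *)
Lemma exp_Psi_split kap z zk z2 (v : nat -> R) (k0 k1 : nat) : 0 < kap ->
  (\int[@lebesgue_measure R]_t (expR (- (4 * phi p t)))%:E)%E = z%:E ->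
  (\int[@lebesgue_measure R]_t (expR (- (kap * phi p t)))%:E)%E = zk%:E ->
  (\int[@lebesgue_measure R]_t (expR (- (2 * phi p t)))%:E)%E = z2%:E ->
  (forall k, vol (sublevel k%:R) = (v k)%:E) ->
  z ^+ n <= expR 4 * (\sum_(k < k1.+1 | (k0 < k)%N) expR (- (4 * k%:R)) * v k)
     + expR (kap * k0%:R) * zk ^+ n + expR (- (2 * k1%:R)) * z2 ^+ n.
Proof.
move=> kap0 hz hzk hz2 hv.
rewrite -lee_fin !EFinD !EFinM -(integral_exp_Psi hz) -(integral_exp_Psi hzk) -(integral_exp_Psi hz2).
have mE k : measurable_fun setT (fun t : T => (expR (- (k * Psi (rowT t))))%:E).
  by apply/measurable_EFinP; exact: measurable_exp_Psi.
have E0 k (t : T) : (0 <= (expR (- (k * Psi (rowT t))))%:E)%E by rewrite lee_fin expR_ge0.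
pose h (k : nat) (t : T) : R := if Psi (rowT t) <= k%:R then expR (- (4 * k%:R)) else 0.
have mh k : measurable_fun setT (h k) by apply: measurable_if_sublevel.
have h0 k t : 0 <= h k t by rewrite /h; case: ifP => // _; exact: expR_ge0.
have sE : ((\sum_(k < k1.+1 | (k0 < k)%N) expR (- (4 * k%:R)) * v k)%:E =
    \int[mu]_t (\sum_(k < k1.+1) (if (k0 < k)%N then h k t else 0))%:E)%E.
  rewrite big_mkcond -sumEFin.
  under [RHS]eq_integral do rewrite -sumEFin.
  rewrite (@ge0_integral_sum _ _ _ mu _ measurableT _ (fun (k : 'I_k1.+1) t => (if (k0 < k)%N then h k t else 0)%:E)); last 2 first.
  - by move=> k; apply/measurable_EFinP; case: (k0 < k)%N.
  - by move=> k t _; rewrite lee_fin; case: (k0 < k)%N.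
  apply: eq_bigr => k _; case: (k0 < k)%N; last by rewrite integral0.
  rewrite /h -integral_sublevel_indic // integral_cst; last exact: measurable_sublevel.
  by rewrite EFinM -hv volE.
rewrite sE -!ge0_integralZl_EFin ?expR_ge0 //; last 2 first.
- by move=> t _; rewrite lee_fin sumr_ge0 // => k _; case: (k0 < k)%N.
- apply/measurable_EFinP; apply: measurable_sum => k; by case: (k0 < k)%N.
have mS : measurable_fun setT (fun t : T => (expR 4)%:E * (\sum_(k < k1.+1) (if (k0 < k)%N then h k t else 0))%:E)%E.
  by apply: measurable_funeM; apply/measurable_EFinP; apply: measurable_sum => k; case: (k0 < k)%N.
have S0 (t : T) : (0 <= (expR 4)%:E * (\sum_(k < k1.+1) (if (k0 < k)%N then h k t else 0))%:E)%E.
  by rewrite -EFinM lee_fin mulr_ge0 ?expR_ge0 // sumr_ge0 // => k _; case: (k0 < k)%N.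
rewrite -ge0_integralD //; last exact: measurable_funeM.
rewrite -ge0_integralD; [|by []|by move=> t _; rewrite adde_ge0 // mule_ge0 // lee_fin expR_ge0
  |by apply: emeasurable_funD => //; exact: measurable_funeM
  |by move=> t _; rewrite mule_ge0 // lee_fin expR_ge0|exact: measurable_funeM].
apply: ge0_le_integral => //.
  by apply: emeasurable_funD; [apply: emeasurable_funD => //|]; exact: measurable_funeM.
move=> t _; rewrite -!EFinM -!EFinD lee_fin.
by apply: exp_split; [exact: Psi_ge0|exact: ltW].
Qed.

End PsiFun.

(** * A level with small energy *)

Section GoodLevel.
Context {R : realType}.

(** For p <= n, the dilation by 1 + 2/n in the area bound changes powers of degree p
    only by a constant factor. *)
Lemma dilation_powR (n : nat) (p : R) : (2 <= n)%N -> 0 <= p <= n%:R ->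
  (1 + 2 * n%:R^-1) `^ p <= expR 2.
Proof.
move=> n2 /andP[p0 pn].
have n0 : (0 : R) < n%:R by rewrite ltr0n (leq_trans _ n2).
have l1 : 1 <= 1 + 2 * n%:R^-1 :> R by rewrite lerDl mulr_ge0 // invr_ge0 ltW.
apply: (le_trans (ler_powR l1 pn)); rewrite powR_mulrn; last by apply: le_trans l1.
apply: (@le_trans _ _ (expR (2 * n%:R^-1) ^+ n)).
  by apply: lerXn2r; rewrite ?nnegrE ?expR_ge0 ?expR_ge1Dx //; apply: le_trans l1.
by rewrite -expRM_natl mulrCA divff ?mulr1 ?gt_eqF.
Qed.

Lemma expr_div4_le (x : R) n : (0 < n)%N -> 0 <= x -> (x / 4) ^+ n <= x ^+ n / 4.
Proof.
case: n => // n _ x0; rewrite expr_div_n; apply: ler_wpM2l; first exact: exprn_ge0.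
by rewrite lef_pV2 ?posrE ?exprn_gt0 // exprS ler_peMr // exprn_ege1 // ler1n.
Qed.

(** The inequality of arithmetic and geometric means for sqrt n and g / sqrt n. *)
Lemma sqrt_le_affine (n : nat) (g : R) : (0 < n)%N -> 0 <= g ->
  Num.sqrt g <= Num.sqrt n%:R / 2 * (1 + g / n%:R).
Proof.
move=> n0 g0; have n0' : (0 : R) < n%:R by rewrite ltr0n.
have w0 : 0 < Num.sqrt (n%:R : R) by rewrite sqrtr_gt0.
have -> : g / n%:R = (Num.sqrt g / Num.sqrt n%:R) ^+ 2 by rewrite expr_div_n !sqr_sqrtr // ltW.
have h := sqr_ge0 (Num.sqrt g / Num.sqrt n%:R - 1).
have {1}-> : Num.sqrt g = Num.sqrt n%:R * (Num.sqrt g / Num.sqrt n%:R).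
  by rewrite mulrC divfK // gt_eqF.
move: (Num.sqrt g / Num.sqrt n%:R) h w0 => y h; move: (Num.sqrt n%:R) => w w0.
have -> : w / 2 * (1 + y ^+ 2) = w * ((1 + y ^+ 2) / 2) by lra.
apply: ler_wpM2l; first exact: ltW. lra.
Qed.

Lemma vol_sublevel_real (p : R) n s : 1 <= p -> exists v : R, vol (sublevel p (n := n) s) = v%:E.
Proof.
move=> p1; have k0 : (0 : R) < 4 by [].
have [z hz _] := integral_exp_phi p1 k0.
have h := vol_sublevel_fin n s k0 hz.
have h0 : (0 <= vol (sublevel p (n := n) s))%E by exact: measure_ge0.
exists (fine (vol (sublevel p (n := n) s))); rewrite fineK //.
by rewrite ge0_fin_numE // (le_lt_trans h) // ltry.
Qed.

(** If all levels between k0 and k1 had an energy above M n vol, then summing with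
    weights exp (- 4 k) would give M z^n / (2 exp 4) <= 2 (J / z) z^n, contrary to the
    choice of M. *)
Lemma exists_low_energy_level (p : R) n l kap z zk z2 J M (v : nat -> R) (k0 k1 : nat) :
  1 <= p -> (0 < n)%N -> 0 < kap -> 0 < z ->
  (\int[@lebesgue_measure R]_t (expR (- (4 * phi p t)))%:E)%E = z%:E ->
  (\int[@lebesgue_measure R]_t (expR (- (kap * phi p t)))%:E)%E = zk%:E ->
  (\int[@lebesgue_measure R]_t (expR (- (2 * phi p t)))%:E)%E = z2%:E ->
  (\int[@lebesgue_measure R]_t (dphi p (l * t) ^+ 2 * expR (- (4 * phi p t)))%:E)%E = J%:E ->
  (forall k, vol (sublevel p (n := n) k%:R) = (v k)%:E) ->
  expR (kap * k0%:R) * zk ^+ n <= z ^+ n / 4 ->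
  expR (- (2 * k1%:R)) * z2 ^+ n <= z ^+ n / 4 ->
  4 * (expR 4 * (J / z)) < M ->
  exists2 k : nat, (k0 < k <= k1)%N & (level_energy p n l k%:R <= (M * n%:R * v k)%:E)%E.
Proof.
move=> p1 n0 kap0 zp hz hzk hz2 hJ hv t1 t2 hM; apply: contrapT => no.
pose S := \sum_(k < k1.+1 | (k0 < k)%N) expR (- (4 * k%:R)) * v k.
have Slow : z ^+ n <= 2 * (expR 4 * S).
  have := exp_Psi_split p1 k0 k1 kap0 hz hzk hz2 hv; rewrite -/S.
  by move: t1 t2; move: (_ * zk ^+ n) (_ * z2 ^+ n) (z ^+ n) (expR 4 * S); clear; move=> *; lra.
have no' (k : nat) : (k0 < k)%N -> (k < k1.+1)%N -> ((M * n%:R * v k)%:E <= level_energy p n l k%:R)%E.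
  move=> h1 h2; have [//|/ltW h] := leP; case: no; exists k => //; by rewrite h1 -ltnS.
have L0 k : (0 <= level_energy p n l k)%E.
  by apply: integral_ge0 => t _; rewrite lee_fin gradsq_ge0.
have h2 : ((M * n%:R * S)%:E <= (2 * (n%:R * (J / z * z ^+ n)))%:E)%E.
  apply: le_trans (level_energy_sum p1 k1.+1 (integral_gradsq_exp n zp hz hJ)).
  rewrite /S mulr_sumr -sumEFin big_mkcond /=.
  apply: lee_sum => k _; case: ifP => hk; last by rewrite mule_ge0 // lee_fin expR_ge0.
  by rewrite mulrCA EFinM; apply: lee_wpmul2l; [rewrite lee_fin expR_ge0|exact: no'].
move: h2; rewrite lee_fin -mulrA mulrCA [leRHS]mulrCA ler_pM2l ?ltr0n // => h2.
have Z0 : 0 < z ^+ n by exact: exprn_gt0.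
have e0 := expR_gt0 (4 : R).
have h3 : 4 * (expR 4 * (J / z)) * z ^+ n < M * z ^+ n by rewrite ltr_pM2r.
have := ler_wpM2l (ltW e0) h2; move: h3.
suff M0 : 0 < M.
  have := ler_wpM2l (ltW M0) Slow.
  clearbody S; move: (expR 4) (J / z) (z ^+ n); clear; move=> e w Z h1 h2 h3; lra.
have J0 : 0 <= J.
  rewrite -lee_fin -hJ; apply: integral_ge0 => t _.
  by rewrite lee_fin mulr_ge0 ?expR_ge0 // sqr_ge0.
by apply: le_lt_trans hM; rewrite mulr_ge0 // mulr_ge0 ?divr_ge0 ?(ltW e0) // ltW.
Qed.

Lemma integral_sqrt_gradsq_le (p : R) n l s v M : (0 < n)%N ->
  vol (sublevel p (n := n) s) = v%:E -> (level_energy p n l s <= (M * n%:R * v)%:E)%E ->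
  (\int[@lebesgue_tuple R n]_(t in @rowT R n @^-1` sublevel p s)
      (Num.sqrt (gradsq p l (rowT t)))%:E <= ((1 + M) / 2 * (Num.sqrt n%:R * v))%:E)%E.
Proof.
move=> n0 hv hL; have n0' : (0 : R) < n%:R by rewrite ltr0n.
have mS := @measurable_sublevel R p n s.
have mg : measurable_fun (@rowT R n @^-1` sublevel p s) (fun t => gradsq p l (rowT t)).
  by apply: measurable_funTS; exact: measurable_gradsq.
apply: (@le_trans _ _ (\int[@lebesgue_tuple R n]_(t in @rowT R n @^-1` sublevel p s)
   ((Num.sqrt n%:R / 2)%:E + (Num.sqrt n%:R / 2 / n%:R)%:E * (gradsq p l (rowT t))%:E))%E).
  apply: ge0_le_integral => //.
  - apply/measurable_EFinP; apply: measurableT_comp mg.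
    by apply: (continuous_measurable_fun (f := @Num.sqrt R)); exact: sqrt_continuous.
  - by apply: emeasurable_funD => //; apply: measurable_funeM; exact/measurable_EFinP.
  move=> t _; rewrite -EFinM -EFinD lee_fin.
  apply: (le_trans (sqrt_le_affine n0 (gradsq_ge0 p l (rowT t)))); lra.
have s0 : 0 <= Num.sqrt (n%:R : R) / 2 / n%:R by rewrite !divr_ge0 ?sqrtr_ge0 // ltW.
rewrite ge0_integralD //; last 2 first.
- by move=> t _; rewrite -EFinM lee_fin mulr_ge0 ?gradsq_ge0.
- by apply: measurable_funeM; exact/measurable_EFinP.
rewrite integral_cst // ge0_integralZl_EFin //; last 2 first.
- by move=> t _; rewrite lee_fin gradsq_ge0.
- exact/measurable_EFinP.
rewrite -/(level_energy p n l s).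
rewrite [X in (_ * X + _)%E](_ : _ = v%:E); last by rewrite -hv volE.
apply: (@le_trans _ _ ((Num.sqrt n%:R / 2)%:E * v%:E + (Num.sqrt n%:R / 2 / n%:R)%:E * (M * n%:R * v)%:E)%E).
  by rewrite leeD2l // lee_wpmul2l.
rewrite -!EFinM -EFinD lee_fin.
have -> : Num.sqrt n%:R / 2 / n%:R * (M * n%:R * v) = Num.sqrt n%:R / 2 * (M * v) * (n%:R / n%:R) by lra.
rewrite divff ?gt_eqF // mulr1.
move: (Num.sqrt _); clear; move=> w; lra.
Qed.

(** The constants come in this order: kap is so large that exp(- kap phi) has an
    integral at most z / (4 e), and b is so large that exp (- 2 b) z2 <= z / 4, with the
    lower bound exp (- 12) for z; then M and C. None of them depends on p. *)
Lemma uniform_level_constants : exists kap b M C : R,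
  [/\ 4 <= kap, 0 < b, 0 < M /\ 0 < C &
   forall p, 1 <= p -> exists z zk z2 : R,
    [/\ 0 < z /\ 0 <= zk /\ 0 <= z2, expR (4 * (b + 1)) * z <= C,
     [/\ (\int[@lebesgue_measure R]_t (expR (- (4 * phi p t)))%:E)%E = z%:E,
       (\int[@lebesgue_measure R]_t (expR (- (kap * phi p t)))%:E)%E = zk%:E &
       (\int[@lebesgue_measure R]_t (expR (- (2 * phi p t)))%:E)%E = z2%:E],
     expR 1 * zk <= z / 4 /\ expR (- (2 * b)) * z2 <= z / 4 &
     forall l, 1 <= l <= 2 -> l `^ p <= expR 2 -> exists2 J : R,
      (\int[@lebesgue_measure R]_t (dphi p (l * t) ^+ 2 * expR (- (4 * phi p t)))%:E)%E = J%:E &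
      4 * (expR 4 * (J / z)) < M]].
Proof.
(* z0 and J0 bound the integrals of exp (- 4 phi) from below and of
   phi'^2 exp (- 4 phi) from above; tau is such that e * (e * tau) = z0 / 4 *)
pose z0 : R := expR (-12); have z00 : 0 < z0 by exact: expR_gt0.
pose J0 : R := 256 * expR 2 ^+ 2 * expR 6.
pose M : R := 4 * (expR 4 * (`|J0| / z0)) + 1.
have M0 : 0 < M.
  apply: ltr_wpDl => //; apply: mulr_ge0 => //; apply: mulr_ge0 (expR_ge0 _) _.
  by apply: divr_ge0 (normr_ge0 _) (ltW z00).
pose tau : R := z0 / (4 * expR 1 ^+ 2).
have e10 : 0 < expR 1 :> R by exact: expR_gt0.
have tau0 : 0 < tau by rewrite divr_gt0 // mulr_gt0 // exprn_gt0.
have tauE : expR 1 * (expR 1 * tau) = z0 / 4.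
  rewrite /tau mulrA -expr2 invfM; move: (exprn_gt0 2 e10); move: (expR 1 ^+ 2) => w w0.
  have -> : w * (z0 * (4^-1 / w)) = z0 / 4 * (w / w) by lra.
  by rewrite divff ?mulr1 // gt_eqF.
pose kap : R := 4 * hyp_norm tau / (hyp_norm tau - 1).
have kap4 : 4 <= kap.
  have h1 : 1 < hyp_norm tau.
    rewrite lt_neqAle hyp_norm_ge1 andbT eq_sym; apply/eqP => h1.
    by have := sqr_hyp_norm tau; rewrite h1 expr1n => /eqP; rewrite -subr_eq0 opprD addNKr oppr_eq0 sqrf_eq0 gt_eqF.
  by rewrite /kap ler_pdivlMr; move: h1; move: (hyp_norm tau); clear => w; lra.
pose b : R := 16 * expR (1 / 2) / z0.
have b0 : 0 < b by rewrite divr_gt0 // mulr_gt0 // expR_gt0.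
pose C := expR (4 * (b + 1)) * (expR 1 * 2).
exists kap, b, M, C; split => //.
  by split=> //; rewrite /C !mulr_gt0 // expR_gt0.
move=> p p1.
have k4 : (0 : R) < 4 by []. have k2 : (0 : R) < 2 by [].
have [z hz /andP[_ zle]] := integral_exp_phi p1 k4.
have zge : z0 <= z by have := integral_exp_phi_ge p1; rewrite hz lee_fin.
have zp : 0 < z by exact: lt_le_trans zge.
have z04 : z0 / 4 <= z / 4 by rewrite ler_pM2r // invr_gt0.
have [z2 hz2 /andP[z20 z2le]] := integral_exp_phi p1 k2.
have [zk hzk /andP[zk0 zkle]] : exists2 zk, (\int[@lebesgue_measure R]_t (expR (- (kap * phi p t)))%:E)%E = zk%:E &
    0 <= zk <= expR 1 * tau.
  by have [k [_ [kE [zk]]]] := integral_exp_phi_small p1 tau0; rewrite kE -/kap; exists zk.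
exists z, zk, z2; split=> //.
- rewrite /C ler_pM2l ?expR_gt0 //; apply: (le_trans zle).
  rewrite divff // ler_pM2l ?expR_gt0 // ler_pdivrMr //; clear; lra.
- split; first by apply: le_trans z04; rewrite -tauE ler_pM2l.
  apply: le_trans z04; rewrite expRN mulrC ler_pdivrMr ?expR_gt0 //.
  apply: (le_trans z2le).
  have hb : 2 * b <= expR (2 * b).
    by apply: le_trans (expR_ge1Dx (2 * b)); rewrite lerDr.
  apply: (@le_trans _ _ (z0 / 4 * (2 * b))); last by rewrite ler_wpM2l // divr_ge0 // ltW.
  have -> : z0 / 4 * (2 * b) = 8 * expR (1 / 2) * (z0 / z0).
    rewrite /b; move: (expR (1 / 2)) (z0); clear => e w; lra.
  rewrite divff ?gt_eqF // (_ : 2 / 4 = 1 / 2 :> R); last by clear; lra.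
  have := expR_ge0 (1 / 2 : R); move: (expR (1 / 2)); clear => e; lra.
move=> l l12 lE; have [J hJ /andP[J1 J2]] := integral_dphi_dilate p1 l12 lE.
exists J => //; rewrite /M ltr_pwDr // ler_pM2l // ler_pM2l ?expR_gt0 //.
apply: ler_pM => //; first by rewrite invr_ge0 ltW.
  by apply: (le_trans J2); exact: ler_norm.
by rewrite lef_pV2 ?posrE.
Qed.

(** With a = 1 / kap, the low and the high values of Psi carry at most (z / 4)^n <= z^n
    / 4 each, so the levels between a n and (b + 1) n carry half of the mass. *)
Lemma exists_isoperimetric_level : exists a B C : R, [/\ 0 < a <= 1, 0 < B, 0 < C &
  forall (p : R) (n : nat), 1 <= p -> (2 <= n)%N -> p <= n%:R -> exists s v : R,
   [/\ a * n%:R <= s <= B * n%:R, vol (sublevel p (n := n) s) = v%:E, 0 < v <= C ^+ n &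
   (\int[@lebesgue_tuple R n]_(t in @rowT R n @^-1` sublevel p s)
      (Num.sqrt (gradsq p (1 + 2 * n%:R^-1) (rowT t)))%:E <= (C * (Num.sqrt n%:R * v))%:E)%E]].
Proof.
have [kap [b [M [C1 [kap4 b0 [M0 C10] H]]]]] := uniform_level_constants.
have kap0 : 0 < kap by apply: lt_le_trans kap4.
pose a : R := kap^-1.
have a0 : 0 < a by rewrite invr_gt0.
have a1 : a <= 1 by rewrite invf_le1 //; apply: le_trans kap4; rewrite ler1n.
exists a, (b + 1), (C1 + (1 + M) / 2); split; [by rewrite a0| | |].
- by rewrite addr_gt0.
- by rewrite addr_gt0 // divr_gt0 // addr_gt0.
move=> p n p1 n2 pn.
have n0 : (0 < n)%N by exact: leq_trans n2.
have n0' : (0 : R) < n%:R by rewrite ltr0n.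
set l := 1 + 2 * n%:R^-1.
have l12 : 1 <= l <= 2.
  rewrite /l lerDl mulr_ge0 ?invr_ge0 ?(ltW n0') //=.
  have : 2 * n%:R^-1 <= 1 :> R by rewrite ler_pdivrMr // mul1r ler_nat.
  by move=> h; rewrite -[leRHS]/(1 + 1) lerD2l.
have lE : l `^ p <= expR 2.
  by apply: dilation_powR => //; rewrite pn andbT; apply: le_trans p1.
have [z [zk [z2 [[zp [zk0 z20]] zC [hz hzk hz2] [zkle z2le] HJ]]]] := H p p1.
have {HJ}[J hJ JM] := HJ l l12 lE.
have [v hv] := choice (fun k : nat => @vol_sublevel_real p n k%:R p1).
pose k0 := Num.truncn (a * n%:R); pose k1 := (Num.truncn (b * n%:R)).+1.
have /andP[k0le k0gt] : k0%:R <= a * n%:R < k0.+1%:R by apply: truncn_itv; rewrite mulr_ge0 // ltW.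
have /andP[k1le k1gt] : k1.-1%:R <= b * n%:R < k1%:R by apply: truncn_itv; rewrite mulr_ge0 // ltW.
have t1 : expR (kap * k0%:R) * zk ^+ n <= z ^+ n / 4.
  apply: (le_trans _ (expr_div4_le n0 (ltW zp))).
  apply: (@le_trans _ _ (expR 1 ^+ n * zk ^+ n)).
    apply: ler_wpM2r; first exact: exprn_ge0.
    rewrite -expRM_natl ler_expR mulr1; apply: (@le_trans _ _ (kap * (a * n%:R))).
      by rewrite ler_wpM2l // ltW.
    by rewrite /a mulrA divff ?mul1r // gt_eqF.
  by rewrite -exprMn; apply: lerXn2r; rewrite ?nnegrE ?divr_ge0 ?mulr_ge0 ?expR_ge0 ?(ltW zp).
have t2 : expR (- (2 * k1%:R)) * z2 ^+ n <= z ^+ n / 4.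
  apply: (le_trans _ (expr_div4_le n0 (ltW zp))).
  apply: (@le_trans _ _ (expR (- (2 * b)) ^+ n * z2 ^+ n)).
    apply: ler_wpM2r; first exact: exprn_ge0.
    by rewrite -expRM_natl ler_expR mulrN lerN2 mulrCA ler_pM2l // mulrC ltW.
  by rewrite -exprMn; apply: lerXn2r; rewrite ?nnegrE ?divr_ge0 ?mulr_ge0 ?expR_ge0 ?(ltW zp).
have [k /andP[kk0 kk1] hk] := exists_low_energy_level p1 n0 kap0 zp hz hzk hz2 hJ hv t1 t2 JM.
have klo : a * n%:R <= k%:R.
  by apply: ltW; apply: (lt_le_trans k0gt); rewrite ler_nat.
have khi : k%:R <= (b + 1) * n%:R.
  apply: (@le_trans _ _ k1%:R); first by rewrite ler_nat.
  rewrite mulrDl mul1r -(prednK (ltn0Sn _ : 0 < k1)%N) -natr1; apply: lerD => //; by rewrite ler1n.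
have vk0 : 0 < v k.
  rewrite -lte_fin -hv.
  have an3 : a * n%:R <= 3 * n%:R by rewrite ler_pM2r // (le_trans a1) // ler1n.
  have := vol_sublevel_gt0 p1 (mulr_gt0 a0 n0') n0 an3.
  have hm : (vol (sublevel p (n := n) (a * n%:R)%R) <= vol (sublevel p (n := n) k%:R))%E.
    apply: le_vol; [exact: measurable_sublevel|exact: measurable_sublevel|].
    by move=> x /le_trans; exact.
  move=> h; apply: lt_le_trans (le_trans h hm).
  by rewrite lte_fin exprn_gt0 // divr_gt0 // mulr_gt0.
have M1 : 0 <= (1 + M) / 2 by rewrite divr_ge0 // addr_ge0 // ltW.
exists k%:R, (v k); split; [by rewrite klo|exact: hv| |].
  rewrite vk0 /= -lee_fin -hv.
  have k4 : (0 : R) < 4 by [].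
  apply: (le_trans (vol_sublevel_fin n k%:R k4 hz)).
  rewrite lee_fin; apply: (@le_trans _ _ (C1 ^+ n)); last first.
    by apply: lerXn2r; rewrite ?nnegrE ?addr_ge0 ?lerDl // ltW.
  apply: (@le_trans _ _ ((expR (4 * (b + 1)) * z) ^+ n)); last first.
    by apply: lerXn2r; rewrite ?nnegrE ?mulr_ge0 ?expR_ge0 // ltW.
  rewrite exprMn -expRM_natl; apply: ler_wpM2r; first by rewrite exprn_ge0 // ltW.
  by rewrite ler_expR mulrCA ler_pM2l // mulrC.
apply: (le_trans (integral_sqrt_gradsq_le n0 (hv k) hk)).
rewrite lee_fin; apply: ler_wpM2r; first by rewrite mulr_ge0 ?sqrtr_ge0 // ltW.
by rewrite lerDr ltW.
Qed.

End GoodLevel.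

(** * The rescaled potential *)

Section Dilation.
Context {R : realType} {n : nat}.
Local Notation T := (n.-tuple (measurableTypeR R)).

Lemma rowT_affT (a : R) (t : T) : rowT (affT a (fun _ => 0) t) = a *: rowT t.
Proof. by apply/rowP => i; rewrite !mxE tnth_mktuple addr0. Qed.

Lemma integral_dilate (a : R) (A : set 'rV[R]_n) (f : 'rV[R]_n -> R) : 0 < a -> measurable_rV A ->
  measurable_fun setT (fun t : T => f (rowT t)) -> (forall x, 0 <= f x) ->
  (\int[@lebesgue_tuple R n]_(t in @rowT R n @^-1` [set z | A (a *: z)]) (f (a *: rowT t))%:E =
   (a ^- n)%:E * \int[@lebesgue_tuple R n]_(t in @rowT R n @^-1` A) (f (rowT t))%:E)%E.
Proof.
move=> a0 mA mf f0.
have an0 : 0 <= a ^- n by rewrite invr_ge0 exprn_ge0 // ltW.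
have mE : measurable_fun setT (fun t : T => (f (rowT t))%:E) by exact/measurable_EFinP.
have maff := @measurable_affT R n a (fun _ => 0).
rewrite -(ge0_integral_mscale (@lebesgue_tuple R n) mA (NngNum an0)) //; last 2 first.
- exact: measurable_funTS.
- by move=> t _; rewrite lee_fin.
under eq_integral do rewrite -rowT_affT.
rewrite (_ : @rowT R n @^-1` _ = affT a (fun _ => 0) @^-1` (@rowT R n @^-1` A)); last first.
  by apply/seteqP; split => t /=; rewrite rowT_affT.
transitivity (\int[pushforward (@lebesgue_tuple R n) (affT a (fun _ => 0%R))]_(t in @rowT R n @^-1` A) (f (rowT t))%:E)%E.
  rewrite (ge0_integral_pushforward maff (@lebesgue_tuple R n) (D := @rowT R n @^-1` A)) //.
    exact: measurable_funTS.
  by move=> t _; rewrite lee_fin.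
by apply: eq_measure_integral => B mB _; exact: lebesgue_tuple_aff.
Qed.
End Dilation.

Section ScaledPotential.
Context {R : realType} (p : R) (p1 : 1 <= p) (n : nat) (c : R) (c0 : 0 < c).

Definition scaled_Psi (x : 'rV[R]_n) : R := Psi p (c *: x).
Definition scaled_grad (x : 'rV[R]_n) : 'rV[R]_n := \row_i (c * dphi p (c * x 0 i)).

Lemma scaled_Psi_grad x y : scaled_Psi x + std_dot (scaled_grad x) (y - x) <= scaled_Psi y.
Proof.
rewrite /scaled_Psi /Psi /std_dot -big_split /=; apply: ler_sum => i _; rewrite !mxE.
have -> : c * dphi p (c * x 0 i) * (y 0 i - x 0 i) = dphi p (c * x 0 i) * (c * y 0 i - c * x 0 i).
  by rewrite -mulrBr; lra.
exact: phi_grad.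
Qed.

Lemma scaled_PsiN x : scaled_Psi (- x) = scaled_Psi x.
Proof. by apply: eq_bigr => i _; rewrite !mxE mulrN phiN. Qed.

Lemma scaled_Psi0 : scaled_Psi 0 = 0.
Proof. by apply: big1 => i _; rewrite !mxE mulr0 phi0. Qed.

Lemma scaled_Psi_monomial (t : R) (e : 'I_n -> bool) (s : 'I_n -> 'I_n) (x : 'rV[R]_n) : injective s ->
  scaled_Psi (t *: \row_j ((-1) ^+ e j * x 0 (s j))) = scaled_Psi (t *: x).
Proof.
move=> injs; rewrite /scaled_Psi /Psi [RHS](reindex_inj injs) /=.
apply: eq_bigr => j _; rewrite !mxE; case: (e j); rewrite ?mul1r // expr1 mulN1r !mulrN phiN //.
Qed.

Lemma l2_norm_scaled_grad l x : 0 < l ->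
  l2_norm (scaled_grad x) = c * Num.sqrt (gradsq p l ((c / l) *: x)).
Proof.
move=> l0; have -> : scaled_grad x = c *: \row_i dphi p (l * ((c / l) *: x) 0 i).
  by apply/rowP => i; rewrite !mxE [l * _]mulrA [l * (c / l)]mulrC divfK // gt_eqF.
rewrite l2_normZ ger0_norm ?(ltW c0) //; congr (_ * Num.sqrt _).
by apply: eq_bigr => i _; rewrite !mxE expr2.
Qed.

Lemma continuous_scaled_coord (f : R -> R) (i : 'I_n) : continuous f ->
  continuous (fun x : 'rV[R]_n => f (c * x 0 i)).
Proof.
move=> cf x; apply: (@continuous_comp _ _ _ (fun x : 'rV[R]_n => x 0 i) (fun y => f (c * y))).
  exact: coord_continuous.
apply: (@continuous_comp _ _ _ (fun y => c * y) f); last exact: cf.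
by apply: cvgM; [exact: cvg_cst|exact: cvg_id].
Qed.

Lemma dphi_le x y : x <= y -> dphi p x <= dphi p y.
Proof.
rewrite le_eqVlt => /predU1P[->//|xy].
have := phi_grad p1 x y; have := phi_grad p1 y x => h1 h2.
have : (dphi p x - dphi p y) * (y - x) <= 0 by lra.
by rewrite pmulr_lle0 ?subr_gt0 // subr_le0.
Qed.

Lemma dphi_dilate_le (t : R) z : 1 <= t -> `|dphi p z| <= `|dphi p (t * z)|.
Proof.
move=> t1; have [z0|z0] := leP 0 z.
  have h1 := dphi_le z0; have h2 := dphi_le (ler_peMl z0 t1); rewrite dphi0 in h1.
  by rewrite !ger0_norm //; apply: le_trans h2.
have h1 := dphi_le (ltW z0); have h2 := dphi_le (ler_neMl (ltW z0) t1); rewrite dphi0 in h1.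
by rewrite !ler0_norm ?lerN2 //; apply: le_trans h2 _.
Qed.

Lemma scaled_grad_mono (t : R) z : 1 <= t -> l2_norm (scaled_grad z) <= l2_norm (scaled_grad (t *: z)).
Proof.
move=> t1; rewrite /l2_norm ler_wsqrtr // /std_dot; apply: ler_sum => i _; rewrite !mxE -!expr2.
rewrite -(real_normK (num_real (c * dphi p (c * z 0 i)))) -(real_normK (num_real (c * dphi p (c * _)))).
rewrite lerXn2r ?nnegrE // 2!(normrM c) ler_wpM2l // mulrCA; exact: dphi_dilate_le.
Qed.

Lemma continuous_scaled_Psi : continuous scaled_Psi.
Proof.
rewrite (_ : scaled_Psi = fun x => \sum_i phi p (c * x 0 i)).
  apply: continuous_big => [|i _]; first exact: add_continuous.
  exact: (continuous_scaled_coord (@continuous_phi R p)).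
by apply/funext => x; apply: eq_bigr => i _; rewrite mxE.
Qed.

Lemma scaled_grad_continuous x (e : R) : 0 < e ->
  exists2 d : R, 0 < d & forall y, l2_norm (y - x) < d -> l2_norm (scaled_grad y - scaled_grad x) < e.
Proof.
pose h (y : 'rV[R]_n) := l2_norm (scaled_grad y - scaled_grad x).
suff ch : continuous h.
  move=> e0; have [d d0 H] := (proj2 (continuous_l2P h) ch) x e e0.
  exists d => // y /H; rewrite /h subrr l2_norm0 subr0 ger0_norm //; exact: l2_norm_ge0.
rewrite (_ : h = fun y => Num.sqrt (\sum_i (c * dphi p (c * y 0 i) - c * dphi p (c * x 0 i)) ^+ 2)); last first.
  by apply/funext => y; congr Num.sqrt; apply: eq_bigr => i _; rewrite !mxE expr2.
move=> y; apply: (@continuous_comp _ _ _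
  (fun y : 'rV[R]_n => \sum_i (c * dphi p (c * y 0 i) - c * dphi p (c * x 0 i)) ^+ 2) Num.sqrt);
  last exact: sqrt_continuous.
move: y; apply: continuous_big => [|i _]; first exact: add_continuous.
apply: (@continuous_scaled_coord (fun t => (c * dphi p t - c * dphi p (c * x 0 i)) ^+ 2)) => t.
have ct : (c * dphi p u - c * dphi p (c * x 0 i)) @[u --> t] --> c * dphi p t - c * dphi p (c * x 0 i).
  by apply: cvgB; [apply: cvgM; [exact: cvg_cst|exact: continuous_dphi]|exact: cvg_cst].
exact: (cvgM ct ct).
Qed.

End ScaledPotential.
Section ScaledArea.
Context {R : realType}.

Lemma measurable_sqrt_gradsq (p l : R) n :
  measurable_fun setT (fun t : n.-tuple (measurableTypeR R) => Num.sqrt (gradsq p l (rowT t))).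
Proof.
apply: (measurableT_comp (f := @Num.sqrt R)); last exact: measurable_gradsq.
by apply: continuous_measurable_fun; exact: sqrt_continuous.
Qed.

Lemma measurable_grad_norm_scaled (p c l : R) n : 0 < c -> 0 < l ->
  measurable_fun setT (fun t : n.-tuple (measurableTypeR R) => (l2_norm (scaled_grad p c (rowT t)))%:E).
Proof.
move=> c0 l0; apply/measurable_EFinP.
under eq_fun do rewrite (l2_norm_scaled_grad p c0 _ l0) -rowT_affT.
apply: measurable_funM => //.
exact: (measurableT_comp (measurable_sqrt_gradsq p l (n := n)) (@measurable_affT R n (c / l) (fun _ => 0))).
Qed.

Lemma integral_scaled_grad (p c l s I : R) n : 0 < c -> 0 < l ->
  (\int[@lebesgue_tuple R n]_(t in @rowT R n @^-1` sublevel p s)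
      (Num.sqrt (gradsq p l (rowT t)))%:E <= I%:E)%E ->
  (\int[@lebesgue_tuple R n]_(t in @rowT R n @^-1` [set z | sublevel p s ((c / l) *: z)])
      (l2_norm (scaled_grad p c (rowT t)))%:E <= (c * ((l / c) ^+ n * I))%:E)%E.
Proof.
move=> c0 l0 hI; under eq_integral do rewrite (l2_norm_scaled_grad p c0 _ l0).
have a0 : 0 < c / l by rewrite divr_gt0.
have mS := @measurable_sublevel R p n s.
have mg := @measurable_sqrt_gradsq p l n.
rewrite (@integral_dilate R n (c / l) (sublevel p s) (fun x => c * Num.sqrt (gradsq p l x))) //; last 2 first.
- exact: measurable_funM.
- by move=> x; rewrite mulr_ge0 ?sqrtr_ge0 // ltW.
under eq_integral do rewrite EFinM.
rewrite ge0_integralZl_EFin ?(ltW c0) //; last by apply/measurable_EFinP; exact: measurable_funTS.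
have -> : c * ((l / c) ^+ n * I) = (c / l) ^- n * (c * I).
  by rewrite mulrCA -exprVn invf_div.
rewrite EFinM; apply: lee_wpmul2l; first by rewrite lee_fin invr_ge0 exprn_ge0 // ltW.
by rewrite EFinM; apply: lee_wpmul2l => //; rewrite lee_fin ltW.
Qed.

Lemma measurable_dilated_sublevel (p c k s : R) n :
  measurable_rV [set z : 'rV[R]_n | sublevel p s ((c / k) *: z)].
Proof.
rewrite (_ : [set z | _] = affV (c / k) 0 (sublevel p s)); last first.
  by apply/seteqP; split => z; rewrite /affV /= addr0.
by apply: measurable_rV_aff; exact: measurable_sublevel.
Qed.

Lemma hausdorff_scaled_level (p : R) (m : nat) (c k s sigma I : R) : 1 <= p -> (0 < m)%N -> 0 < c ->
  0 < k -> 0 < sigma -> sigma <= s -> 0 < I ->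
  (\int[@lebesgue_tuple R m.+1]_(t in @rowT R m.+1 @^-1` sublevel p s)
      (Num.sqrt (gradsq p (1 + 2 * k) (rowT t)))%:E <= I%:E)%E ->
  (hausdorff m [set x : 'rV[R]_m.+1 | scaled_Psi p c x = s] <=
   (8 / (k * sigma) * (c * (((1 + 2 * k) / c) ^+ m.+1 * I)))%:E)%E.
Proof.
move=> p1 m0 c0 k0 sigma0 sigmas I0 hI.
have l0 : 0 < 1 + 2 * k by rewrite addr_gt0 // mulr_gt0.
have bodyE : dilated_body (@scaled_Psi R p m.+1 c) s k = [set z | sublevel p s ((c / (1 + 2 * k)) *: z)].
  by apply/seteqP; split => z; rewrite /dilated_body /sublevel /scaled_Psi /= scalerA.
have s0 : scaled_Psi p c (0 : 'rV[R]_m.+1) + sigma <= s by rewrite scaled_Psi0 add0r.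
have I0' : 0 < c * (((1 + 2 * k) / c) ^+ m.+1 * I).
  exact: (mulr_gt0 c0 (mulr_gt0 (exprn_gt0 _ (divr_gt0 l0 c0)) I0)).
apply: (@hausdorff_level_le R m m0 (@scaled_Psi R p m.+1 c) (@scaled_grad R p m.+1 c)
  (scaled_Psi_grad p1 c (n := m.+1)) (@continuous_scaled_Psi R p m.+1 c)
  (@scaled_grad_continuous R p m.+1 c) (scaled_grad_mono p1 c (n := m.+1)) s sigma k sigma0 s0 k0 _ I0').
- by rewrite bodyE; exact: measurable_dilated_sublevel.
- exact: (measurable_grad_norm_scaled p c0 l0).
by rewrite bodyE; exact: integral_scaled_grad.
Qed.
End ScaledArea.

(** * The gauge of a sublevel set *)

Section Gauge.
Context {R : realType} {n : nat}.
Variables (F : 'rV[R]_n -> R) (g : 'rV[R]_n -> 'rV[R]_n) (s : R).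
Hypothesis F_grad : forall x y, F x + std_dot (g x) (y - x) <= F y.
Hypothesis F_even : forall x, F (- x) = F x.
Variables (nrm : 'rV[R]_n -> R) (rin rout : R).
Hypothesis nrmZ : forall (a : R) x, nrm (a *: x) = `|a| * nrm x.
Hypothesis nrm_coord : forall (x : 'rV[R]_n) i, `|x 0 i| <= nrm x.
Hypothesis nrm_ge0 : forall x, 0 <= nrm x.
Hypothesis r0 : 0 < rin.
Hypothesis inner : forall x, nrm x <= rin -> F x <= s.
Hypothesis outer : forall x, F x <= s -> nrm x <= rout.

Definition gauge_set x : set R := [set t | 0 < t /\ F (t^-1 *: x) <= s].

(** The sublevel set is only known to be squeezed between two balls of an auxiliary norm
    nrm; these give the finiteness and the positivity of the gauge. *)
Definition gauge x : R := inf (gauge_set x).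

Lemma sublevel_convex (a : R) x y : 0 <= a <= 1 -> F x <= s -> F y <= s -> F (a *: x + (1 - a) *: y) <= s.
Proof.
move=> /andP[a0 a1] xs ys; set z := a *: x + (1 - a) *: y.
have hx := F_grad z x; have hy := F_grad z y; have a1' : 0 <= 1 - a by rewrite subr_ge0.
have e : a * std_dot (g z) (x - z) + (1 - a) * std_dot (g z) (y - z) = 0.
  have e0 : a *: (x - z) + (1 - a) *: (y - z) = 0.
    rewrite !scalerBr addrACA -/z -opprD -scalerDl.
    by rewrite [a + _]addrC subrK scale1r subrr.
  by rewrite -!std_dotZr -std_dotDr e0 /std_dot big1 // => i _; rewrite mxE mulr0.
have := ler_wpM2l a0 (le_trans hx xs); have := ler_wpM2l a1' (le_trans hy ys).
rewrite !mulrDr; move: e; move: (std_dot _ _) (std_dot _ _) => u v; lra.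
Qed.

Lemma F0_le : F 0 <= s.
Proof. by apply: inner; rewrite -(scale0r 0) nrmZ normr0 mul0r ltW. Qed.

Lemma gauge_set_up x t u : gauge_set x t -> t <= u -> gauge_set x u.
Proof.
move=> [t0 ts] tu; have u0 : 0 < u by exact: lt_le_trans tu.
split=> //; have -> : u^-1 *: x = (t / u) *: (t^-1 *: x) + (1 - t / u) *: 0.
  by rewrite scaler0 addr0 scalerA mulrAC divff ?mul1r // gt_eqF.
apply: sublevel_convex ts F0_le.
by rewrite divr_ge0 ?(ltW t0) ?(ltW u0) //= ler_pdivrMr // mul1r.
Qed.

Lemma gauge_set_norm x t : 0 < t -> nrm x <= rin * t -> gauge_set x t.
Proof.
move=> t0 h; split=> //; apply: inner.
by rewrite nrmZ ger0_norm ?invr_ge0 ?(ltW t0) // mulrC ler_pdivrMr.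
Qed.

Lemma has_inf_gauge_set x : has_inf (gauge_set x).
Proof.
split; last by exists 0 => t [/ltW].
exists ((nrm x + 1) / rin); apply: gauge_set_norm.
  by rewrite divr_gt0 // ltr_wpDl.
by rewrite mulrC divfK ?gt_eqF // lerDl.
Qed.

Lemma gauge_le x t : gauge_set x t -> gauge x <= t.
Proof. by move=> h; apply: ge_inf => //; case: (has_inf_gauge_set x). Qed.

Lemma le_gauge x b : (forall t, gauge_set x t -> b <= t) -> b <= gauge x.
Proof. by move=> h; apply: lb_le_inf => //; case: (has_inf_gauge_set x). Qed.

Lemma gauge_ge0 x : 0 <= gauge x.
Proof. by apply: le_gauge => t [/ltW]. Qed.

Lemma gauge_upper x : gauge x <= rin^-1 * nrm x.
Proof.
apply/ler_addgt0Pr => e e0; apply: gauge_le; apply: gauge_set_norm.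
  by rewrite ltr_wpDl // mulr_ge0 // invr_ge0 ltW.
by rewrite mulrDr mulrA divff ?gt_eqF // mul1r lerDl mulr_ge0 // ltW.
Qed.

Lemma gauge_lower x : nrm x <= rout * gauge x.
Proof.
have rr0 : 0 <= rout by apply: (le_trans (nrm_ge0 0)); apply: outer; exact: F0_le.
have h t : gauge_set x t -> nrm x <= rout * t.
  move=> [t0 /outer]; rewrite nrmZ ger0_norm ?invr_ge0 ?(ltW t0) // mulrC ler_pdivrMr //.
move: rr0; rewrite le_eqVlt => /predU1P[rr0|rr0].
  have [t ht] := (has_inf_gauge_set x).1.
  by have := h t ht; rewrite -rr0 !mul0r.
by rewrite mulrC -ler_pdivrMr //; apply: le_gauge => t /h; rewrite ler_pdivrMr // mulrC.
Qed.

Lemma gaugeD x y : gauge (x + y) <= gauge x + gauge y.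
Proof.
rewrite -lerBlDr; apply: le_gauge => t [t0 ts]; rewrite lerBlDr -lerBlDl.
apply: le_gauge => u [u0 us]; rewrite lerBlDl; apply: gauge_le.
have tu0 : 0 < t + u by exact: addr_gt0.
split=> //; have -> : (t + u)^-1 *: (x + y) = (t / (t + u)) *: (t^-1 *: x) + (1 - t / (t + u)) *: (u^-1 *: y).
  have -> : 1 - t / (t + u) = u / (t + u).
    by rewrite -[X in X - _](divff (lt0r_neq0 tu0)) -mulrBl [t + u]addrC addrK.
  by rewrite !scalerA ![_ / (t + u) * _]mulrAC !divff ?gt_eqF // !mul1r scalerDr.
apply: sublevel_convex => //.
by rewrite divr_ge0 ?(ltW t0) ?(ltW tu0) //= ler_pdivrMr // mul1r lerDl ltW.
Qed.

Lemma gauge_setZ (a : R) x t : a != 0 -> gauge_set x t -> gauge_set (a *: x) (`|a| * t).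
Proof.
move=> a0 [t0 ts]; split; first by rewrite mulr_gt0 // normr_gt0.
have [ap|an] := ltP 0 a.
  by rewrite ger0_norm ?(ltW ap) // scalerA invfM mulrAC mulVf ?mul1r // gt_eqF.
by rewrite ler0_norm // scalerA -F_even -scaleNr invfM mulrAC invrN mulNr mulVf // mulN1r opprK.
Qed.

Lemma gauge0 : gauge 0 = 0.
Proof.
apply/eqP; rewrite eq_le gauge_ge0 andbT; apply: (le_trans (gauge_upper 0)).
by rewrite -(scale0r 0) nrmZ normr0 mul0r mulr0.
Qed.

Lemma gaugeZ (a : R) x : gauge (a *: x) = `|a| * gauge x.
Proof.
have [->|a0] := eqVneq a 0; first by rewrite scale0r gauge0 normr0 mul0r.
have half b y : b != 0 -> gauge (b *: y) <= `|b| * gauge y.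
  move=> b0; rewrite mulrC -ler_pdivrMr ?normr_gt0 //; apply: le_gauge => t ht.
  by rewrite ler_pdivrMr ?normr_gt0 // mulrC; apply: gauge_le; exact: gauge_setZ.
apply/eqP; rewrite eq_le half //= mulrC -ler_pdivlMr ?normr_gt0 // mulrC -normfV.
have {1}-> : x = a^-1 *: (a *: x) by rewrite scalerA mulVf // scale1r.
by apply: half; rewrite invr_neq0.
Qed.

Lemma is_norm_gauge : is_norm gauge.
Proof.
split; [exact: gaugeD|exact: gaugeZ|move=> x x0].
apply/rowP => i; rewrite mxE; apply/eqP; rewrite -normr_eq0 eq_le normr_ge0 andbT.
by apply: (le_trans (nrm_coord x i)); apply: (le_trans (gauge_lower x)); rewrite x0 mulr0.
Qed.

(** The nontrivial case is gauge x = 1, where F is at most s just before x on the ray;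
    the gradient inequality at x carries the bound over to x. *)
Lemma unit_ball_gauge : unit_ball gauge = [set x | F x <= s].
Proof.
apply/seteqP; split => x /=; rewrite /unit_ball /=; last first.
  by move=> h; apply: gauge_le; split=> //; rewrite invr1 scale1r.
move=> x1.
have h (t : R) : 1 < t -> F (t^-1 *: x) <= s.
  move=> t1; have [u hu ut] := inf_lt (has_inf_gauge_set x).1 (le_lt_trans x1 t1).
  by have [] := gauge_set_up hu (ltW ut).
rewrite leNgt; apply/negP => sF; pose d := `|std_dot (g x) x|.
have d0 : 0 <= d by exact: normr_ge0.
have D0 : 0 < F x - s by rewrite subr_gt0.
(* the point (1 - e) x of the unit ball, with e so small that e |<g x, x>| < F x - s *)
pose e := (F x - s) / (2 * (F x - s + d)).
have den : 0 < 2 * (F x - s + d) by rewrite mulr_gt0 // ltr_pwDl.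
have e0 : 0 < e by rewrite divr_gt0.
have e1 : e < 1 by rewrite ltr_pdivrMr // mul1r; move: d0 D0; clearbody d; lra.
have ed : e * d < F x - s.
  rewrite /e mulrAC ltr_pdivrMr // ltr_pM2l //; move: d0 D0; clearbody d; lra.
have e1' : 0 < 1 - e by rewrite subr_gt0.
have := h (1 - e)^-1; rewrite invf_gt1 // invrK gtrBl => /(_ e0) Fs.
have := F_grad x ((1 - e) *: x); rewrite -[X in _ *: x - X]scale1r -scalerBl std_dotZr => Fg.
have nd : - d <= - std_dot (g x) x by rewrite lerN2 ler_norm.
have := ler_wpM2l (ltW e0) nd.
move: Fs Fg ed; clearbody d e; lra.
Qed.
End Gauge.

(** * Comparison with the l_p norm *)

Section LpNorm.
Context {R : realType} (p : R) (p1 : 1 <= p) (n : nat).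
Implicit Types x : 'rV[R]_n.

Lemma powRVK (t : R) : 0 <= t -> (t `^ p) `^ p^-1 = t.
Proof. by move=> t0; rewrite -powRrM divff ?powRr1 // gt_eqF // (lt_le_trans _ p1). Qed.

Lemma powRKV (t : R) : 0 <= t -> (t `^ p^-1) `^ p = t.
Proof. by move=> t0; rewrite -powRrM mulVf ?powRr1 // gt_eqF // (lt_le_trans _ p1). Qed.

Lemma lp_norm_ge0 x : 0 <= lp_norm p x.
Proof. exact: powR_ge0. Qed.

Lemma sum_powR_ge0 x : 0 <= \sum_(i < n) `|x 0 i| `^ p.
Proof. by apply: sumr_ge0 => i _; exact: powR_ge0. Qed.

Lemma powR_lp_norm x : lp_norm p x `^ p = \sum_(i < n) `|x 0 i| `^ p.
Proof. by rewrite /lp_norm powRKV // sum_powR_ge0. Qed.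

Lemma lp_normZ (a : R) x : lp_norm p (a *: x) = `|a| * lp_norm p x.
Proof.
rewrite /lp_norm; under eq_bigr do rewrite mxE normrM powRM //.
by rewrite -mulr_sumr powRM ?powR_ge0 ?sum_powR_ge0 // powRVK.
Qed.

Lemma coord_le_lp_norm x i : `|x 0 i| <= lp_norm p x.
Proof.
rewrite -[leLHS](powRVK (normr_ge0 _)).
have p0 : 0 <= p^-1 by rewrite invr_ge0 (le_trans _ p1).
apply: ge0_ler_powR => //; rewrite ?nnegrE ?powR_ge0 ?sum_powR_ge0 //.
by rewrite (bigD1 i) //= lerDl sumr_ge0 // => j _; exact: powR_ge0.
Qed.

Lemma powR_le_self (t : R) : 0 <= t <= 1 -> t `^ p <= t.
Proof.
move=> /andP[]; rewrite le_eqVlt => /predU1P[<- _|t0 t1]; last by apply: ge1r_powR => //; rewrite t0.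
by rewrite powR0 // gt_eqF // (lt_le_trans _ p1).
Qed.

Lemma powR_ge_self (t : R) : 1 <= t -> t <= t `^ p.
Proof. by move=> t1; rewrite -[leLHS]powRr1 ?(le_trans _ t1) // ler_powR. Qed.

(** Sum the lower bound (|t| / 2)^p <= 2^p (phi t + 1) over the coordinates of c x,
    where c^p = n. *)
Lemma lp_norm_le_of_sublevel (s B : R) x : 0 <= B -> s <= B * n%:R -> (0 < n)%N ->
  scaled_Psi p (n%:R `^ p^-1) x <= s -> lp_norm p x <= 4 * (B + 1).
Proof.
move=> B0 sB n0 xs; set c := n%:R `^ p^-1 in xs.
have p0 : 0 <= p by apply: le_trans p1.
have n0' : (0 : R) < n%:R by rewrite ltr0n.
have c0 : 0 <= c by exact: powR_ge0.
have cp : c `^ p = n%:R by rewrite powRKV.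
have two0 : 0 < 2 `^ p :> R by exact: powR_gt0.
have H : n%:R * (\sum_(i < n) `|x 0 i| `^ p) <= n%:R * (2 `^ p * 2 `^ p * (B + 1)).
  have -> : n%:R * (\sum_(i < n) `|x 0 i| `^ p) = 2 `^ p * \sum_(i < n) (`|(c *: x) 0 i| / 2) `^ p.
    rewrite !mulr_sumr; apply: eq_bigr => i _.
    by rewrite mxE normrM (ger0_norm c0) -cp -!powRM ?mulr_ge0 ?divr_ge0 //; congr (_ `^ _); lra.
  rewrite -mulrA mulrCA ler_pM2l //.
  apply: (@le_trans _ _ (\sum_(i < n) 2 `^ p * (phi p ((c *: x) 0 i) + 1))).
    by apply: ler_sum => i _; exact: phi_power_lower.
  rewrite -mulr_sumr mulrCA ler_pM2l // big_split /= sumr_const card_ord.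
  have := le_trans xs sB; rewrite /scaled_Psi /Psi; lra.
rewrite -[leLHS](powRVK (lp_norm_ge0 x)) powR_lp_norm.
rewrite ler_pM2l // in H.
have B1 : 1 <= B + 1 by rewrite lerDr.
rewrite -[leRHS]powRVK; last by rewrite mulr_ge0 // addr_ge0.
apply: ge0_ler_powR; rewrite ?nnegrE ?powR_ge0 ?sum_powR_ge0 ?invr_ge0 //.
apply: (le_trans H); rewrite powRM ?addr_ge0 // -powRM // (_ : 2 * 2 = 4 :> R); last by lra.
by rewrite ler_wpM2l ?powR_ge0 // powR_ge_self.
Qed.

(** Below a / 6 the linear bound near 0 gives a / 2; above it 1 + |t| is comparable to
    |t|. *)
Lemma phi_le_mixed (a t : R) : 0 < a <= 1 -> phi p t <= a / 2 + (2 * (1 + 6 / a) * `|t|) `^ p.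
Proof.
move=> /andP[a0 a1]; have a0' : 0 <= a / 2 by rewrite divr_ge0 // ltW.
have [ta|at_] := leP `|t| (a / 6).
  apply: (@le_trans _ _ (a / 2)); last by rewrite lerDl powR_ge0.
  have t1 : `|t| <= 1 by apply: (le_trans ta); move: a1; lra.
  by apply: (le_trans (phi_small p1 t1)); move: ta; lra.
apply: (@le_trans _ _ ((2 * (1 + 6 / a) * `|t|) `^ p)); last by rewrite lerDr.
apply: (le_trans (phi_power_upper p1 t)).
have a6 : 0 <= 6 / a by rewrite divr_ge0 // ltW.
apply: ge0_ler_powR; rewrite ?nnegrE ?mulr_ge0 ?addr_ge0 //; first by apply: le_trans p1.
rewrite -mulrA ler_pM2l // mulrDl mul1r addrC lerD2l.
by rewrite mulrAC ler_pdivlMr // mul1r; move: at_; lra.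
Qed.

(** The part of phi that is at most a / 2 contributes a n / 2, and the power part
    contributes at most n (a / 2)^p. *)
Lemma sublevel_of_lp_norm_le (s a : R) x : 0 < a <= 1 -> a * n%:R <= s -> (0 < n)%N ->
  lp_norm p x <= a / (4 * (1 + 6 / a)) -> scaled_Psi p (n%:R `^ p^-1) x <= s.
Proof.
move=> a01 as_ n0; have /andP[a0 a1] := a01; set A := 1 + 6 / a => xa.
have A0 : 0 < A by rewrite ltr_pwDl // divr_ge0 // ltW.
set c := n%:R `^ p^-1.
have p0 : 0 <= p by apply: le_trans p1.
have n0' : (0 : R) < n%:R by rewrite ltr0n.
have c0 : 0 <= c by exact: powR_ge0.
have cp : c `^ p = n%:R by rewrite powRKV // ltW.
apply: le_trans as_.
apply: (@le_trans _ _ (\sum_(i < n) (a / 2 + (2 * A * `|(c *: x) 0 i|) `^ p))).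
  by apply: ler_sum => i _; exact: phi_le_mixed.
rewrite big_split /= sumr_const card_ord -[_ *+ n]mulr_natr.
have -> : \sum_(i < n) (2 * A * `|(c *: x) 0 i|) `^ p = n%:R * (2 * A * lp_norm p x) `^ p.
  rewrite powRM ?mulr_ge0 ?powR_ge0 ?(ltW A0) // powR_lp_norm !mulr_sumr; apply: eq_bigr => i _.
  rewrite mxE normrM (ger0_norm c0) -cp -!powRM ?mulr_ge0 ?(ltW A0) //; congr (_ `^ _); lra.
have h : (2 * A * lp_norm p x) `^ p <= a / 2.
  have a2 : 0 <= a / 2 <= 1 by apply/andP; split; lra.
  apply: le_trans (powR_le_self a2).
  apply: ge0_ler_powR => //; rewrite ?nnegrE ?mulr_ge0 ?powR_ge0 ?(ltW A0) ?(ltW a0) //.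
  rewrite mulrC -ler_pdivlMr ?mulr_gt0 //; apply: (le_trans xa).
  by rewrite !invfM; clearbody A; lra.
have := ler_wpM2l (ltW n0') h; lra.
Qed.
End LpNorm.

(** * The isoperimetric quotient *)

Section Boundary.
Context {R : realType} {n : nat}.

Lemma eq_gauge (F : 'rV[R]_n -> R) s x y : (forall t : R, F (t *: x) = F (t *: y)) ->
  gauge F s x = gauge F s y.
Proof. by move=> Fxy; congr inf; apply/seteqP; split=> t; rewrite /gauge_set /= Fxy. Qed.

(** A covering of B covers A. *)
Lemma le_hausdorff d (A B : set 'rV[R]_n) : A `<=` B -> (hausdorff d A <= hausdorff d B)%E.
Proof.
move=> AB; rewrite /hausdorff; apply: lee_wpmul2l.
  by rewrite mule_ge0 ?measure_ge0 // lee_fin invr_ge0 exprn_ge0.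
apply: ge_ereal_sup => _ [delta /= delta0 <-].
apply: (@le_trans _ _ (hausdorff_pre d delta B)); last by apply: ereal_sup_ubound; exists delta.
by apply: ereal_inf_le_tmp => _ [F [/= BF hF] <-]; exists F => //; split=> // x /AB /BF.
Qed.

Lemma boundary_sublevel (F : 'rV[R]_n -> R) s : continuous F ->
  boundary [set x | F x <= s] `<=` [set x | F x = s].
Proof.
move=> cF x [cx ix] /=; apply/eqP; rewrite eq_le; apply/andP; split.
  suff : closed [set x | F x <= s] by move=> cl; apply: cl.
  exact: (closed_comp (fun x _ => cF x) (@closed_le R s)).
rewrite leNgt; apply/negP => xs; apply: ix.
have : open [set x | F x < s] by exact: (open_comp (fun x _ => cF x) (@open_lt R s)).
move=> o; have xn : nbhs x [set x | F x < s] by apply: open_nbhs_nbhs; split.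
by apply: (@filterS _ (nbhs x) (nbhs_filter x)) xn => y /=; exact: ltW.
Qed.
End Boundary.

Section IsoperimetricQuotient.
Context {R : realType}.

(** With n = m + 1, V = V^(1/n) V^((n-1)/n) and V^(1/n) <= C / c. *)
Lemma iq_le (m : nat) (K : set 'rV[R]_m.+1) (V c C D : R) : 0 < V -> 0 < c -> 0 <= C -> 0 <= D ->
  vol K = V%:E -> V <= (C / c) ^+ m.+1 ->
  (hausdorff m (boundary K) <= (D * (c * V))%:E)%E -> (iq K <= (D * C)%:E)%E.
Proof.
move=> V0 c0 C0 D0 hV VC hH; rewrite /iq /= hV poweR_EFin.
set W := V `^ (m%:R / m.+1%:R); have W0 : 0 < W by exact: powR_gt0.
rewrite inver gt_eqF // lee_pdivrMr //; apply: (le_trans hH).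
rewrite -EFinM lee_fin -mulrA ler_wpM2l //.
have n0 : (0 : R) < m.+1%:R by rewrite ltr0n.
have n0' : m.+1%:R != 0 :> R by rewrite gt_eqF.
have -> : V = V `^ (m.+1%:R^-1) * W.
  rewrite /W -powRD ?(gt_eqF V0) ?implybT // -{1}[m.+1%:R^-1]mul1r -mulrDl.
  by rewrite addrC natr1 divff // powRr1 // ltW.
rewrite mulrA ler_wpM2r ?(ltW W0) // -ler_pdivlMl // mulrC.
apply: (@le_trans _ _ (((C / c) ^+ m.+1) `^ (m.+1%:R^-1))).
  by apply: ge0_ler_powR; rewrite ?nnegrE ?invr_ge0 ?(ltW V0) ?exprn_ge0 ?divr_ge0 // ltW.
have Cc : 0 <= C / c by rewrite divr_ge0 // ltW.
by rewrite -powR_mulrn // -powRrM divff // powRr1.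
Qed.

(** The norm is the gauge of n^(-1/p) K, where K is the sublevel set of Psi chosen
    above. Its unit ball has the volume c^-n v with c = n^(1/p), and the area bound is used
    with k = 1/n and sigma = a n, so that k sigma = a. *)
Lemma isoperimetric_lp_norm : exists c C : R, 0 < c /\ 0 < C /\
  forall (m : nat) (p : R), (0 < m)%N -> 1 <= p -> p <= m.+1%:R ->
  exists N : 'rV[R]_m.+1 -> R, is_norm N /\ canonically_positioned N /\
   (forall x : 'rV[R]_m.+1, c * lp_norm p x <= N x /\ N x <= C * lp_norm p x) /\
   (iq (unit_ball N) <= (C * Num.sqrt m.+1%:R)%:E)%E.
Proof.
have [a [B [C [a01 B0 C0 H]]]] := @exists_isoperimetric_level R.
have /andP[a0 a1] := a01.
pose r := a / (4 * (1 + 6 / a)); pose rr := 4 * (B + 1).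
have r0 : 0 < r by rewrite /r divr_gt0 // mulr_gt0 // ltr_pwDl // divr_ge0 // ltW.
have rr0 : 0 < rr by rewrite /rr mulr_gt0 // addr_gt0.
pose D := 8 / a * expR 2 * C; have D0 : 0 <= D by rewrite !mulr_ge0 ?expR_ge0 ?invr_ge0 ?(ltW a0) ?(ltW C0).
exists rr^-1, (r^-1 + D * C); split; first by rewrite invr_gt0.
split; first by rewrite ltr_pwDl ?invr_gt0 // mulr_ge0 // ltW.
move=> m p m0 p1 pn.
have [s [v [/andP[as_ sB] hv /andP[v0 vC] hI]]] := H p m.+1 p1 m0 pn.
have n0 : (0 : R) < m.+1%:R by rewrite ltr0n.
pose c : R := m.+1%:R `^ p^-1; have c0 : 0 < c by exact: powR_gt0.
pose F := @scaled_Psi R p m.+1 c.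
have Fg := scaled_Psi_grad p1 c (n := m.+1).
have FN := @scaled_PsiN R p m.+1 c.
have inner x : lp_norm p x <= r -> F x <= s by exact: sublevel_of_lp_norm_le.
have outer x : F x <= s -> lp_norm p x <= rr by apply: lp_norm_le_of_sublevel => //; exact: ltW.
have nZ := lp_normZ p1 (n := m.+1).
have n_ge0 := @lp_norm_ge0 R p m.+1.
have ncoord := coord_le_lp_norm p1 (n := m.+1).
have normN := is_norm_gauge Fg FN nZ ncoord n_ge0 r0 inner outer.
have lower := gauge_lower nZ n_ge0 r0 inner outer.
have upper := gauge_upper nZ n_ge0 r0 inner.
exists (gauge F s); split=> //; split.
  apply: (@canonically_positioned_of_symmetric R m (gauge F s) normN _ rr^-1).
  - by move=> e sg x injs; apply: eq_gauge => t; exact: scaled_Psi_monomial.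
  - by rewrite invr_gt0.
  - move=> x i; rewrite mulrC ler_pdivrMr // mulrC.
    by apply: le_trans (lower x); exact: ncoord.
split.
  move=> x; split; first by rewrite mulrC ler_pdivrMr // mulrC.
  apply: (le_trans (upper x)); rewrite ler_wpM2r //.
  by rewrite lerDl mulr_ge0 // ltW.
rewrite (unit_ball_gauge Fg nZ n_ge0 r0 inner).
have KE : [set x | F x <= s] = affV c 0 (sublevel p s).
  by apply/seteqP; split => x; rewrite /affV /sublevel /= addr0.
have hV : vol [set x | F x <= s] = (c ^- m.+1 * v)%:E.
  by rewrite KE (vol_aff _ c0 (measurable_sublevel p s)) hv EFinM.
have V0 : 0 < c ^- m.+1 * v by apply: mulr_gt0 v0; rewrite invr_gt0; exact: exprn_gt0.
have w0 : 0 <= Num.sqrt (m.+1%:R : R) by exact: sqrtr_ge0.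
apply: (@le_trans _ _ ((D * Num.sqrt m.+1%:R * C)%:E)); last first.
  by rewrite lee_fin mulrAC; apply: (ler_wpM2r w0); rewrite lerDr invr_ge0 ltW.
have VC : c ^- m.+1 * v <= (C / c) ^+ m.+1.
  rewrite expr_div_n [leRHS]mulrC; apply: ler_wpM2l vC.
  by rewrite invr_ge0; apply: exprn_ge0; exact: ltW.
apply: (iq_le V0 c0 (ltW C0) (mulr_ge0 D0 w0) hV VC).
have hb : (hausdorff m (boundary [set x | (F x <= s)%R]) <= hausdorff m [set x | F x = s])%E.
  by apply: le_hausdorff; apply: boundary_sublevel; exact: continuous_scaled_Psi.
apply: (le_trans hb).
have I0 : 0 < C * (Num.sqrt m.+1%:R * v) by apply: (mulr_gt0 C0); apply: mulr_gt0 v0; rewrite sqrtr_gt0.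
have k0 : 0 < m.+1%:R^-1 :> R by rewrite invr_gt0.
apply: (le_trans (hausdorff_scaled_level p1 m0 c0 k0 (mulr_gt0 a0 n0) as_ I0 hI)).
have ka : m.+1%:R^-1 * (a * m.+1%:R) = a by rewrite mulrCA mulVf ?mulr1 // gt_eqF.
rewrite lee_fin ka.
have lE : (1 + 2 * m.+1%:R^-1) ^+ m.+1 <= expR 2 :> R.
  rewrite -powR_mulrn; last by apply: addr_ge0 => //; apply: mulr_ge0 (ltW k0).
  by apply: (dilation_powR (n := m.+1) m0); rewrite (ltW n0) lexx.
rewrite expr_div_n.
move: lE; move: ((1 + 2 * _) ^+ _) => l lE.
have P0 : 0 <= 8 / a * C * (c * (c ^- m.+1 * v) * Num.sqrt m.+1%:R).
  by rewrite !mulr_ge0 ?invr_ge0 ?exprn_ge0 ?(ltW a0) ?(ltW C0) ?(ltW c0) ?(ltW v0).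
have := ler_wpM2l P0 lE; rewrite /D.
move: (c ^- m.+1) (Num.sqrt _) (expR 2) (8 / a) => ci w e b; clear; lra.
Qed.
End IsoperimetricQuotient.

Theorem theorem48 (R : realType) :
  exists c C : R, 0 < c /\ 0 < C /\
    forall (n : nat) (p : R), (0 < n)%N -> 1 <= p ->
      (exists m : nat, (m %| n)%N /\ Num.max p 2 <= m%:R /\ m%:R <= expR p) ->
      exists N : 'rV[R]_n -> R,
        is_norm N /\ canonically_positioned N /\
        (forall x : 'rV[R]_n, c * lp_norm p x <= N x /\ N x <= C * lp_norm p x) /\
        (iq (unit_ball N) <= (C * Num.sqrt n%:R)%:E)%E.
Proof.
have [c [C [c0 [C0 H]]]] := @isoperimetric_lp_norm R.
exists c, C; split=> //; split=> // n p n0 p1 [m [mn [mp _]]].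
have [pm m2] : p <= m%:R /\ (2 <= m)%N.
  by move: mp; rewrite ge_max => /andP[-> ]; rewrite ler_nat.
have mlen : (m <= n)%N by exact: dvdn_leq.
case: n => // n in n0 mn mlen *.
apply: H => //; first by rewrite -ltnS; exact: leq_trans mlen.
by apply: le_trans pm _; rewrite ler_nat.
Qed.
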